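(* Let $f:\mathbb{R}^d\to\mathbb{R}$, $f(x)=\mathbb{E}_{\xi\sim\Xi(x)}[F(x;\xi)]$, be bounded below, $L$-Lipschitz continuous, and twice differentiable with $L_H$-Lipschitz Hessian: $\|\nabla^2 f(x)-\nabla^2 f(y)\|\le L_H\|x-y\|$ for all $x,y$. Suppose the stochastic zeroth-order oracle (SZO) satisfies $\mathbb{E}_{\xi\sim\Xi(x)}[F(x;\xi)]=f(x)$ and $\mathbb{E}_{\xi\sim\Xi(x)}[|F(x;\xi)-f(x)|^2]\le\sigma^2$ for all $x\in\mathbb{R}^d$. Let $\delta=\sqrt{\frac{\epsilon}{2L_H}}$. Then the algorithm ZO-O2NC (described in the context) with smoothing radius $\delta$, with either Option I or Option II and suitable choices of its remaining inputs $M,K,\eta$, finds an $\epsilon$-stationary point of $f$ in expectation, i.e. its output $\bar y_{k_{\rm out}}$ satisfies $\mathbb{E}[\|\nabla f(\bar y_{k_{\rm out}})\|]\le\epsilon$, using $$N_{\rm SZO}=\mathcal{O}(d^2\epsilon^{-9/2})$$ SZO calls.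
   Context: Notation. $\|\cdot\|$ is the Euclidean norm (operator norm for matrices), $\mathbb{B}(x,r)$ the closed ball of radius $r$ about $x$, $\mathbb{S}^{d-1}$ the unit sphere in $\mathbb{R}^d$, $\Pi_S$ Euclidean projection onto a closed convex set $S$. For each $x\in\mathbb{R}^d$, $\Xi(x)$ is a probability distribution depending on $x$. An SZO call at a point $x$ draws $\xi\sim\Xi(x)$ and returns $F(x;\xi)$; conditionally on its query point, each call is independent of all previous randomness and of the other calls. Constants: $L,L_H>0$, $\sigma\ge0$. A point $x$ is $\epsilon$-stationary if $\|\nabla f(x)\|\le\epsilon$. Algorithm ZO-O2NC. Inputs: smoothing radius $\delta>0$, block length $M\in\mathbb{N}$, number of blocks $K\in\mathbb{N}$, stepsize $\eta>0$, Option I or II. Set $D=\delta/M$, $T=KM$, $x_0=0$. (Option II only: set $y_0=0$, sample $u_0\sim\mathrm{Unif}(\mathbb{S}^{d-1})$, $\xi_0\sim\Xi(y_0+\delta u_0)$, and query $F(y_0+\delta u_0;\xi_0)$.) For $k=1,\dots,K$: set $\Delta_{(k-1)M+1}=0$; for $m=1,\dots,M$, with $t=(k-1)M+m$: sample $s_t\sim\mathrm{Unif}[0,1]$; set $y_t=x_{t-1}+s_t\Delta_t$ and $x_t=x_{t-1}+\Delta_t$; sample $u_t\sim\mathrm{Unif}(\mathbb{S}^{d-1})$; construct $g_t$; if $m<M$ set $\Delta_{t+1}=\Pi_{\mathbb{B}(0,D)}(\Delta_t-\eta g_t)$. All $s_t,u_t$ are fresh independent samples. Here - Option I: $g_t=\frac{d}{2\delta}\big(F(y_t+\delta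 u_t;\xi_t^+)-F(y_t-\delta u_t;\xi_t^-)\big)u_t$ with $\xi_t^\pm\sim\Xi(y_t\pm\delta u_t)$ drawn independently of each other (two SZO calls per iteration); - Option II: $g_t=\frac{d}{\delta}\big(F(y_t+\delta u_t;\xi_t)-F(y_{t-1}+\delta u_{t-1};\xi_{t-1})\big)u_t$ with $\xi_t\sim\Xi(y_t+\delta u_t)$; the second value is reused from the previous iteration (one new SZO call per iteration). Output: sample $k_{\rm out}\sim\mathrm{Unif}\{1,\dots,K\}$ independently and return $\bar y_{k_{\rm out}}=\frac1M\sum_{t=(k_{\rm out}-1)M+1}^{k_{\rm out}M}y_t$. $\mathcal{O}(\cdot)$ hides a constant depending only on $\gamma=f(x_0)-\inf f$, $\sigma$, $L$, $L_H$ (not on $d$ or $\epsilon$), and is understood for all sufficiently small $\epsilon>0$. *)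

(* Defs.v *)
From HB Require Import structures.
From mathcomp Require Import all_boot all_order all_algebra.
From mathcomp Require Import all_classical all_reals all_analysis.

Set Implicit Arguments.
Unset Strict Implicit.
Unset Printing Implicit Defensive.

Import Order.TTheory GRing.Theory Num.Theory.
Import numFieldNormedType.Exports.

Local Open Scope classical_set_scope.
Local Open Scope ring_scope.

(** * Euclidean geometry of ['rV[R]_d] *)

(* The library's norm [`|x|] on matrices is the sup norm, so the Euclidean
   norm is introduced separately; both induce the same topology, hence the
   same notions of differentiability and the same Borel sets. *)
Definition enorm (R : realType) (d : nat) (x : 'rV[R]_d) : R :=
  Num.sqrt (\sum_(i < d) x 0 i ^+ 2).

Definition opnorm (R : realType) (d : nat) (A : 'M[R]_d) : R :=
  sup [set enorm (v *m A) | v in [set v : 'rV[R]_d | enorm v <= 1]].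

Definition ecball (R : realType) (d : nat) (x : 'rV[R]_d) (r : R) :
  set 'rV[R]_d := [set y | enorm (y - x) <= r].

Definition esphere (R : realType) (d : nat) : set 'rV[R]_d :=
  [set x | enorm x = 1].

(* The nearest point of [S] to [v] (unique when [S] is closed, convex and
   nonempty). *)
Definition eproj (R : realType) (d : nat) (S : set 'rV[R]_d) (v : 'rV[R]_d) :
  'rV[R]_d :=
  xget 0 [set p | S p /\ forall q, S q -> enorm (v - p) <= enorm (v - q)].

(** * Gradient and Hessian *)

Definition grad (R : realType) (d : nat) (f : 'rV[R]_d -> R) (x : 'rV[R]_d) :
  'rV[R]_d := \row_i 'D_(delta_mx 0 i) f x.

Definition hess (R : realType) (d : nat) (f : 'rV[R]_d -> R) (x : 'rV[R]_d) :
  'M[R]_d := jacobian (grad f) x.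

Definition twice_differentiable (R : realType) (d : nat) (f : 'rV[R]_d -> R) :=
  forall x : 'rV[R]_d, differentiable f x /\ differentiable (grad f) x.

(** * Borel sets of [R^d] and the uniform laws *)

Fact mx_borel_display : measure_display. Proof. exact: default_measure_display. Qed.

HB.instance Definition _ (R : realType) (m n : nat) :=
  @isMeasurable.Build mx_borel_display 'M[R]_(m, n)
    <<s [set A : set 'M[R]_(m, n) | open A] >>
    (@sigma_algebra0 _ setT _) (@sigma_algebraC _ _)
    (@sigma_algebra_bigcup _ setT _).

(* Unif(S^(d-1)): the rotation-invariant Borel probability carried by the unit
   sphere (it is unique); [x *m Q] with [Q] orthogonal is an isometry. *)
Definition uniform_on_sphere (R : realType) (d : nat)
    (mu : probability 'rV[R]_d R) : Prop :=
  mu (@esphere R d) = 1%E /\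
  forall Q : 'M[R]_d, Q *m Q^T = 1%:M ->
  forall A : set 'rV[R]_d, measurable A ->
    mu ((fun x => x *m Q) @^-1` A) = mu A.

Definition uniform_upto (R : realType) (K : nat) (B : set nat) : \bar R :=
  ((K%:R^-1)%:E * \sum_(1 <= k < K.+1) \d_k B)%E.

(** * The stochastic zeroth-order oracle *)

Record is_szo (R : realType) (d : nat) (dX : measure_display)
    (X : measurableType dX) (f : 'rV[R]_d -> R) (F : 'rV[R]_d -> X -> R)
    (Xi : R.-pker 'rV[R]_d ~> X) (sigma : R) : Prop := IsSZO {
  szo_measurable : measurable_fun setT (fun p : 'rV[R]_d * X => F p.1 p.2);
  szo_mean : forall x, (\int[Xi x]_xi (F x xi)%:E)%E = (f x)%:E;
  szo_variance : forall x,
    (\int[Xi x]_xi (`|F x xi - f x| ^+ 2)%:E <= (sigma ^+ 2)%:E)%E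
}.

(** * ZO-O2NC *)

Inductive zo_option := OptionI | OptionII.

Record zo_input (R : realType) := ZOInput {
  zo_opt : zo_option;
  radius : R;
  block_length : nat;
  num_blocks : nat;
  stepsize : R
}.

Definition horizon (R : realType) (p : zo_input R) : nat :=
  (num_blocks p * block_length p)%N.

(* Option I makes two oracle calls per iteration; Option II makes one before
   the first iteration and then one per iteration. *)
Definition szo_calls (R : realType) (p : zo_input R) : nat :=
  match zo_opt p with
  | OptionI => (2 * horizon p)%N
  | OptionII => (1 + horizon p)%N
  end.

(* The random draws of a run, as random elements on [Omega] indexed by the
   iteration [t]. Under Option I, [draw_xi t] and [draw_xi' t] are xi_t^+ and
   xi_t^-. Under Option II, [draw_xi t] is xi_t and [draw_xi'] is not used;
   only that option uses [draw_u 0] and [draw_xi 0]. *)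
Record zo_draws (R : realType) (d : nat) (X Omega : Type) := ZODraws {
  draw_s : nat -> Omega -> R;
  draw_u : nat -> Omega -> 'rV[R]_d;
  draw_xi : nat -> Omega -> X;
  draw_xi' : nat -> Omega -> X;
  draw_k : Omega -> nat
}.

(* The estimator [g_t] at [y = y_t], where [yprev = y_(t-1)]. *)
Definition zo_grad (R : realType) (d : nat) (X Omega : Type)
    (p : zo_input R) (F : 'rV[R]_d -> X -> R) (z : zo_draws R d X Omega)
    (w : Omega) (t : nat) (yprev y : 'rV[R]_d) : 'rV[R]_d :=
  let delta := radius p in
  let u := draw_u z t w in
  match zo_opt p with
  | OptionI =>
      (d%:R / (2 * delta) * (F (y + delta *: u) (draw_xi z t w)
                             - F (y - delta *: u) (draw_xi' z t w))) *: u
  | OptionII =>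
      (d%:R / delta * (F (y + delta *: u) (draw_xi z t w)
                       - F (yprev + delta *: draw_u z t.-1 w)
                           (draw_xi z t.-1 w))) *: u
  end.

(* The triple [(x_t, Delta_(t+1), y_t)]. An iteration [t] closes its block
   ([m = M]) exactly when [M] divides [t]; the next block then starts with
   increment 0. *)
Fixpoint zo_state (R : realType) (d : nat) (X Omega : Type)
    (p : zo_input R) (F : 'rV[R]_d -> X -> R) (z : zo_draws R d X Omega)
    (w : Omega) (t : nat) : 'rV[R]_d * 'rV[R]_d * 'rV[R]_d :=
  match t with
  | 0 => (0, 0, 0)
  | t'.+1 =>
      let: (x, Delta, yprev) := zo_state p F z w t' in
      let y := x + draw_s z t w *: Delta in
      let g := zo_grad p F z w t yprev y in
      let D := radius p / (block_length p)%:R in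
      let Delta' := if (block_length p %| t)%N then 0
                    else eproj (ecball 0 D) (Delta - stepsize p *: g) in
      (x + Delta, Delta', y)
  end.

Definition zo_y (R : realType) (d : nat) (X Omega : Type)
    (p : zo_input R) (F : 'rV[R]_d -> X -> R) (z : zo_draws R d X Omega)
    (t : nat) (w : Omega) : 'rV[R]_d := (zo_state p F z w t).2.

Definition zo_output (R : realType) (d : nat) (X Omega : Type)
    (p : zo_input R) (F : 'rV[R]_d -> X -> R) (z : zo_draws R d X Omega)
    (w : Omega) : 'rV[R]_d :=
  let M := block_length p in
  let k := draw_k z w in
  M%:R^-1 *: \sum_((k.-1 * M).+1 <= t < (k * M).+1) zo_y p F z t w.

(** * The joint law of the draws *)

Definition events_of (d : measure_display) (T : measurableType d)
    (Omega : Type) (Y : Omega -> T) : set (set Omega) :=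
  preimage_set_system setT Y measurable.

(* [Y] is a random element whose conditional law given the sigma-algebra
   generated by [G] is [kappa]. When [kappa] is constant, this says that [Y]
   has law [kappa] and is independent of [G]. *)
Definition has_cond_law (R : realType) (dO d : measure_display)
    (Omega : measurableType dO) (T : measurableType d)
    (P : probability Omega R) (G : set (set Omega)) (Y : Omega -> T)
    (kappa : Omega -> set T -> \bar R) : Prop :=
  measurable_fun setT Y /\
  forall (E : set Omega) (B : set T), <<s G >> E -> measurable B ->
    P (E `&` Y @^-1` B) = (\int[P]_(w in E) kappa w B)%E.

(* Generators of the sigma-algebra of all the draws made up to and including
   iteration [t]. *)
Fixpoint zo_past (R : realType) (d : nat) (dX : measure_display)
    (X : measurableType dX) (Omega : Type) (opt : zo_option)
    (z : zo_draws R d X Omega) (t : nat) : set (set Omega) :=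
  match t with
  | 0 => match opt with
         | OptionI => set0
         | OptionII => events_of (draw_u z 0) `|` events_of (draw_xi z 0)
         end
  | t'.+1 =>
      zo_past opt z t' `|` events_of (draw_s z t) `|` events_of (draw_u z t)
      `|` events_of (draw_xi z t)
      `|` match opt with
          | OptionI => events_of (draw_xi' z t)
          | OptionII => set0
          end
  end.

(* The sampling rules of ZO-O2NC, in the order in which the draws are made;
   each draw is conditioned on all the earlier ones. [mu] is Unif(S^(d-1)). *)
Record zo_sampling (R : realType) (d : nat) (dX dO : measure_display)
    (X : measurableType dX) (Omega : measurableType dO)
    (P : probability Omega R) (mu : probability 'rV[R]_d R)
    (F : 'rV[R]_d -> X -> R) (Xi : R.-pker 'rV[R]_d ~> X)
    (p : zo_input R) (z : zo_draws R d X Omega) : Prop := ZOSampling {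
  zo_law_u0 : zo_opt p = OptionII ->
    has_cond_law P set0 (draw_u z 0) (fun _ => mu);
  zo_law_xi0 : zo_opt p = OptionII ->
    has_cond_law P (events_of (draw_u z 0)) (draw_xi z 0)
      (fun w => Xi (zo_y p F z 0 w + radius p *: draw_u z 0 w));
  zo_law_s : forall t, (1 <= t <= horizon p)%N ->
    has_cond_law P (zo_past (zo_opt p) z t.-1)
      (draw_s z t) (fun _ => uniform_prob (@ltr01 R));
  zo_law_u : forall t, (1 <= t <= horizon p)%N ->
    has_cond_law P
      (zo_past (zo_opt p) z t.-1 `|` events_of (draw_s z t))
      (draw_u z t) (fun _ => mu);
  zo_law_xi : forall t, (1 <= t <= horizon p)%N ->
    has_cond_law P
      (zo_past (zo_opt p) z t.-1 `|` events_of (draw_s z t)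
       `|` events_of (draw_u z t))
      (draw_xi z t)
      (fun w => Xi (zo_y p F z t w + radius p *: draw_u z t w));
  zo_law_xi' : zo_opt p = OptionI -> forall t, (1 <= t <= horizon p)%N ->
    has_cond_law P
      (zo_past (zo_opt p) z t.-1 `|` events_of (draw_s z t)
       `|` events_of (draw_u z t) `|` events_of (draw_xi z t))
      (draw_xi' z t)
      (fun w => Xi (zo_y p F z t w - radius p *: draw_u z t w));
  zo_law_k :
    has_cond_law P (zo_past (zo_opt p) z (horizon p)) (draw_k z)
      (fun _ => uniform_upto R (num_blocks p))
}.

(* Main.v *)
Require Import Defs.
From HB Require Import structures.
From mathcomp Require Import all_boot all_order all_algebra.
From mathcomp Require Import all_classical all_reals all_analysis.
From mathcomp Require Import measurable_realfun.
From mathcomp Require Import ring lra.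

Set Implicit Arguments.
Unset Strict Implicit.
Unset Printing Implicit Defensive.

Import Order.TTheory GRing.Theory Num.Theory.
Import numFieldNormedType.Exports.

Local Open Scope classical_set_scope.
Local Open Scope ring_scope.

(** Notation of this comment: [delta] is the smoothing radius, [D = delta / M]
the largest increment, [b = LH * delta ^ 2 / 2], which equals [eps / 4] for the
radius of the theorem, and E is the expectation.

Each [y_t] is uniform on the segment from [x_(t-1)] to [x_t = x_(t-1) + Delta_t],
so the mean of <grad f (y_t), Delta_t> is exactly the mean increment of [f] along
that segment ([segment_expectation]). Inside a block the [Delta_t] are the
iterates of projected online gradient descent in the ball of radius [D], fed
with the [g_t]. Comparing them with the constant increment of length [D] that
points against the sum of the gradients of the block shows that [D] times the
norm of this sum is at most the decrease of [f] over the block, plus the regret,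
plus errors coming from [g_t - grad f (y_t)] ([block_regret]). The points of a
block stay within [delta] of its start, so, the Hessian being Lipschitz, the
gradient at their mean is within [b] of the mean of their gradients
([grad_average]): the output is controlled by the sums just bounded.

The estimators are biased, but little: for every vector [Z] known before the
direction [u_t] is drawn, E <g_t - grad f (y_t), Z> is at most [b * E |Z|]
([estimator_bias]). It matters that [b] is free of the dimension; this comes from
a reflection. The function
[h z = (f (y + z) - f (y - z)) / 2 - <grad f y, z>] is [b]-Lipschitz on the ball of
radius [delta] ([odd_part_lipschitz]). Reflecting [u] in the hyperplane
orthogonal to [Z] changes the sign of <u, Z> and moves [u] by
[2 * |<u, Z>| / |Z|], so the mean of [h (delta u) * <u, Z>] is at most
[b * delta / |Z|] times the mean of <u, Z> ^ 2, that is [b * delta * |Z| / d]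
([sphere_central_bias]). Both this step and the second moments of the uniform law
on the sphere rest on its invariance under orthogonal matrices.

Both [g_t] and [g_t - grad f (y_t)] have second moment at most [B ^ 2], which is
of order [d ^ 2 / eps] ([estimator_L2]). Expanding the squared norm
of the partial sums of [g_t - grad f (y_t)] gives a recursion whose cross terms
are governed by the bias, so the sum over a block has mean norm at most
[b * M + B * sqrt M] ([drift_sum_enorm]).

Summing over the blocks, the decreases of [f] telescope, and the expected norm
of the gradient at the output is at most
[gamma / (delta * K) + 2 * B / sqrt M + 3 * b] for the stepsize [D / (B * sqrt M)],
which balances the two terms of the regret ([expected_gradient_bound]). With [M] of
order [B ^ 2 / eps ^ 2] and [K] of order [gamma / (delta * eps)] the first two
terms are at most [eps / 8] each, and [K * M] is of order [d ^ 2 * eps ^ (- 9 / 2)].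

The draws are only known through their conditional laws given the past. The
passage from these laws to iterated integrals is [disintegration]: the joint law
of the past and the new draw agrees with the composition of kernels on
rectangles, hence everywhere. *)

(** * Euclidean geometry and projected gradient steps *)

Section euclid.
Context {R : realType} {d : nat}.
Implicit Types (x y z u : 'rV[R]_d).

Definition dot x y : R := \sum_i x 0 i * y 0 i.

Lemma dotC x y : dot x y = dot y x.
Proof. by apply: eq_bigr => i _; rewrite mulrC. Qed.

Lemma dotDl x y z : dot (x + y) z = dot x z + dot y z.
Proof. by rewrite -big_split; apply: eq_bigr => i _; rewrite mxE mulrDl. Qed.

Lemma dotDr x y z : dot z (x + y) = dot z x + dot z y.
Proof. by rewrite dotC dotDl !(dotC z). Qed.

Lemma dotZl a x y : dot (a *: x) y = a * dot x y.
Proof. by rewrite mulr_sumr; apply: eq_bigr => i _; rewrite mxE mulrA. Qed.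

Lemma dotZr a x y : dot x (a *: y) = a * dot x y.
Proof. by rewrite dotC dotZl dotC. Qed.

Lemma dotNl x y : dot (- x) y = - dot x y.
Proof. by rewrite -scaleN1r dotZl mulN1r. Qed.

Lemma dotNr x y : dot x (- y) = - dot x y.
Proof. by rewrite dotC dotNl dotC. Qed.

Lemma dotBl x y z : dot (x - y) z = dot x z - dot y z.
Proof. by rewrite dotDl dotNl. Qed.

Lemma dotBr x y z : dot z (x - y) = dot z x - dot z y.
Proof. by rewrite dotDr dotNr. Qed.

Lemma dot0l x : dot 0 x = 0.
Proof. by rewrite -(scale0r 0) dotZl mul0r. Qed.

Lemma dot0r x : dot x 0 = 0.
Proof. by rewrite dotC dot0l. Qed.

Lemma dot_suml (I : Type) (s : seq I) (Q : pred I) (F : I -> 'rV[R]_d) x :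
  dot (\sum_(i <- s | Q i) F i) x = \sum_(i <- s | Q i) dot (F i) x.
Proof.
by apply: (big_morph (fun y => dot y x)); [move=> a b; rewrite dotDl|rewrite dot0l].
Qed.

Lemma enorm_ge0 x : 0 <= enorm x. Proof. exact: sqrtr_ge0. Qed.

Lemma dotxx_ge0 x : 0 <= dot x x.
Proof. by apply: sumr_ge0 => i _; rewrite -expr2 sqr_ge0. Qed.

Lemma enorm_sqr x : enorm x ^+ 2 = dot x x.
Proof.
rewrite sqr_sqrtr; first by apply: eq_bigr => i _; rewrite expr2.
by apply: sumr_ge0 => i _; rewrite sqr_ge0.
Qed.

Lemma enormE x : enorm x = Num.sqrt (dot x x).
Proof. by rewrite -enorm_sqr sqrtr_sqr ger0_norm// enorm_ge0. Qed.

Lemma enormZ a x : enorm (a *: x) = `|a| * enorm x.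
Proof.
by rewrite !enormE dotZl dotZr mulrA -expr2 sqrtrM ?sqr_ge0// sqrtr_sqr.
Qed.

Lemma enormN x : enorm (- x) = enorm x.
Proof. by rewrite -scaleN1r enormZ normrN1 mul1r. Qed.

Lemma enorm0 : enorm (0 : 'rV[R]_d) = 0.
Proof. by rewrite -(scale0r 0) enormZ normr0 mul0r. Qed.

Lemma enorm_eq0 x : (enorm x == 0) = (x == 0).
Proof.
apply/idP/eqP => [|->]; last by rewrite enorm0.
rewrite -sqrf_eq0 enorm_sqr psumr_eq0; last first.
  by move=> i _; rewrite -expr2 sqr_ge0.
move=> /allP h; apply/rowP => i; have := h i (mem_index_enum i).
by rewrite -expr2 sqrf_eq0 mxE => /eqP.
Qed.

Lemma dot_le x y : dot x y <= enorm x * enorm y.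
Proof.
have [->|x0] := eqVneq x 0; first by rewrite dot0l enorm0 mul0r.
have [->|y0] := eqVneq y 0; first by rewrite dot0r enorm0 mulr0.
have nx : 0 < enorm x by rewrite lt_neqAle enorm_ge0 eq_sym enorm_eq0 x0.
have ny : 0 < enorm y by rewrite lt_neqAle enorm_ge0 eq_sym enorm_eq0 y0.
have := dotxx_ge0 (enorm y *: x - enorm x *: y).
rewrite dotBl !dotBr !dotZl !dotZr (dotC y x) -!enorm_sqr => h.
have : 0 <= (enorm x * enorm y) * (enorm x * enorm y - dot x y) by nra.
by rewrite pmulr_rge0 ?mulr_gt0// subr_ge0.
Qed.

Lemma dot_abs_le x y : `|dot x y| <= enorm x * enorm y.
Proof.
by rewrite ler_norml dot_le andbT lerNl -dotNl (le_trans (dot_le _ _))// enormN.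
Qed.

Lemma enormD x y : enorm (x + y) <= enorm x + enorm y.
Proof.
rewrite -(@ler_pXn2r _ 2%N)// ?nnegrE ?addr_ge0 ?enorm_ge0//.
rewrite enorm_sqr dotDl !dotDr (dotC y x) -!enorm_sqr.
by have := dot_le x y; nra.
Qed.

Lemma enormB x y : enorm (x - y) <= enorm x + enorm y.
Proof. by rewrite (le_trans (enormD _ _))// enormN. Qed.

Lemma enorm_distC x y : enorm (x - y) = enorm (y - x).
Proof. by rewrite -enormN opprB. Qed.

Lemma enorm_sum (I : Type) (s : seq I) (Q : pred I) (F : I -> 'rV[R]_d) :
  enorm (\sum_(i <- s | Q i) F i) <= \sum_(i <- s | Q i) enorm (F i).
Proof.
elim/big_ind2 : _ => [|x a y b xa yb|//]; first by rewrite enorm0.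
by rewrite (le_trans (enormD _ _))// lerD.
Qed.

(** The dual form of the norm, through which all vector estimates are reduced to
scalar ones in a fixed direction. *)
Lemma enorm_le_dual x c : 0 <= c ->
  (forall w, dot x w <= c * enorm w) -> enorm x <= c.
Proof.
move=> c0 h; have [->|x0] := eqVneq x 0; first by rewrite enorm0.
have nx : 0 < enorm x by rewrite lt_neqAle enorm_ge0 eq_sym enorm_eq0 x0.
by have := h x; rewrite -enorm_sqr expr2 ler_pM2r.
Qed.

Lemma enorm_sqrD_le x y : enorm (x + y) ^+ 2 <= 2 * enorm x ^+ 2 + 2 * enorm y ^+ 2.
Proof.
have := dotxx_ge0 (x - y); rewrite !enorm_sqr.
rewrite dotBl dotDl !dotBr !dotDr (dotC y x); lra.
Qed.

(** The closed form of the projection onto the ball; unlike [eproj], which is an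
arbitrary choice of a minimiser, it is visibly measurable. *)
Definition clip (D : R) x := if enorm x <= D then x else (D / enorm x) *: x.

Lemma enorm_clip D x : 0 <= D -> enorm (clip D x) <= D.
Proof.
move=> D0; rewrite /clip; case: (leP (enorm x)) => // xD.
have nx : 0 < enorm x by exact: le_lt_trans xD.
by rewrite enormZ ger0_norm ?divr_ge0// ?(ltW nx)// divfK// gt_eqF.
Qed.

(** Outside the ball [x - clip D x] is a nonnegative multiple of [x], and Cauchy-Schwarz
bounds [dot x u] by [D * enorm x = dot x (D / enorm x *: x)]. *)
Lemma clip_variational D x u : 0 <= D -> enorm u <= D ->
  0 <= dot (x - clip D x) (clip D x - u).
Proof.
move=> D0 uD; rewrite /clip; case: (leP (enorm x)) => xD.
  by rewrite subrr dot0l.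
have nx : 0 < enorm x by exact: le_lt_trans xD.
rewrite -{1}(scale1r x) -scalerBl dotZl mulr_ge0//.
  by rewrite subr_ge0 ler_pdivrMr// mul1r ltW.
rewrite dotBr dotZr -enorm_sqr subr_ge0 expr2 mulrA divfK ?gt_eqF//.
by rewrite (le_trans (dot_le _ _))// mulrC ler_wpM2r// ltW.
Qed.

(** Gives at once that [clip D x] is the unique nearest point and that projecting
does not increase the distance to points of the ball. *)
Lemma clip_pythagoras D x u : 0 <= D -> enorm u <= D ->
  enorm (x - clip D x) ^+ 2 + enorm (clip D x - u) ^+ 2 <= enorm (x - u) ^+ 2.
Proof.
move=> D0 uD; have := clip_variational x D0 uD; set p := clip D x => h.
have -> : x - u = (x - p) + (p - u) by rewrite addrA subrK.
move: (x - p) (p - u) h => a b h.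
by rewrite !enorm_sqr dotDl !dotDr (dotC b); lra.
Qed.

Lemma eproj_ball D x : 0 <= D -> eproj (ecball 0 D) x = clip D x.
Proof.
move=> D0; have pD : ecball 0 D (clip D x).
  by rewrite /ecball /= subr0 enorm_clip.
rewrite /eproj; set Q := [set p | _].
have : Q (xget 0 Q).
  apply: xgetPex; exists (clip D x); split => // q; rewrite /ecball /= subr0 => qD.
  rewrite -(@ler_pXn2r _ 2%N)// ?nnegrE ?enorm_ge0//.
  by apply: le_trans (clip_pythagoras x D0 qD); rewrite lerDl sqr_ge0.
move: (xget 0 Q) => p [+ pmin]; rewrite /ecball /= subr0 => pball.
have := pmin _ pD; rewrite -(@ler_pXn2r _ 2%N)// ?nnegrE ?enorm_ge0// => h.
have h' := clip_pythagoras x D0 pball.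
have : enorm (p - clip D x) ^+ 2 <= 0.
  rewrite -(lerD2l (enorm (x - clip D x) ^+ 2)) addr0 (enorm_distC p).
  exact: le_trans h' h.
by rewrite real_exprn_even_le0// ?num_real//= enorm_eq0 subr_eq0 => /eqP.
Qed.

(** The classical telescoping of the squared distances to the comparator [u]. The
last step of a block is never projected, so its distance is simply dropped. *)
Lemma ogd_regret (D eta : R) (M : nat) (Delta g : nat -> 'rV[R]_d) u :
  0 <= D -> 0 < eta -> enorm u <= D -> Delta 0%N = 0 ->
  (forall i, (i.+1 < M)%N -> Delta i.+1 = clip D (Delta i - eta *: g i)) ->
  \sum_(i < M) dot (g i) (Delta i - u) <=
  D ^+ 2 / (2 * eta) + eta / 2 * \sum_(i < M) enorm (g i) ^+ 2.
Proof.
move=> D0 eta0 uD De0 DeS.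
have step i : 2 * eta * dot (g i) (Delta i - u) =
    enorm (Delta i - u) ^+ 2 + eta ^+ 2 * enorm (g i) ^+ 2
    - enorm (Delta i - eta *: g i - u) ^+ 2.
  rewrite (addrAC (Delta i)); move: (Delta i - u) => a.
  by rewrite !enorm_sqr dotBl !dotBr !dotZl !dotZr (dotC a); ring.
have key n : (n <= M)%N ->
    2 * eta * \sum_(i < n) dot (g i) (Delta i - u) +
      (if (n < M)%N then enorm (Delta n - u) ^+ 2 else 0) <=
    D ^+ 2 + eta ^+ 2 * \sum_(i < n) enorm (g i) ^+ 2.
  elim: n => [|n IH] nM.
    rewrite !big_ord0 !mulr0 add0r addr0; case: ifP => _; last exact: sqr_ge0.
    by rewrite De0 sub0r enormN lerXn2r ?nnegrE ?enorm_ge0.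
  have := IH (ltnW nM); rewrite nM !big_ord_recr/= !mulrDr step.
  have : (if (n.+1 < M)%N then enorm (Delta n.+1 - u) ^+ 2 else 0) <=
      enorm (Delta n - eta *: g n - u) ^+ 2.
    case: ifP => [nM'|_]; last exact: sqr_ge0.
    have := clip_pythagoras (Delta n - eta *: g n) D0 uD.
    rewrite DeS//; set a := enorm (_ - clip _ _).
    by have := sqr_ge0 a; lra.
  set a := (if _ then _ else _); set b := enorm (_ - eta *: _ - u) ^+ 2.
  set c := enorm _ ^+ 2; set s := \sum_(i < n) dot _ _.
  set t := \sum_(i < n) _ ^+ 2; set e := enorm _ ^+ 2.
  by move: a b c s t e => a b c s t e; lra.
have := key M (leqnn M); rewrite ltnn addr0 => h.
have e2 : 0 < 2 * eta by rewrite mulr_gt0.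
rewrite -(ler_pM2l e2).
apply: le_trans h _; rewrite le_eqVlt; apply/orP; left; apply/eqP.
by field; rewrite gt_eqF.
Qed.

(** The regret bound against the comparator of norm [D] opposite to the sum of
the [v i], for which [- dot (\sum v i) u] is [D] times the norm of that sum. *)
Lemma block_regret (D eta : R) (M : nat) (Delta g v : nat -> 'rV[R]_d) :
  0 <= D -> 0 < eta -> Delta 0%N = 0 ->
  (forall i, (i.+1 < M)%N -> Delta i.+1 = clip D (Delta i - eta *: g i)) ->
  D * enorm (\sum_(i < M) v i) <=
  - \sum_(i < M) dot (v i) (Delta i)
  + (D ^+ 2 / (2 * eta) + eta / 2 * \sum_(i < M) enorm (g i) ^+ 2)
  + \sum_(i < M) dot (v i - g i) (Delta i)
  + D * enorm (\sum_(i < M) (g i - v i)).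
Proof.
move=> D0 eta0 De0 DeS; set V := \sum_(i < M) v i.
pose u := - ((D / enorm V) *: V).
have uD : enorm u <= D.
  rewrite enormN enormZ ger0_norm ?divr_ge0 ?enorm_ge0//.
  have [->|V0] := eqVneq (enorm V) 0; first by rewrite mulr0.
  by rewrite divfK.
have uV : - dot V u = D * enorm V.
  rewrite dotNr opprK dotZr -enorm_sqr expr2.
  have [->|V0] := eqVneq (enorm V) 0; first by rewrite !mulr0.
  by rewrite mulrA divfK.
have h := ogd_regret D0 eta0 uD De0 DeS.
have CS : dot (\sum_(i < M) (g i - v i)) u <= D * enorm (\sum_(i < M) (g i - v i)).
  by rewrite (le_trans (dot_le _ _))// mulrC ler_wpM2r ?enorm_ge0.
rewrite -uV; apply: (@le_trans _ _ (- \sum_(i < M) dot (v i) (Delta i)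
  + \sum_(i < M) dot (g i) (Delta i - u)
  + \sum_(i < M) dot (v i - g i) (Delta i)
  + dot (\sum_(i < M) (g i - v i)) u)).
  rewrite /V !dot_suml -!sumrN -!big_split/=; apply: ler_sum => i _.
  by rewrite !dotBl dotBr; lra.
by move: h CS; lra.
Qed.

End euclid.

(** * Borel measurability of vector-valued functions *)

Section borel_rV.
Context {R : realType} {d : nat}.
Implicit Types (A : set 'rV[R]_d).

Let box (q : 'rV[rat]_d) (n : nat) : set 'rV[R]_d :=
  [set x | forall i, `|x 0 i - ratr (q 0 i)| < n.+1%:R^-1].

(** Open sets are countable unions of rational boxes: this reduces Borel
measurability of a vector-valued map to that of its coordinates. *)
Lemma open_box_cover A : open A ->
  A = \bigcup_(p in [set p : 'rV[rat]_d * nat | box p.1 p.2 `<=` A])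
        box p.1 p.2.
Proof.
move=> oA; apply/seteqP; split => [x Ax|x [p/= pA px]]; last exact: pA.
have /nbhs_ballP[e /= e0 xeA] : nbhs x A by apply: open_nbhs_nbhs.
pose n := Num.truncn (e^-1 * 2).
have ne : n.+1%:R^-1 + n.+1%:R^-1 < e.
  have : e^-1 * 2 < n.+1%:R by rewrite truncnS_gt.
  rewrite ltr_pdivrMl// mulrC [in X in X -> _]mulrC => h.
  have n0 : 0 < n.+1%:R :> R by rewrite ltr0n.
  by rewrite -mulr2n -[X in X < _]mulr_natl ltr_pdivrMr// mulrC.
have /choice[q qP] (i : 'I_d) : exists q : rat, `|x 0 i - ratr q| < n.+1%:R^-1.
  have [|q] := @rat_in_itvoo R (x 0 i - n.+1%:R^-1) (x 0 i + n.+1%:R^-1).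
    by rewrite ltrD2l gtrN// invr_gt0 ltr0n.
  by rewrite in_itv/= => /andP[q1 q2]; exists q; rewrite distrC ltr_distl q1 q2.
exists (\row_i q i, n) => [y /= yq|i /=]; last by rewrite mxE.
apply: xeA; split => // i j; rewrite ord1.
move: (yq j) => /=; rewrite mxE /ball /= => yqj.
rewrite (le_lt_trans (ler_distD (ratr (q j)) _ _))//.
by rewrite (le_lt_trans _ ne)// ltW// ltrD// distrC.
Qed.

Lemma measurable_fun_rV dT (T : measurableType dT) (g : T -> 'rV[R]_d) :
  (forall i, measurable_fun setT (fun w => g w 0 i)) -> measurable_fun setT g.
Proof.
move=> mg; apply: (@measurability _ _ _ _ _ _ [set A : set 'rV[R]_d | open A]) => //.
move=> _ [A oA <-]; rewrite setTI (open_box_cover oA) preimage_bigcup.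
rewrite bigcup_mkcond; apply: countable_bigcupT_measurable => [|p].
  exact: countableP.
case: ifP => // _; rewrite (_ : _ @^-1` _ = \bigcap_(i in [set: 'I_d])
    [set w | `|g w 0 i - ratr (p.1 0 i)| < p.2.+1%:R^-1]); last first.
  by apply/seteqP; split => [w h i _|w h i]; exact: h.
apply: fin_bigcap_measurable => [|i _]; first exact: finite_finset.
rewrite -[X in measurable X]setTI.
rewrite (_ : [set w | _] = (fun w => `|g w 0 i - ratr (p.1 0 i)|) @^-1`
    [set` `]-oo, (p.2.+1%:R^-1 : R)[ ]); last first.
  by apply/seteqP; split => w /=; rewrite in_itv.
suff: measurable_fun setT (fun w => `|g w 0 i - ratr (p.1 0 i)|) by apply.
by apply: measurableT_comp => //; apply: measurable_funB.
Qed.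

Lemma continuous_measurable_rV n (h : 'rV[R]_d -> 'rV[R]_n) :
  continuous h -> measurable_fun setT h.
Proof.
move=> ch; apply: (@measurability _ _ _ _ _ _ [set A : set 'rV[R]_n | open A]) => //.
move=> _ [A oA <-]; rewrite setTI; apply: sub_sigma_algebra.
by move: ch => /continuousP; exact.
Qed.

Lemma continuous_measurable_rVR (h : 'rV[R]_d -> R) :
  continuous h -> measurable_fun setT h.
Proof.
move=> ch; apply: (measurability _ (RGenOpens.measurableE R)).
move=> _ [_ [a [b ->] <-]]; rewrite setTI; apply: sub_sigma_algebra.
by move: ch => /continuousP; apply; exact: interval_open.
Qed.

Lemma measurable_coord (i : 'I_d) : measurable_fun setT (fun x : 'rV[R]_d => x 0 i).
Proof. by apply: continuous_measurable_rVR => x; exact: coord_continuous. Qed.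

End borel_rV.



Section vector_measurability.
Context {R : realType} {d : nat} {dT : measure_display} {T : measurableType dT}.
Implicit Types (X Y : T -> 'rV[R]_d) (a : T -> R).

Lemma measurable_rV_coord X (i : 'I_d) : measurable_fun setT X ->
  measurable_fun setT (fun w => X w 0 i).
Proof. by move=> mX; apply: (measurableT_comp (measurable_coord i)). Qed.

Lemma measurable_rVD X Y : measurable_fun setT X -> measurable_fun setT Y ->
  measurable_fun setT (fun w => X w + Y w).
Proof.
move=> mX mY; apply: measurable_fun_rV => i; under eq_fun do rewrite mxE.
by apply: measurable_funD; exact: measurable_rV_coord.
Qed.

Lemma measurable_rVZ a X : measurable_fun setT a -> measurable_fun setT X ->
  measurable_fun setT (fun w => a w *: X w).
Proof.
move=> ma mX; apply: measurable_fun_rV => i; under eq_fun do rewrite mxE.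
by apply: measurable_funM => //; exact: measurable_rV_coord.
Qed.

Lemma measurable_rVB X Y : measurable_fun setT X -> measurable_fun setT Y ->
  measurable_fun setT (fun w => X w - Y w).
Proof.
move=> mX mY; under eq_fun do rewrite -scaleN1r.
by apply: measurable_rVD => //; exact: measurable_rVZ.
Qed.

Lemma measurable_rV_sum (I : Type) (s : seq I) (X : I -> T -> 'rV[R]_d) :
  (forall i, measurable_fun setT (X i)) ->
  measurable_fun setT (fun w => \sum_(i <- s) X i w).
Proof.
move=> mX; elim: s => [|i s IH].
  by under eq_fun do rewrite big_nil; exact: measurable_cst.
by under eq_fun do rewrite big_cons; exact: measurable_rVD.
Qed.

Lemma measurable_dot X Y : measurable_fun setT X -> measurable_fun setT Y ->
  measurable_fun setT (fun w => dot (X w) (Y w)).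
Proof.
move=> mX mY; apply: measurable_sum => i.
by apply: measurable_funM; exact: measurable_rV_coord.
Qed.

Lemma measurable_enorm X : measurable_fun setT X ->
  measurable_fun setT (fun w => enorm (X w)).
Proof.
move=> mX; under eq_fun do rewrite enormE.
apply: (@measurableT_comp _ _ _ _ _ _ (@Num.sqrt R)); last exact: measurable_dot.
by apply: continuous_measurable_fun; exact: sqrt_continuous.
Qed.

Lemma measurable_clip (D : R) X : measurable_fun setT X ->
  measurable_fun setT (fun w => clip D (X w)).
Proof.
move=> mX; rewrite /clip; apply: measurable_fun_ifT => //.
  by apply: measurable_fun_ler => //; exact: measurable_enorm.
apply: measurable_rVZ => //; apply: measurable_funM => //.
under eq_fun do rewrite -powR_inv1 ?enorm_ge0//.
apply: (@measurableT_comp _ _ _ _ _ _ (@powR R ^~ (-1))); last exact: measurable_enorm.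
exact: measurable_powR.
Qed.

End vector_measurability.


(** * Integrable and square-integrable random variables *)

Section L1.
Context {d} {T : measurableType d} {R : realType} (P : probability T R).
Implicit Types X Y Z : T -> R.
Local Notation E := (Rintegral P setT).

Definition L1 X := P.-integrable setT (EFin \o X).

Lemma L1_measurable X : L1 X -> measurable_fun setT X.
Proof. by move=> /measurable_int /measurable_EFinP. Qed.

Lemma eq_L1 X Y : X =1 Y -> L1 X -> L1 Y.
Proof. by move=> /funext ->. Qed.

Lemma L1D X Y : L1 X -> L1 Y -> L1 (fun w => X w + Y w).
Proof. by move=> iX iY; apply: (integrableD _ iX iY). Qed.

Lemma L1Z c X : L1 X -> L1 (fun w => c * X w).
Proof. by move=> iX; apply: (integrableZl _ c iX). Qed.

Lemma L1B X Y : L1 X -> L1 Y -> L1 (fun w => X w - Y w).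
Proof. by move=> iX iY; apply: (integrableB _ iX iY). Qed.

Lemma L1_cst c : L1 (fun=> c).
Proof. exact: finite_measure_integrable_cst. Qed.

Lemma L1_sum (I : Type) (s : seq I) (Q : pred I) (X : I -> T -> R) :
  (forall i, Q i -> L1 (X i)) -> L1 (fun w => \sum_(i <- s | Q i) X i w).
Proof.
move=> h; rewrite /L1 (_ : _ \o _ = (fun w => \sum_(i <- s | Q i) (X i w)%:E)%E).
  exact: (integrable_sum).
by apply/funext => w; rewrite /= sumEFin.
Qed.

Lemma L1_dom X Z : measurable_fun setT X ->
  {ae P, forall w, `|X w| <= Z w} -> L1 Z -> L1 X.
Proof.
move=> mX XZ /integrableP[mZ Zoo]; apply/integrableP; split.
  exact/measurable_EFinP.
apply: le_lt_trans Zoo; apply: ae_ge0_le_integral => //.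
- by apply: measurableT_comp => //; exact/measurable_EFinP.
- exact: measurableT_comp.
- by apply: filterS XZ => w /= h _; rewrite lee_fin (le_trans h)// ler_norm.
Qed.

Lemma L1_bdd X c : measurable_fun setT X ->
  {ae P, forall w, `|X w| <= c} -> L1 X.
Proof. by move=> mX Xc; apply: L1_dom (L1_cst c). Qed.

Lemma meanD X Y : L1 X -> L1 Y -> E (fun w => X w + Y w) = E X + E Y.
Proof. by move=> iX iY; rewrite RintegralD. Qed.

Lemma meanB X Y : L1 X -> L1 Y -> E (fun w => X w - Y w) = E X - E Y.
Proof. by move=> iX iY; rewrite RintegralB. Qed.

Lemma meanZ c X : L1 X -> E (fun w => c * X w) = c * E X.
Proof. by move=> iX; rewrite RintegralZl. Qed.

Lemma mean_cst c : E (fun=> c) = c.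
Proof. by rewrite Rintegral_cst//= probability_setT mulr1. Qed.

Lemma mean_sum (I : Type) (s : seq I) (Q : pred I) (X : I -> T -> R) :
  (forall i, Q i -> L1 (X i)) ->
  E (fun w => \sum_(i <- s | Q i) X i w) = \sum_(i <- s | Q i) E (X i).
Proof.
move=> h; elim: s => [|i s IH].
  by under eq_Rintegral do rewrite big_nil; rewrite mean_cst big_nil.
rewrite big_cons; under eq_Rintegral do rewrite big_cons.
by case: ifP => // Qi; rewrite meanD ?IH//; [exact: h|exact: L1_sum].
Qed.

Lemma mean_EFin X : L1 X -> (\int[P]_w (X w)%:E = (E X)%:E)%E.
Proof. by move=> iX; rewrite /Rintegral fineK//; exact: integrable_fin_num. Qed.

Lemma mean_ge0 X : {ae P, forall w, 0 <= X w} -> L1 X -> 0 <= E X.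
Proof.
move=> X0 iX; have mX := L1_measurable iX.
rewrite -lee_fin -mean_EFin// (@ae_eq_integral _ _ _ _ _ (fun w => `|X w|%:E))//.
- by apply: integral_ge0 => w _; rewrite lee_fin.
- exact/measurable_EFinP.
- by apply/measurable_EFinP; exact: measurableT_comp.
- by apply: filterS X0 => w h _; rewrite ger0_norm.
Qed.

Lemma mean_le X Y : {ae P, forall w, X w <= Y w} -> L1 X -> L1 Y -> E X <= E Y.
Proof.
move=> XY iX iY; rewrite -subr_ge0 -meanB//; apply: mean_ge0; last exact: L1B.
by apply: filterS XY => w; rewrite subr_ge0.
Qed.

Definition L2 X := measurable_fun setT X /\ L1 (fun w => X w ^+ 2).

Lemma L2_L1M X Y : L2 X -> L2 Y -> L1 (fun w => X w * Y w).
Proof.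
move=> [mX X2] [mY Y2]; apply: (@L1_dom _ (fun w => X w ^+ 2 + Y w ^+ 2)).
- exact: measurable_funM.
- apply: aeW => w; rewrite normrM -(real_normK (num_real (X w))).
  rewrite -(real_normK (num_real (Y w))); set a := `|_|; set b := `|_|.
  have := sqr_ge0 (a - b); have : 0 <= a by exact: normr_ge0.
  have : 0 <= b by exact: normr_ge0.
  by nra.
- exact: L1D.
Qed.

Lemma L2_cst c : L2 (fun=> c).
Proof. by split; [exact: measurable_cst|exact: L1_cst]. Qed.

Lemma L2_L1 X : L2 X -> L1 X.
Proof.
by move=> /L2_L1M /(_ (L2_cst 1)); apply: eq_L1 => w; rewrite mulr1.
Qed.

Lemma L2D X Y : L2 X -> L2 Y -> L2 (fun w => X w + Y w).
Proof.
move=> lX lY; split; first by case: lX lY => mX _ [mY _]; exact: measurable_funD.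
apply: (@eq_L1 (fun w => X w ^+ 2 + 2 * (X w * Y w) + Y w ^+ 2)).
  by move=> w; ring.
apply: L1D; last by case: lY.
by apply: L1D; [case: lX|apply: L1Z; exact: L2_L1M].
Qed.

Lemma L2Z c X : L2 X -> L2 (fun w => c * X w).
Proof.
move=> [mX X2]; split; first by apply: measurable_funM.
by apply: (@eq_L1 (fun w => c ^+ 2 * X w ^+ 2)); [move=> w; ring|exact: L1Z].
Qed.

Lemma L2B X Y : L2 X -> L2 Y -> L2 (fun w => X w - Y w).
Proof.
move=> lX lY; have := L2D lX (L2Z (-1) lY).
by under eq_fun do rewrite mulN1r.
Qed.

Lemma L2_dom X Z : measurable_fun setT X ->
  {ae P, forall w, `|X w| <= Z w} -> L2 Z -> L2 X.
Proof.
move=> mX XZ [mZ Z2]; split => //; apply: L1_dom Z2.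
  exact: measurable_funX.
apply: filterS XZ => w h; rewrite ger0_norm ?sqr_ge0//.
rewrite -(real_normK (num_real (X w))) lerXn2r// nnegrE//.
exact: le_trans h.
Qed.

Lemma L2_bdd X c : measurable_fun setT X ->
  {ae P, forall w, `|X w| <= c} -> L2 X.
Proof. by move=> mX Xc; apply: L2_dom (L2_cst c). Qed.

(** Nonnegativity of the variance. *)
Lemma mean_sqr_le X : L2 X -> E X ^+ 2 <= E (fun w => X w ^+ 2).
Proof.
move=> lX; have iX := L2_L1 lX; case: (lX) => mX X2.
set m := E X.
have : 0 <= E (fun w => X w ^+ 2 - (2 * m) * X w + m ^+ 2).
  apply: mean_ge0; last by apply: L1D; [apply: L1B => //; exact: L1Z|exact: L1_cst].
  apply: aeW => w; have -> : X w ^+ 2 - 2 * m * X w + m ^+ 2 = (X w - m) ^+ 2.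
    by ring.
  exact: sqr_ge0.
rewrite meanD ?meanB ?meanZ ?mean_cst//; last 3 first.
  exact: L1Z.
  by apply: L1B => //; exact: L1Z.
  exact: L1_cst.
rewrite -/m -subr_ge0 => h.
  by apply: le_trans h _; rewrite le_eqVlt; apply/orP; left; apply/eqP; ring.
exact: L1_cst.
Qed.

End L1.

Section vector_integrability.
Context {R : realType} {d : nat} {dO : measure_display}
  {Omega : measurableType dO} (P : probability Omega R).

Lemma dot_L1 (X Y : Omega -> 'rV[R]_d) :
  measurable_fun setT X -> measurable_fun setT Y ->
  L2 P (fun w => enorm (X w)) -> L2 P (fun w => enorm (Y w)) ->
  L1 P (fun w => dot (X w) (Y w)).
Proof.
move=> mX mY X2 Y2; apply: (L1_dom _ _ (L2_L1M X2 Y2)).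
  exact: measurable_dot.
by apply: aeW => w; exact: dot_abs_le.
Qed.

Lemma enormD_L2 (X Y : Omega -> 'rV[R]_d) :
  measurable_fun setT X -> measurable_fun setT Y ->
  L2 P (fun w => enorm (X w)) -> L2 P (fun w => enorm (Y w)) ->
  L2 P (fun w => enorm (X w + Y w)).
Proof.
move=> mX mY X2 Y2; apply: (L2_dom _ _ (L2D X2 Y2)).
  by apply: measurable_enorm; exact: measurable_rVD.
by apply: aeW => w; rewrite ger0_norm ?enorm_ge0// enormD.
Qed.

Lemma enorm_sum_L1 (n : nat) (Y : 'I_n -> Omega -> 'rV[R]_d) :
  (forall i, measurable_fun setT (Y i)) ->
  (forall i, L1 P (fun w => enorm (Y i w))) ->
  L1 P (fun w => enorm (\sum_(i < n) Y i w)).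
Proof.
move=> mY lY; apply: (@L1_dom _ _ _ _ _ (fun w => \sum_(i < n) enorm (Y i w))).
- by apply: measurable_enorm; exact: measurable_rV_sum.
- by apply: aeW => w; rewrite ger0_norm ?enorm_ge0// enorm_sum.
- by apply: L1_sum => i _; exact: lY.
Qed.

End vector_integrability.

(** * Taylor estimates along segments *)

Section calculus.
Context {R : realType}.

(** The difference quotients of [g] along the line are those that define the
directional derivative, after reparametrisation. *)
Lemma line_is_derive d (W : normedModType R) (g : 'rV[R]_d -> W) x v (t : R) :
  differentiable g (x + t *: v) ->
  is_derive t 1 (fun s : R => g (x + s *: v)) ('D_v g (x + t *: v)).
Proof.
move=> dg; have E : (fun h : R => h^-1 *: (((fun s : R => g (x + s *: v)) \o shift t)
    (h *: 1) - g (x + t *: v))) =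
    (fun h : R => h^-1 *: ((g \o shift (x + t *: v)) (h *: v) - g (x + t *: v))).
  apply/funext => h /=; congr (_ *: (g _ - _)).
  by rewrite scalerDl [h *: 1]mulr1 addrCA.
by split; rewrite /derivable /derive E//; exact: diff_derivable.
Qed.

Lemma increment_le (phi phi' : R -> R) (c : R) :
  (forall s : R, is_derive s (1 : R) phi (phi' s)) ->
  (forall s : R, 0 <= s -> s <= 1 -> phi' s <= c) -> phi 1 - phi 0 <= c.
Proof.
move=> dphi le.
have cphi : {within `[0, 1], continuous phi}.
  by apply: derivable_within_continuous => s _; case: (dphi s).
have [s] := MVT ltr01 (fun s _ => dphi s) cphi.
rewrite in_itv/= => /andP[s0 s1] ->; rewrite subr0 mulr1.
by apply: le; exact: ltW.
Qed.

Lemma increment_le_half (phi phi' : R -> R) (c : R) :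
  (forall s : R, is_derive s (1 : R) phi (phi' s)) ->
  (forall s : R, 0 <= s -> s <= 1 -> phi' s <= c * s) -> phi 1 - phi 0 <= c / 2.
Proof.
move=> dphi le.
pose psi s := phi s - c / 2 * s ^+ 2.
have dpsi (s : R) : is_derive s (1 : R) psi (phi' s - c * s).
  pose q (s : R) : R := c / 2 * s ^+ 2.
  suff dq : is_derive s (1 : R) q (c * s) by exact: is_deriveB.
  by apply: is_derive_eq; rewrite /GRing.scale /=; field.
have := @increment_le psi _ 0 dpsi; rewrite /psi expr0n/= mulr0 subr0 expr1n mulr1.
have le0 s : 0 <= s -> s <= 1 -> phi' s - c * s <= 0.
  by move=> s0 s1; rewrite subr_le0; exact: le.
by move=> /(_ le0); lra.
Qed.

Lemma is_derive_mulr_cst (c t : R) :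
  is_derive t (1 : R) (fun s : R => s * c) c.
Proof.
have -> : (fun s : R => s * c) = c \*: (@id R).
  by apply/funext => s; rewrite /= mulrC.
by apply: is_derive_eq; rewrite /GRing.scale/= mulr1.
Qed.

Lemma dot_is_linear d (w : 'rV[R]_d) : linear (dot ^~ w).
Proof. by move=> a x y; rewrite dotDl dotZl. Qed.

Lemma continuous_dot d (w : 'rV[R]_d) : continuous (dot ^~ w).
Proof.
have h i : continuous (fun x : 'rV[R]_d => x 0 i * w 0 i).
  move=> x; apply: (@continuousM _ _ (fun x : 'rV[R]_d => x 0 i) (fun=> w 0 i)).
    exact: coord_continuous.
  exact: cst_continuous.
move=> x; rewrite /dot.
apply: (@continuous_big _ _ +%R 0 xpredT add_continuous) => i _; exact: h.
Qed.

Lemma dot_is_diff d (G : 'rV[R]_d -> 'rV[R]_d) (x w : 'rV[R]_d) : differentiable G x ->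
  differentiable (fun y => dot (G y) w) x /\
  forall v, 'D_v (fun y => dot (G y) w) x = dot ('D_v G x) w.
Proof.
move=> dG.
pose l : {linear 'rV[R]_d -> R} :=
  HB.pack (dot ^~ w : 'rV[R]_d -> R) (GRing.isLinear.Build _ _ _ _ _ (dot_is_linear w)).
have dl y : differentiable l y by apply: linear_differentiable; exact: continuous_dot.
have dc : differentiable (l \o G) x by exact: differentiable_comp.
have dlE : 'd l (G x) = l :> (_ -> _).
  by apply: diff_lin; exact: continuous_dot.
split => // v; rewrite deriveE//; transitivity (('d (l \o G) x : _ -> _) v); first by [].
by rewrite diff_comp// deriveE// [LHS]/= dlE.
Qed.


Lemma coord_le_enorm d (x : 'rV[R]_d) i : `|x 0 i| <= enorm x.
Proof.
rewrite -(@ler_pXn2r _ 2%N)// ?nnegrE ?enorm_ge0// enorm_sqr real_normK ?num_real//.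
rewrite /dot (bigD1 i)//= -expr2 lerDl; apply: sumr_ge0 => j _.
by rewrite -expr2 sqr_ge0.
Qed.

Lemma enorm_le_sum d (x : 'rV[R]_d) : enorm x <= \sum_i `|x 0 i|.
Proof.
apply: enorm_le_dual => [|w]; first by apply: sumr_ge0 => i _.
rewrite mulr_suml; apply: ler_sum => i _.
rewrite (le_trans (ler_norm _))// normrM ler_wpM2l//.
exact: coord_le_enorm.
Qed.

Lemma opnorm_le d (A : 'M[R]_d) (z : 'rV[R]_d) :
  enorm (z *m A) <= opnorm A * enorm z.
Proof.
have [->|z0] := eqVneq z 0; first by rewrite mul0mx enorm0 mulr0.
have nz : 0 < enorm z by rewrite lt_neqAle enorm_ge0 eq_sym enorm_eq0 z0.
rewrite -ler_pdivrMr//.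
have -> : enorm (z *m A) / enorm z = enorm (((enorm z)^-1 *: z) *m A).
  by rewrite -scalemxAl enormZ ger0_norm ?invr_ge0 ?(ltW nz)// mulrC.
apply: ub_le_sup; last first.
  exists ((enorm z)^-1 *: z) => //=.
  by rewrite enormZ ger0_norm ?invr_ge0 ?(ltW nz)// mulVf// gt_eqF.
exists (\sum_j \sum_i `|A i j|) => _ [v /= v1 <-].
apply: le_trans (enorm_le_sum _) _; apply: ler_sum => j _.
rewrite mxE (le_trans (ler_norm_sum _ _ _))//; apply: ler_sum => i _.
rewrite normrM ler_piMl// (le_trans _ v1)//; exact: coord_le_enorm.
Qed.

End calculus.

Section smooth.
Context {R : realType} {d : nat} (f : 'rV[R]_d -> R) (L LH : R).
Hypothesis L0 : 0 <= L.
Hypothesis fL : forall x y, `|f x - f y| <= L * enorm (x - y).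
Hypothesis f2 : twice_differentiable f.
Hypothesis LH0 : 0 <= LH.
Hypothesis fH : forall x y, opnorm (hess f x - hess f y) <= LH * enorm (x - y).
Implicit Types x y z w : 'rV[R]_d.

Lemma derive_grad x v : 'D_v f x = dot (grad f x) v.
Proof.
have [df _] := f2 x; rewrite deriveE// {1}(row_sum_delta v) linear_sum.
by apply: eq_bigr => i _; rewrite linearZ/= /grad mxE deriveE// mulrC.
Qed.

Lemma derive_grad2 x v : 'D_v (grad f) x = v *m hess f x.
Proof. by have [_ dg] := f2 x; rewrite deriveEjacobian. Qed.

Lemma line_f x v (t : R) :
  is_derive t (1 : R) (fun s : R => f (x + s *: v)) (dot (grad f (x + t *: v)) v).
Proof. by rewrite -derive_grad; apply: line_is_derive; case: (f2 (x + t *: v)). Qed.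

Lemma line_grad x v w (t : R) :
  is_derive t (1 : R) (fun s : R => dot (grad f (x + s *: v)) w)
    (dot (v *m hess f (x + t *: v)) w).
Proof.
have [_ dg] := f2 (x + t *: v); have [dd E] := dot_is_diff w dg.
by rewrite -derive_grad2 -E; apply: (line_is_derive dd).
Qed.

(** The difference quotients in direction [w] are at most [L * enorm w]. *)
Lemma grad_le x : enorm (grad f x) <= L.
Proof.
apply: enorm_le_dual => // w; rewrite -derive_grad.
have [df _] := f2 x; apply: limr_le; first exact: diff_derivable.
have : \forall h \near (0 : R)^', h != 0 by exact: nbhs_dnbhs_neq.
apply: filterS => h h0 /=; rewrite (le_trans (ler_norm _))// normrZ normfV.
rewrite ler_pdivrMl ?normr_gt0// (le_trans (fL _ _))//.
by rewrite addrK enormZ mulrCA.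
Qed.

(** In a fixed direction [w], the remainder along the segment has derivative at
most [LH * s * enorm z ^ 2 * enorm w] at time [s]; integrating in [s] gives the factor 1/2. *)
Lemma grad_taylor x z :
  enorm (grad f (x + z) - grad f x - z *m hess f x) <= LH * enorm z ^+ 2 / 2.
Proof.
apply: enorm_le_dual => [|w].
  by rewrite divr_ge0// mulr_ge0// sqr_ge0.
pose phi (s : R) := dot (grad f (x + s *: z)) w - s * dot (z *m hess f x) w.
pose phi' (s : R) := dot (z *m (hess f (x + s *: z) - hess f x)) w.
have dphi (s : R) : is_derive s (1 : R) phi (phi' s).
  rewrite /phi' mulmxBr dotBl; apply: is_deriveB; first exact: line_grad.
  exact: is_derive_mulr_cst.
have le s : 0 <= s -> s <= 1 -> phi' s <= (LH * enorm z ^+ 2 * enorm w) * s.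
  move=> s0 s1; rewrite (le_trans (dot_le _ _))//.
  rewrite [leRHS]mulrAC ler_wpM2r ?enorm_ge0//.
  rewrite (le_trans (opnorm_le _ _))// expr2 mulrA mulrAC ler_wpM2r ?enorm_ge0//.
  by rewrite (le_trans (fH _ _))// addrAC subrr add0r enormZ ger0_norm// mulrCA mulrC.
have := increment_le_half dphi le; rewrite /phi scale1r scale0r addr0 mul1r mul0r subr0.
by rewrite !dotBl; lra.
Qed.

(** The gradient of [fun z => (f (y + z) - f (y - z)) / 2 - dot (grad f y) z] is the half sum of
the two Taylor remainders of [grad f] at [z] and [- z]: the Hessian terms cancel. *)
Lemma odd_part_lipschitz y p q r : enorm p <= r -> enorm q <= r ->
  (f (y + p) - f (y - p)) / 2 - dot (grad f y) p
  - ((f (y + q) - f (y - q)) / 2 - dot (grad f y) q)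
  <= LH * r ^+ 2 / 2 * enorm (p - q).
Proof.
move=> pr qr; pose v := p - q.
pose phi (s : R) := (f (y + q + s *: v) - f (y - q + s *: (- v))) / 2
  - (dot (grad f y) q + s * dot (grad f y) v).
pose phi' (s : R) := (dot (grad f (y + q + s *: v)) v
  - dot (grad f (y - q + s *: (- v))) (- v)) / 2 - dot (grad f y) v.
have dphi (s : R) : is_derive s (1 : R) phi (phi' s).
  have dA := line_f (y + q) v s; have dB := line_f (y - q) (- v) s.
  have dC := is_derive_mulr_cst (dot (grad f y) v) s.
  have -> : phi = ((2^-1 \*: ((fun s : R => f (y + q + s *: v)) -
        (fun s : R => f (y - q + s *: (- v))))) -
      (cst (dot (grad f y) q) + (fun s : R => s * dot (grad f y) v))).
    by apply/funext => t; rewrite /phi /= !fctE/= mulrC.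
  by apply: is_derive_eq; rewrite /phi' /GRing.scale/= add0r mulrC.
have le s : 0 <= s -> s <= 1 -> phi' s <= LH * r ^+ 2 / 2 * enorm v.
  move=> s0 s1; pose z := q + s *: v.
  have zr : enorm z <= r.
    have -> : z = s *: p + (1 - s) *: q.
      by rewrite /z /v scalerBr scalerBl scale1r addrCA; congr (_ + _); rewrite addrC.
    rewrite (le_trans (enormD _ _))// !enormZ !ger0_norm ?subr_ge0//.
    by nra.
  have -> : phi' s = dot ((2^-1 : R) *: ((grad f (y + z) - grad f y - z *m hess f y)
      + (grad f (y - z) - grad f y - (- z) *m hess f y))) v.
    rewrite /phi' (_ : y + q + s *: v = y + z); last by rewrite /z addrA.
    rewrite (_ : y - q + s *: - v = y - z); last by rewrite /z (opprD q) addrA scalerN.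
    rewrite dotNr dotZl dotDl !dotBl mulNmx dotNl; lra.
  rewrite (le_trans (dot_le _ _))// ler_wpM2r ?enorm_ge0// enormZ ger0_norm//.
  have h1 := grad_taylor y z; have h2 := grad_taylor y (- z).
  rewrite enormN in h2.
  have zz : LH * enorm z ^+ 2 <= LH * r ^+ 2.
    by rewrite ler_wpM2l// lerXn2r// nnegrE ?enorm_ge0// (le_trans (enorm_ge0 z)).
  rewrite mulrC ler_pdivrMr// (le_trans (enormD _ _))//.
  lra.
have := increment_le dphi le; rewrite /phi scale1r !scale0r !addr0 mul1r mul0r addr0.
rewrite (_ : y + q + v = y + p); last by rewrite /v addrA addrAC addrK.
rewrite (_ : y - q + 1 *: - v = y - p); last first.
  by rewrite scale1r /v opprB addrA subrK.
by rewrite dotBr; lra.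
Qed.


Lemma continuous_f : continuous f.
Proof. by move=> x; apply: differentiable_continuous; case: (f2 x). Qed.

Lemma continuous_grad : continuous (grad f).
Proof. by move=> x; apply: differentiable_continuous; case: (f2 x). Qed.

(** The fundamental theorem of calculus along the segment. *)
Lemma uniform_line_integral x v :
  L1 (uniform_prob (@ltr01 R)) (fun s => dot (grad f (x + s *: v)) v) /\
  Rintegral (uniform_prob (@ltr01 R)) setT (fun s => dot (grad f (x + s *: v)) v)
  = f (x + v) - f x.
Proof.
pose phi (s : R) := dot (grad f (x + s *: v)) v.
pose c := L * enorm v.
have phic s : `|phi s| <= c.
  by rewrite (le_trans (dot_abs_le _ _))// ler_wpM2r ?enorm_ge0// grad_le.
have cphi : continuous phi.
  move=> s; apply: differentiable_continuous; apply/derivable1_diffP.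
  by case: (line_grad x v v s).
have mphi : measurable_fun setT phi by exact: continuous_measurable_fun.
have i1 : L1 (uniform_prob (@ltr01 R)) phi.
  by apply: (@L1_bdd _ _ _ (uniform_prob (@ltr01 R)) phi c mphi); exact: aeW.
split => //.
pose F (s : R) := f (x + s *: v) + s * c.
have dF (s : R) : is_derive s (1 : R) F (phi s + c).
  have dA := line_f x v s; have dC := is_derive_mulr_cst c s.
  exact: is_deriveD.
have : (\int[uniform_prob (@ltr01 R)]_s (phi s + c)%:E = (F 1 - F 0)%:E)%E.
  rewrite integral_uniform; last 2 first.
  - by apply/measurable_EFinP; exact: measurable_funD.
  - move=> s; rewrite lee_fin -(opprK c) subr_ge0.
    by have := phic s; rewrite ler_norml => /andP[].
  rewrite subr0 invr1 mul1e (@continuous_FTC2 _ _ F)//.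
  - by apply: continuous_subspaceT => s; apply: continuousD; [exact: cphi|exact: cst_continuous].
  - have cF s : {for s, continuous F}.
      by apply: differentiable_continuous; apply/derivable1_diffP; case: (dF s).
    split.
    + by move=> s _; case: (dF s).
    + by apply: cvg_at_right_filter; exact: cF.
    + by apply: cvg_at_left_filter; exact: cF.
  - by move=> s _; rewrite derive1E; case: (dF s).
rewrite mean_EFin; last by apply: L1D => //; exact: L1_cst.
move=> [+]; rewrite meanD ?mean_cst//; last exact: L1_cst.
rewrite /F scale1r scale0r addr0 mul1r mul0r => h.
by rewrite -[LHS](addrK c) h; ring.
Qed.

End smooth.

(** * Conditional laws as iterated integrals *)

Section graph_kernel.
Context {R : realType} {d1 d2 : measure_display} {X : measurableType d1}
  {Y : measurableType d2} (k : R.-pker X ~> Y).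

Let mpair (x : X) : measurable_fun setT (pair x : Y -> X * Y).
Proof. exact: measurable_fun_pair. Qed.

(** The law of [(x, Y)] when [Y] has law [k x]. The dummy [unit] is the parameter
of the initial kernel in the composition of kernels. *)
Definition graph_kernel (p : unit * X) : {measure set (X * Y) -> \bar R} :=
  measure_function_pushforward__canonical__measure_function_Measure
    (k p.2) (mpair p.2).

Let measurable_graph_kernel U :
  measurable U -> measurable_fun setT (graph_kernel ^~ U).
Proof.
move=> mU; rewrite (_ : graph_kernel ^~ U = (fun x => k x (xsection U x)) \o snd).
  apply: measurableT_comp => //.
  by apply: measurable_fun_xsection_finite_kernel; rewrite inE.
by apply/funext => p /=; rewrite xsectionE.
Qed.

HB.instance Definition _ :=
  isKernel.Build _ _ _ _ _ graph_kernel measurable_graph_kernel.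

Let graph_kernel_prob p : graph_kernel p setT = 1%E.
Proof. by rewrite /graph_kernel/= /pushforward preimage_setT prob_kernel. Qed.

HB.instance Definition _ :=
  Kernel_isProbability.Build _ _ _ _ _ graph_kernel graph_kernel_prob.

End graph_kernel.

Section disintegration.
Context {R : realType} {dO dT : measure_display} {Omega : measurableType dO}
  {T : measurableType dT} (P : probability Omega R) (G : set (set Omega)).
Hypothesis GM : G `<=` measurable.
Local Notation OG := (g_sigma_algebraType G).

Lemma measurable_from_sub dU (U : measurableType dU) (f : OG -> U) :
  measurable_fun setT f -> measurable_fun setT (f : Omega -> U).
Proof.
move=> mf _ A mA; have := mf measurableT A mA; rewrite !setTI.
apply: (smallest_sub _ GM); split => //.
- by move=> B mB; rewrite setTD; exact: measurableC.
- by move=> F mF; exact: bigcupT_measurable.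
Qed.

Let idG : Omega -> OG := id.
Let measurable_idG : measurable_fun setT idG.
Proof. exact: (@measurable_from_sub _ OG id). Qed.

Variable Y : Omega -> T.
Hypothesis mY : measurable_fun setT Y.
Variable k : R.-pker OG ~> T.
Hypothesis condY : forall E B, <<s G >> E -> measurable B ->
  P (E `&` Y @^-1` B) = (\int[P]_(w in E) k w B)%E.

Let graph (w : Omega) : OG * T := (idG w, Y w).
Let measurable_graph : measurable_fun setT graph.
Proof. exact: measurable_fun_pair. Qed.

Let gr : {mfun Omega >-> (OG * T)%type} :=
  HB.pack graph (isMeasurableFun.Build _ _ _ _ _ measurable_graph).
Let ig : {mfun Omega >-> OG} :=
  HB.pack idG (isMeasurableFun.Build _ _ _ _ _ measurable_idG).
Let PG : pprobability OG R := distribution P ig.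

Let measurable_cstPG : measurable_fun [set: unit] (cst PG : unit -> pprobability OG R).
Proof. exact: measurable_cst. Qed.

Let joint : {measure set (OG * T) -> \bar R} :=
  mkcomp (kprobability measurable_cstPG) (graph_kernel k) tt.

Let jointE B : measurable B -> distribution P gr B = joint B.
Proof.
pose C : set (set (OG * T)) :=
  [set A `*` B | A in measurable & B in measurable].
have CI : setI_closed C.
  move=> _ _ [X1 mX1 [X2 mX2 <-]] [Y1 mY1 [Y2 mY2 <-]].
  exists (X1 `&` Y1); first exact: measurableI.
  by exists (X2 `&` Y2); [exact: measurableI|rewrite setXI].
move=> mB; apply: (measure_unique C (fun=> setT)) => //.
- by rewrite measurable_prod_measurableType.
- by move=> _; exists setT => //; exists setT => //; rewrite setXTT.
- by apply/seteqP; split => // x _; exists 0%N.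
- move=> _ [A mA [D mD <-]].
  transitivity (P (A `&` Y @^-1` D)); first by [].
  rewrite condY//.
  transitivity (\int[distribution P ig]_w graph_kernel k (tt, w) (A `*` D))%E;
    last by [].
  rewrite ge0_integral_distribution//; last first.
    apply: (@measurableT_comp _ _ _ _ _ _ (graph_kernel k ^~ (A `*` D)) _ (pair tt)).
      by apply: measurable_kernel; exact: measurableX.
    exact: measurable_pair1.
  rewrite integral_mkcond; apply: eq_integral => w _.
  rewrite patchE; case: ifPn => [wA|wA]; rewrite /graph_kernel/= /pushforward.
    congr (k w _); apply/seteqP; split => y /=; first by split => //; exact: set_mem.
    by case.
  rewrite (_ : _ @^-1` _ = set0) ?measure0//.
  by apply/seteqP; split => y //= -[/mem_set]; rewrite (negPf wA).
- by move=> _; rewrite (le_lt_trans (probability_le1 _ _))// ltry.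
Qed.

(** Both sides are integrals of [phi] on the product of the past and of [T]: one for
the joint law of the identity and [Y], the other for the composition of [P] with
the kernel [k]. The conditional law says that these two measures agree on
rectangles, which generate the product sigma-algebra. *)
Lemma disintegration (phi : OG * T -> \bar R) :
  measurable_fun setT phi -> (forall p, 0 <= phi p)%E ->
  (\int[P]_w phi (w, Y w) = \int[P]_w \int[k w]_y phi (w, y))%E.
Proof.
move=> mphi phi0.
transitivity (\int[distribution P gr]_p phi p)%E.
  by rewrite ge0_integral_distribution.
transitivity (\int[joint]_p phi p)%E.
  by apply: eq_measure_integral => A mA _; exact: jointE.
rewrite integral_kcomp//.
transitivity (\int[distribution P ig]_w
    \int[graph_kernel k (tt, w)]_z phi z)%E; first by [].
rewrite ge0_integral_distribution//.
- apply: eq_integral => w _ /=; rewrite ge0_integral_pushforward//.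
- apply: (@measurableT_comp _ _ _ _ _ _ (fun p => \int[graph_kernel k p]_z phi z)%E _ (pair tt)).
    apply: measurable_fun_integral_kernel => //.
    exact: measurable_kernel.
  exact: measurable_pair1.
- by move=> y; exact: integral_ge0.
Qed.


Lemma measurable_inner (phi : OG * T -> \bar R) :
  measurable_fun setT phi -> (forall p, 0 <= phi p)%E ->
  measurable_fun setT (fun w : OG => \int[k w]_y phi (w, y))%E.
Proof.
move=> mphi phi0.
have := measurable_fun_integral_finite_kernel phi k phi0 mphi.
by [].
Qed.

(** The inner integral is only known to be finite almost everywhere, whence the
statement in extended real numbers. *)
Lemma disintegration_signed (phi : OG * T -> R) :
  measurable_fun setT phi ->
  P.-integrable setT (fun w => (phi (w, Y w))%:E) ->
  (\int[P]_w (phi (w, Y w))%:E = \int[P]_w \int[k w]_y (phi (w, y))%:E)%E /\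
  P.-integrable setT (fun w => \int[k w]_y (phi (w, y))%:E)%E.
Proof.
move=> mphi iphi.
have mE : measurable_fun setT (EFin \o phi) by exact/measurable_EFinP.
have mp : measurable_fun setT ((EFin \o phi)^\+)%E by exact: measurable_funepos.
have mn : measurable_fun setT ((EFin \o phi)^\-)%E by exact: measurable_funeneg.
pose A (w : Omega) := (\int[k w]_y ((EFin \o phi)^\+)%E (w, y))%E.
pose B (w : Omega) := (\int[k w]_y ((EFin \o phi)^\-)%E (w, y))%E.
have inner w : (\int[k w]_y (phi (w, y))%:E = A w - B w)%E.
  by rewrite [LHS]integralE; congr (_ - _)%E; apply: eq_integral => y _;
    rewrite ?funeposE ?funenegE.
have EA : (\int[P]_w ((EFin \o phi)^\+)%E (w, Y w) = \int[P]_w A w)%E.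
  by rewrite -disintegration.
have EB : (\int[P]_w ((EFin \o phi)^\-)%E (w, Y w) = \int[P]_w B w)%E.
  by rewrite -disintegration.
have iA : P.-integrable setT A.
  apply/integrableP; split.
    by apply: measurable_from_sub; exact: measurable_inner.
  rewrite (eq_integral A); last by move=> w _; rewrite gee0_abs ?integral_ge0.
  rewrite -EA; have /integrableP[_] := integrable_funepos measurableT iphi.
  congr (_ < _)%E; apply: eq_integral => w _; rewrite gee0_abs//.
  by rewrite ?funeposE ?funenegE.
have iB : P.-integrable setT B.
  apply/integrableP; split.
    by apply: measurable_from_sub; exact: measurable_inner.
  rewrite (eq_integral B); last by move=> w _; rewrite gee0_abs ?integral_ge0.
  rewrite -EB; have /integrableP[_] := integrable_funeneg measurableT iphi.
  congr (_ < _)%E; apply: eq_integral => w _; rewrite gee0_abs//.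
  by rewrite ?funeposE ?funenegE.
split; last by under eq_fun do rewrite inner; exact: integrableB.
under [RHS]eq_integral do rewrite inner.
rewrite integralB// -EA -EB [LHS]integralE; congr (_ - _)%E;
  by apply: eq_integral => w _; rewrite ?funeposE ?funenegE.
Qed.

End disintegration.

Section comp_kernel.
Context {R : realType} {d1 d2 d3 : measure_display} {S : measurableType d1}
  {U : measurableType d2} {T : measurableType d3}.
Variables (k : R.-pker U ~> T) (zeta : S -> U).
Hypothesis mzeta : measurable_fun setT zeta.

Definition comp_kernel (_ : measurable_fun setT zeta) (x : S) :
  {measure set T -> \bar R} := k (zeta x).

Let measurable_comp_kernel B : measurable B ->
  measurable_fun setT (comp_kernel mzeta ^~ B).
Proof.
move=> mB; apply: (@measurableT_comp _ _ _ _ _ _ (k ^~ B)) => //.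
exact: measurable_kernel.
Qed.

HB.instance Definition _ :=
  isKernel.Build _ _ _ _ _ (comp_kernel mzeta) measurable_comp_kernel.

Let comp_kernel_prob x : comp_kernel mzeta x setT = 1%E.
Proof. exact: prob_kernel. Qed.

HB.instance Definition _ :=
  Kernel_isProbability.Build _ _ _ _ _ (comp_kernel mzeta) comp_kernel_prob.

End comp_kernel.

Section cst_kernel.
Context {R : realType} {d1 d2 : measure_display} {S : measurableType d1}
  {T : measurableType d2} (mu : probability T R).

Definition cst_kernel (x : S) : {measure set T -> \bar R} := mu.

Let measurable_cst_kernel B : measurable B ->
  measurable_fun setT (cst_kernel ^~ B).
Proof. by move=> mB; exact: measurable_cst. Qed.

HB.instance Definition _ :=
  isKernel.Build _ _ _ _ _ cst_kernel measurable_cst_kernel.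

Let cst_kernel_prob x : cst_kernel x setT = 1%E.
Proof. exact: probability_setT. Qed.

HB.instance Definition _ :=
  Kernel_isProbability.Build _ _ _ _ _ cst_kernel cst_kernel_prob.

End cst_kernel.

Section cond_law.
Context {R : realType} {dO dT : measure_display} {Omega : measurableType dO}
  {T : measurableType dT} (P : probability Omega R) (G : set (set Omega)).
Hypothesis GM : G `<=` measurable.
Local Notation OG := (g_sigma_algebraType G).
Local Notation E := (Rintegral P setT).
Variables (Y : Omega -> T) (k : R.-pker OG ~> T).
Hypothesis lawY : has_cond_law P G Y (fun w : Omega => k w).

Lemma cond_law_E (phi : OG * T -> R) (c : Omega -> R) :
  measurable_fun setT phi -> L1 P (fun w => phi (w, Y w)) ->
  (forall w, \int[k w]_y (phi (w, y))%:E = (c w)%:E)%E ->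
  L1 P c /\ E (fun w => phi (w, Y w)) = E c.
Proof.
case: lawY => mY condY mphi iphi innerE.
have [h1 h2] := @disintegration_signed _ _ _ _ _ P G GM Y mY k condY phi mphi iphi.
have eqc : (fun w => \int[k w]_y (phi (w, y))%:E)%E = EFin \o c.
  by apply/funext => w; rewrite innerE.
split; first by rewrite /L1 -eqc.
by rewrite /Rintegral h1; congr fine; apply: eq_integral => w _; rewrite innerE.
Qed.

Lemma cond_law_ge0 (phi : OG * T -> R) (C : R) :
  measurable_fun setT phi -> (forall p, 0 <= phi p) ->
  (forall w, \int[k w]_y (phi (w, y))%:E <= C%:E)%E ->
  L1 P (fun w => phi (w, Y w)) /\ E (fun w => phi (w, Y w)) <= C.
Proof.
case: lawY => mY condY mphi phi0 innerE.
have mE : measurable_fun setT (EFin \o phi) by exact/measurable_EFinP.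
have pos (p : OG * T) : (0 <= (EFin \o phi) p)%E by rewrite /= lee_fin.
have h := @disintegration _ _ _ _ _ P G GM Y mY k condY (EFin \o phi) mE pos.
have le : (\int[P]_w (phi (w, Y w))%:E <= C%:E)%E.
  rewrite [leLHS]h; apply: (@le_trans _ _ (\int[P]_w C%:E)%E).
    apply: ge0_le_integral => //.
    - by move=> w _; exact: integral_ge0.
    - by apply: (measurable_from_sub GM); exact: measurable_inner.
  by rewrite integral_cst//= probability_setT mule1.
have iL : L1 P (fun w => phi (w, Y w)).
  apply/integrableP; split.
    apply/measurable_EFinP; apply: (@measurableT_comp _ _ _ _ _ _ phi _
      (fun w : Omega => (w : OG, Y w))) => //.
    apply: measurable_fun_pair => //.
    by apply: (@measurable_from_sub _ _ G GM _ OG id).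
  under eq_integral do rewrite gee0_abs ?lee_fin//.
  by rewrite (le_lt_trans le)// ltry.
by split => //; rewrite -lee_fin -mean_EFin.
Qed.

Lemma cond_law_ae (B : set T) : measurable B -> (forall w, k w B = 1%E) ->
  {ae P, forall w, B (Y w)}.
Proof.
case: lawY => mY condY mB kB.
have mYB : measurable (Y @^-1` B) by rewrite -[X in measurable X]setTI; exact: mY.
exists (~` (Y @^-1` B)); split; first exact: measurableC.
  rewrite probability_setC// (_ : P _ = 1%E) ?subee//.
  rewrite -[X in P X]setTI condY//; last exact: (@measurableT _ OG).
  rewrite (eq_integral (cst 1%E)); last by move=> w _; rewrite kB.
  by rewrite integral_cst//= mul1e probability_setT.
by move=> w.
Qed.

End cond_law.

(** * The uniform law on the sphere *)

Section sphere.
Context {R : realType} {d : nat} (mu : probability 'rV[R]_d R).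
Hypothesis d0 : (0 < d)%N.
Hypothesis muS : uniform_on_sphere mu.
Local Notation E := (Rintegral mu setT).
Implicit Types (u v w a b z : 'rV[R]_d).

Lemma measurable_esphere : measurable (@esphere R d).
Proof.
have mE : measurable_fun setT (fun u : 'rV[R]_d => enorm u) by exact: measurable_enorm.
have := mE measurableT [set 1] (measurable_set1 1); rewrite setTI.
rewrite (_ : _ @^-1` _ = @esphere R d)//.
Qed.

Lemma sphere_ae : {ae mu, forall u, enorm u = 1}.
Proof.
exists (~` @esphere R d); split; first by apply: measurableC; exact: measurable_esphere.
  rewrite probability_setC; last exact: measurable_esphere.
  by case: muS => -> _; rewrite subee.
by move=> u; apply: contra_not.
Qed.

Lemma sphere_L1 (h : 'rV[R]_d -> R) c : measurable_fun setT h ->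
  (forall u, enorm u = 1 -> `|h u| <= c) -> L1 mu h.
Proof.
by move=> mh hc; apply: (L1_bdd (c := c) mh); apply: filterS sphere_ae => u /hc.
Qed.

Lemma sphere_L2 (h : 'rV[R]_d -> R) c : measurable_fun setT h ->
  (forall u, enorm u = 1 -> `|h u| <= c) -> L2 mu h.
Proof.
by move=> mh hc; apply: (L2_bdd (c := c) mh); apply: filterS sphere_ae => u /hc.
Qed.

Lemma sphere_invariant (Q : 'M[R]_d) (h : 'rV[R]_d -> R) : Q *m Q^T = 1%:M ->
  measurable_fun setT h -> L1 mu (fun u => h (u *m Q)) ->
  E (fun u => h (u *m Q)) = E h.
Proof.
move=> QQ mh ih.
have mQ : measurable_fun setT (fun u : 'rV[R]_d => u *m Q).
  apply: measurable_fun_rV => i; under eq_fun do rewrite mxE.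
  apply: measurable_sum => j; apply: measurable_funM => //.
  exact: measurable_coord.
pose q : {mfun 'rV[R]_d >-> 'rV[R]_d} :=
  HB.pack (fun u : 'rV[R]_d => u *m Q) (isMeasurableFun.Build _ _ _ _ _ mQ).
rewrite /Rintegral; congr fine.
transitivity (\int[distribution mu q]_u (h u)%:E)%E.
  by rewrite integral_distribution//; exact/measurable_EFinP.
apply: eq_measure_integral => A mA _; case: muS => _; exact.
Qed.

Definition reflection w u := u - (2 * dot u w / dot w w) *: w.

(** The orthogonal matrix [1 - (2 / |w|^2) w^T w]. *)
Lemma reflection_mx w : w != 0 -> exists2 Q : 'M[R]_d, Q *m Q^T = 1%:M &
  forall u, u *m Q = reflection w u.
Proof.
move=> w0; have ww : dot w w != 0 by rewrite -enorm_sqr sqrf_eq0 enorm_eq0.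
pose c := 2 / dot w w.
have dotE u v : u *m v^T = (dot u v)%:M.
  apply/matrixP => i j; rewrite !ord1 !mxE eqxx mulr1n.
  by apply: eq_bigr => k _; rewrite mxE.
pose W := w^T *m w.
have WW : W *m W = dot w w *: W.
  by rewrite /W mulmxA -(mulmxA w^T) dotE mul_mx_scalar -scalemxAl.
have cc : c * (c * dot w w) = c + c by rewrite /c; field.
exists (1%:M - c *: W) => [|u].
  have WT : W^T = W by rewrite /W trmx_mul trmxK.
  have -> : (1%:M - c *: W)^T = 1%:M - c *: W.
    by rewrite !linearB !linearZ /= trmx1 WT.
  rewrite mulmxBl mul1mx mulmxBr mulmx1 -!scalemxAl -scalemxAr WW !scalerA.
  by rewrite -mulrA cc scalerDl opprB addrK subrK.
rewrite mulmxBr mulmx1 -scalemxAr mulmxA dotE mul_scalar_mx scalerA /reflection.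
by congr (_ - _ *: _); rewrite /c; ring.
Qed.

End sphere.

Section sphere_moments.
Context {R : realType} {d : nat} (mu : probability 'rV[R]_d R).
Hypothesis d0 : (0 < d)%N.
Hypothesis muS : uniform_on_sphere mu.
Local Notation E := (Rintegral mu setT).
Implicit Types (u v w a b z : 'rV[R]_d).

Lemma dot_reflection w u a : dot (reflection w u) a = dot u (reflection w a).
Proof. by rewrite /reflection dotBl dotBr dotZl dotZr (dotC w a); ring. Qed.

Lemma enorm_reflection w u : w != 0 -> enorm (reflection w u) = enorm u.
Proof.
move=> w0; have ww : dot w w != 0 by rewrite -enorm_sqr sqrf_eq0 enorm_eq0.
rewrite !enormE; congr Num.sqrt.
by rewrite /reflection !dotBl !dotBr !dotZl !dotZr (dotC w u); field.
Qed.

(** Two vectors of the same norm are exchanged by the reflection in the hyperplane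
which bisects them; hence the second moment below depends on the norm only. *)
Lemma reflection_swap a b : enorm a = enorm b -> a != b ->
  reflection (a - b) a = b.
Proof.
move=> ab aneb; have w0 : a - b != 0 by rewrite subr_eq0.
have ww : dot (a - b) (a - b) != 0 by rewrite -enorm_sqr sqrf_eq0 enorm_eq0.
have aabb : dot a a = dot b b by rewrite -!enorm_sqr ab.
have -> : reflection (a - b) a = a - 1 *: (a - b).
  rewrite /reflection; congr (_ - _ *: _).
  rewrite -[RHS](divff ww); congr (_ / _).
  by rewrite !dotBl !dotBr (dotC b a) -aabb; ring.
by rewrite scale1r opprB addrC subrK.
Qed.

Lemma measurable_dotl a : measurable_fun setT (fun u : 'rV[R]_d => dot u a).
Proof. by apply: measurable_dot => //; exact: measurable_cst. Qed.

Lemma measurable_dotl_sqr a : measurable_fun setT (fun u : 'rV[R]_d => dot u a ^+ 2).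
Proof. by apply: measurable_funX; exact: measurable_dotl. Qed.

Lemma sphere_dot_le u a : enorm u = 1 -> `|dot u a| <= enorm a.
Proof. by move=> u1; rewrite (le_trans (dot_abs_le _ _))// u1 mul1r. Qed.

Lemma sphere_dot_sqr_le u a : enorm u = 1 -> `|dot u a ^+ 2| <= enorm a ^+ 2.
Proof.
by move=> u1; rewrite normrX lerXn2r ?nnegrE ?enorm_ge0//; exact: sphere_dot_le.
Qed.

Lemma sphere_reflection w (h : 'rV[R]_d -> R) c : w != 0 ->
  measurable_fun setT h -> (forall u, enorm u = 1 -> `|h u| <= c) ->
  E (fun u => h (reflection w u)) = E h.
Proof.
move=> w0 mh hc; have [Q QQ Qw] := reflection_mx w0.
have -> : (fun u => h (reflection w u)) = (fun u => h (u *m Q)).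
  by apply/funext => u; rewrite Qw.
apply: sphere_invariant => //.
apply: (sphere_L1 muS (c := c)) => [|u u1].
  apply: (@measurableT_comp _ _ _ _ _ _ h) => //.
  under eq_fun do rewrite Qw; apply: measurable_rVB => //.
  apply: measurable_rVZ => //; apply: measurable_funM => //.
  by apply: measurable_funM => //; exact: measurable_dotl.
by apply: hc; rewrite Qw enorm_reflection.
Qed.

Lemma sphere_opp (h : 'rV[R]_d -> R) c :
  measurable_fun setT h -> (forall u, enorm u = 1 -> `|h u| <= c) ->
  E (fun u => h (- u)) = E h.
Proof.
move=> mh hc; have QE u : u *m (- 1%:M) = - u by rewrite mulmxN mulmx1.
have -> : (fun u => h (- u)) = (fun u => h (u *m (- 1%:M))).
  by apply/funext => u; rewrite QE.
apply: sphere_invariant => //.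
  by rewrite linearN/= trmx1 mulNmx mulmxN opprK mulmx1.
apply: (sphere_L1 muS (c := c)) => [|u u1].
  apply: (@measurableT_comp _ _ _ _ _ _ h) => //.
  under eq_fun do rewrite QE -scaleN1r.
  exact: measurable_rVZ.
by apply: hc; rewrite QE enormN.
Qed.

Lemma sphere_first_moment a : E (fun u => dot u a) = 0.
Proof.
have := sphere_opp (measurable_dotl a) (fun u => @sphere_dot_le u a).
under eq_Rintegral do rewrite dotNl -mulN1r.
rewrite meanZ; last exact: (sphere_L1 muS (measurable_dotl a) (fun u => @sphere_dot_le u a)).
by move=> h; lra.
Qed.

Lemma sphere_second_moment_eq a b : enorm a = enorm b ->
  E (fun u => dot u a ^+ 2) = E (fun u => dot u b ^+ 2).
Proof.
move=> ab; have [->//|aneb] := eqVneq a b.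
have w0 : a - b != 0 by rewrite subr_eq0.
rewrite -(sphere_reflection w0 (measurable_dotl_sqr a) (fun u => @sphere_dot_sqr_le u a)).
by under eq_Rintegral do rewrite dot_reflection reflection_swap//.
Qed.

(** The second moments along the [d] coordinate vectors are all equal and add up
to the mean of [enorm u ^ 2 = 1]. *)
Lemma sphere_second_moment z :
  E (fun u => dot u z ^+ 2) = enorm z ^+ 2 / d%:R.
Proof.
have dn0 : d%:R != 0 :> R by rewrite pnatr_eq0 -lt0n.
apply: (mulIf dn0); rewrite divfK//.
pose e (i : 'I_d) : 'rV[R]_d := enorm z *: delta_mx 0 i.
have dote u i : dot u (e i) = enorm z * u 0 i.
  rewrite dotZr /dot (bigD1 i)//= mxE !eqxx mulr1 big1 ?addr0// => j ji.
  by rewrite mxE eqxx (negPf ji) mulr0.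
have ne i : enorm z = enorm (e i).
  rewrite [RHS]enormE dote mxE mxE !eqxx mulr1 -expr2 sqrtr_sqr ger0_norm//.
  exact: enorm_ge0.
transitivity (\sum_(i < d) E (fun u => dot u (e i) ^+ 2)).
  rewrite -(eq_bigr _ (fun i _ => sphere_second_moment_eq (ne i))).
  by rewrite sumr_const card_ord mulr_natr.
rewrite -mean_sum; last first.
  by move=> i _; apply: (sphere_L1 muS (measurable_dotl_sqr (e i))
    (fun u => @sphere_dot_sqr_le u (e i))).
rewrite -[RHS](mean_cst mu); apply: le_anti; apply/andP.
have i1 : L1 mu (fun u => \sum_(i < d) dot u (e i) ^+ 2).
  by apply: L1_sum => i _; apply: (sphere_L1 muS (measurable_dotl_sqr (e i))
    (fun u => @sphere_dot_sqr_le u (e i))).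
have i2 := L1_cst mu (enorm z ^+ 2).
have eqae : {ae mu, forall u, \sum_(i < d) dot u (e i) ^+ 2 = enorm z ^+ 2}.
  apply: filterS (sphere_ae muS) => u u1.
  under eq_bigr do rewrite dote exprMn.
  rewrite -mulr_sumr (_ : \sum_(i < d) _ = 1) ?mulr1//.
  transitivity (dot u u); last by rewrite -enorm_sqr u1 expr1n.
  by apply: eq_bigr => i _; rewrite expr2.
by split; apply: mean_le => //; apply: filterS eqae => u ->.
Qed.


Variables (f : 'rV[R]_d -> R) (L LH : R).
Hypothesis L0 : 0 <= L.
Hypothesis fL : forall x y, `|f x - f y| <= L * enorm (x - y).
Hypothesis f2 : twice_differentiable f.
Hypothesis LH0 : 0 <= LH.
Hypothesis fH : forall x y, opnorm (hess f x - hess f y) <= LH * enorm (x - y).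
Variables (delta : R).
Hypothesis delta0 : 0 < delta.

Lemma measurable_f : measurable_fun setT f.
Proof. by apply: continuous_measurable_rVR; exact: continuous_f. Qed.

Lemma measurable_shift y (c : R) :
  measurable_fun setT (fun u : 'rV[R]_d => f (y + c *: u)).
Proof.
apply: (@measurableT_comp _ _ _ _ _ _ f); first exact: measurable_f.
by apply: measurable_rVD => //; exact: measurable_rVZ.
Qed.

Lemma f_shift_le y (c : R) u : enorm u = 1 -> `|f (y + c *: u) - f y| <= L * `|c|.
Proof.
by move=> u1; rewrite (le_trans (fL _ _))// addrAC subrr add0r enormZ u1 mulr1.
Qed.

Lemma central_le y u : enorm u = 1 ->
  `|f (y + delta *: u) - f (y - delta *: u)| <= 2 * L * delta.
Proof.
move=> u1; rewrite (le_trans (fL _ _))//.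
have -> : y + delta *: u - (y - delta *: u) = (2 * delta) *: u.
  by rewrite opprB addrC addrA subrK -scalerDl mulr_natl mulr2n.
by rewrite enormZ u1 mulr1 gtr0_norm ?mulr_gt0// mulrCA mulrA.
Qed.

Lemma sphere_cross_moment a b :
  E (fun u => dot u a * dot u b) = dot a b / d%:R.
Proof.
have i1 c := sphere_L1 muS (measurable_dotl_sqr c) (fun u => @sphere_dot_sqr_le u c).
have -> : (fun u => dot u a * dot u b) =
    (fun u => 4^-1 * (dot u (a + b) ^+ 2 - dot u (a - b) ^+ 2)).
  by apply/funext => u; rewrite dotDr dotBr; field.
rewrite meanZ ?meanB//; last exact: L1B.
rewrite !sphere_second_moment !enorm_sqr !dotDl !dotNl !dotDr !dotNr (dotC b a).
by field; rewrite pnatr_eq0 -lt0n.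
Qed.

Let odd_part y u := (f (y + delta *: u) - f (y - delta *: u)) / 2
  - dot (grad f y) (delta *: u).

Let measurable_odd_part y : measurable_fun setT (odd_part y).
Proof.
apply: measurable_funB.
  apply: measurable_funM => //; apply: measurable_funB; first exact: measurable_shift.
  by under eq_fun do rewrite -scaleNr; exact: measurable_shift.
by apply: measurable_dot => //; exact: measurable_rVZ.
Qed.

(** Subtracting the linear part of [f], which is estimated exactly by the
second moments, leaves the function [odd_part y]. The reflection in the hyperplane
orthogonal to [z] reverses [dot u z] and moves [delta *: u] by
[2 * delta * `|dot u z| / enorm z], so the Lipschitz bound on [odd_part y] produces one
more factor [dot u z], whose square has mean [enorm z ^+ 2 / d]. The two factors
[d] cancel and the bias is independent of the dimension. *)
Lemma sphere_central_bias y z :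
  d%:R / (2 * delta) *
    E (fun u => (f (y + delta *: u) - f (y - delta *: u)) * dot u z)
  <= dot (grad f y) z + LH * delta ^+ 2 / 2 * enorm z.
Proof.
have dn0 : d%:R != 0 :> R by rewrite pnatr_eq0 -lt0n.
have [->|z0] := eqVneq z 0.
  under eq_Rintegral do rewrite dot0r mulr0.
  by rewrite mean_cst dot0r enorm0 !mulr0 addr0.
have nz : 0 < enorm z by rewrite lt_neqAle enorm_ge0 eq_sym enorm_eq0 z0.
pose H := odd_part y; pose h u := H u * dot u z.
have Hb u : enorm u = 1 -> `|H u| <= 2 * L * delta.
  move=> u1; rewrite /H /odd_part (le_trans (ler_normB _ _))//.
  rewrite (_ : 2 * L * delta = L * delta + L * delta); last by ring.
  apply: lerD.
    by rewrite normrM [`|2^-1|]ger0_norm// ler_pdivrMr// (le_trans (central_le _ u1))//; lra.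
  rewrite (le_trans (dot_abs_le _ _))// enormZ u1 mulr1 gtr0_norm//.
  by rewrite ler_wpM2r ?(ltW delta0)//; exact: grad_le.
have mh : measurable_fun setT h.
  by apply: measurable_funM; [exact: measurable_odd_part|exact: measurable_dotl].
have hb u : enorm u = 1 -> `|h u| <= 2 * L * delta * enorm z.
  by move=> u1; rewrite normrM ler_pM//; [exact: Hb|exact: sphere_dot_le].
have ih := sphere_L1 muS mh hb.
have zz : reflection z z = - z.
  rewrite /reflection mulfK; last by rewrite -enorm_sqr sqrf_eq0 enorm_eq0.
  by rewrite -[X in X - _]scale1r -scalerBl (_ : 1 - 2 = -1) ?scaleN1r//; ring.
have ihR : L1 mu (fun u => h (reflection z u)).
  apply: (sphere_L1 muS (c := 2 * L * delta * enorm z)) => [|u u1].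
    apply: (@measurableT_comp _ _ _ _ _ _ h) => //.
    apply: measurable_rVB => //; apply: measurable_rVZ => //.
    by apply: measurable_funM => //; apply: measurable_funM => //; exact: measurable_dotl.
  by apply: hb; rewrite enorm_reflection.
pose K := LH * delta ^+ 3 / enorm z.
have it := sphere_L1 muS (measurable_dotl_sqr z) (fun u => @sphere_dot_sqr_le u z).
have le2 : 2 * E h <= K * (enorm z ^+ 2 / d%:R).
  rewrite -sphere_second_moment -meanZ// mulr_natl mulr2n.
  rewrite -{2}(sphere_reflection z0 mh hb) -meanD//.
  apply: mean_le; [|exact: L1D|exact: L1Z].
  apply: filterS (sphere_ae muS) => u u1; rewrite /h dot_reflection zz dotNr.
  set t := dot u z; rewrite mulrN -mulrBl.
  have uR : delta *: u - delta *: reflection z u = (delta * (2 * t / enorm z ^+ 2)) *: z.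
    by rewrite -scalerBr /reflection opprB addrC subrK scalerA enorm_sqr.
  have n1 : enorm (delta *: u) <= delta by rewrite enormZ u1 mulr1 gtr0_norm.
  have n2 : enorm (delta *: reflection z u) <= delta.
    by rewrite enormZ enorm_reflection// u1 mulr1 gtr0_norm.
  have l1 := odd_part_lipschitz f2 LH0 fH y n1 n2.
  have l2 := odd_part_lipschitz f2 LH0 fH y n2 n1.
  rewrite enorm_distC in l2; rewrite uR enormZ in l1 l2.
  have E3 : LH * delta ^+ 2 / 2 * (`|delta * (2 * t / enorm z ^+ 2)| * enorm z) = K * `|t|.
    rewrite /K !normrM normfV [`|enorm z ^+ 2|]ger0_norm ?sqr_ge0//.
    rewrite [`|delta|]gtr0_norm// [`|2|]ger0_norm//.
    by field; rewrite gt_eqF.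
  rewrite E3 in l1 l2.
  have abs : `|H u - H (reflection z u)| <= K * `|t|.
    by rewrite ler_norml l1 andbT lerNl opprB l2.
  rewrite (le_trans (ler_norm _))// normrM (le_trans (ler_wpM2r _ abs))//.
  by rewrite -mulrA -expr2 real_normK// num_real.
have ic : L1 mu (fun u => (f (y + delta *: u) - f (y - delta *: u)) * dot u z).
  apply: (sphere_L1 muS (c := 2 * L * delta * enorm z)) => [|u u1].
    apply: measurable_funM; last exact: measurable_dotl.
    apply: measurable_funB; first exact: measurable_shift.
    by under eq_fun do rewrite -scaleNr; exact: measurable_shift.
  by rewrite normrM ler_pM//; [exact: central_le|exact: sphere_dot_le].
have ig : L1 mu (fun u => dot u (grad f y) * dot u z).
  by apply: L2_L1M; apply: sphere_L2 (measurable_dotl _) (fun u => @sphere_dot_le u _).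
have EE : E (fun u => (f (y + delta *: u) - f (y - delta *: u)) * dot u z) =
    2 * E h + 2 * delta * (dot (grad f y) z / d%:R).
  rewrite -sphere_cross_moment -!meanZ// -meanD//; [|exact: L1Z|exact: L1Z].
  apply: eq_Rintegral => u _; rewrite /h /H /odd_part dotZr (dotC (grad f y)).
  by field.
rewrite EE.
have -> : dot (grad f y) z + LH * delta ^+ 2 / 2 * enorm z =
    d%:R / (2 * delta) * (K * (enorm z ^+ 2 / d%:R) + 2 * delta * (dot (grad f y) z / d%:R)).
  by rewrite /K; field; rewrite dn0 !gt_eqF.
by rewrite ler_pM2l ?lerD2r// divr_gt0 ?mulr_gt0// ltr0n.
Qed.

(** By the symmetry [u -> - u] the one-point estimator has the same mean as the
symmetric one. *)
Lemma sphere_onepoint_bias y z :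
  E (fun u => d%:R / delta * (f (y + delta *: u) - f y) * dot u z)
  <= dot (grad f y) z + LH * delta ^+ 2 / 2 * enorm z.
Proof.
apply: le_trans (sphere_central_bias y z).
pose h u := (f (y + delta *: u) - f y) * dot u z.
have mh : measurable_fun setT h.
  apply: measurable_funM; last exact: measurable_dotl.
  by apply: measurable_funB => //; exact: measurable_shift.
have hb u : enorm u = 1 -> `|h u| <= L * delta * enorm z.
  move=> u1; rewrite normrM ler_pM//; last exact: sphere_dot_le.
  by rewrite (le_trans (f_shift_le _ _ u1))// gtr0_norm.
have ih := sphere_L1 muS mh hb.
have ihN : L1 mu (fun u => h (- u)).
  apply: (sphere_L1 muS (c := L * delta * enorm z)) => [|u u1].
    apply: (@measurableT_comp _ _ _ _ _ _ h _ (fun u : 'rV[R]_d => - u)) => //.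
    suff: measurable_fun setT (fun u : 'rV[R]_d => -1 *: u).
      by under eq_fun do rewrite scaleN1r.
    exact: measurable_rVZ.
  by apply: hb; rewrite enormN.
have -> : (fun u => (f (y + delta *: u) - f (y - delta *: u)) * dot u z) =
    (fun u => h u + h (- u)).
  by apply/funext => u; rewrite /h dotNl scalerN; ring.
rewrite meanD// (sphere_opp mh hb).
have -> : (fun u => d%:R / delta * (f (y + delta *: u) - f y) * dot u z) =
    (fun u => d%:R / delta * h u).
  by apply/funext => u; rewrite /h mulrA.
rewrite meanZ// le_eqVlt; apply/orP; left; apply/eqP.
by field; rewrite gt_eqF.
Qed.

End sphere_moments.

(** * Oracle noise and randomly directed estimators *)

Section probability_of_kernel.
Context {R : realType} {d1 d2 : measure_display} {U : measurableType d1}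
  {T : measurableType d2} (k : R.-pker U ~> T) (x : U).

(** A member of a probability kernel is only known as a measure; this gives it the
structure of a probability. *)
Definition kernel_law : set T -> \bar R := k x.

HB.instance Definition _ := isMeasure.Build _ _ _ kernel_law
  (measure0 (k x)) (measure_ge0 (k x)) (@measure_semi_sigma_additive _ _ _ (k x)).

HB.instance Definition _ := Measure_isProbability.Build _ _ _ kernel_law
  (prob_kernel x).

End probability_of_kernel.

Section noise.
Context {R : realType} {d : nat} {dX dO : measure_display}
  {X : measurableType dX} {Omega : measurableType dO}
  (P : probability Omega R) (f : 'rV[R]_d -> R) (F : 'rV[R]_d -> X -> R)
  (Xi : R.-pker 'rV[R]_d ~> X) (sigma : R).
Hypothesis mf : measurable_fun setT f.
Hypothesis szo : is_szo f F Xi sigma.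
Local Notation E := (Rintegral P setT).

(** Finite variance makes [F x] integrable, so the mean of the oracle is a true
expectation and can be subtracted. *)
Lemma szo_centered x (c : R) : (\int[Xi x]_xi ((F x xi - f x) * c)%:E = 0)%E.
Proof.
pose Px : probability X R := kernel_law Xi x.
have mF : measurable_fun setT (F x).
  apply: (@measurableT_comp _ _ _ _ _ _ (fun p : 'rV[R]_d * X => F p.1 p.2) _ (pair x)).
    exact: (szo_measurable szo).
  exact: measurable_pair1.
have mN : measurable_fun setT (fun xi => F x xi - f x).
  by apply: measurable_funB.
have l2 : L2 Px (fun xi => F x xi - f x).
  split => //; apply/integrableP; split.
    by apply/measurable_EFinP; exact: measurable_funX.
  apply: (@le_lt_trans _ _ (sigma ^+ 2)%:E); last exact: ltry.
  apply: le_trans (szo_variance szo x).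
  rewrite le_eqVlt; apply/orP; left; apply/eqP.
  by apply: eq_integral => xi _; rewrite /= normrX.
have l1 := L2_L1 l2.
have l1F : L1 Px (F x).
  by apply: (eq_L1 _ (L1D l1 (L1_cst Px (f x)))) => xi; rewrite subrK.
have EF : Rintegral Px setT (F x) = f x by rewrite /Rintegral (szo_mean szo x).
transitivity ((Rintegral Px setT (fun xi => c * (F x xi - f x)))%:E).
  rewrite -mean_EFin; last exact: L1Z.
  by apply: eq_integral => xi _; rewrite mulrC.
by rewrite meanZ// meanB ?mean_cst ?EF ?subrr ?mulr0//; exact: L1_cst.
Qed.

Variables (G : set (set Omega)) (zeta : Omega -> 'rV[R]_d) (xi : Omega -> X).
Hypothesis GM : G `<=` measurable.
Local Notation OG := (g_sigma_algebraType G).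
Hypothesis mzeta : measurable_fun setT (zeta : OG -> 'rV[R]_d).
Hypothesis law_xi : has_cond_law P G xi (fun w => Xi (zeta w)).

Let N (w : Omega) : R := F (zeta w) (xi w) - f (zeta w).

Let mphi : measurable_fun setT
  (fun p : OG * X => F (zeta p.1) p.2 - f (zeta p.1)).
Proof.
have mz : measurable_fun setT (fun p : OG * X => zeta p.1).
  by apply: (@measurableT_comp _ _ _ _ _ _ (zeta : OG -> _)).
apply: measurable_funB; last exact: measurableT_comp.
apply: (@measurableT_comp _ _ _ _ _ _ (fun p : 'rV[R]_d * X => F p.1 p.2) _
  (fun p : OG * X => (zeta p.1, p.2))).
  exact: (szo_measurable szo).
by apply: measurable_fun_pair => //; exact: measurable_snd.
Qed.

Lemma noise_L2 : L2 P N /\ E (fun w => N w ^+ 2) <= sigma ^+ 2.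
Proof.
pose phi (p : OG * X) := (F (zeta p.1) p.2 - f (zeta p.1)) ^+ 2.
have mp : measurable_fun setT phi by exact: measurable_funX.
have le w : (\int[comp_kernel Xi mzeta w]_xi (phi (w, xi))%:E <= (sigma ^+ 2)%:E)%E.
  rewrite (le_trans _ (szo_variance szo (zeta w)))// le_eqVlt; apply/orP; left.
  by apply/eqP; apply: eq_integral => y _; rewrite /phi/= real_normK// num_real.
have [l1 le1] := @cond_law_ge0 _ _ _ _ _ P G GM xi (comp_kernel Xi mzeta) law_xi
  phi (sigma ^+ 2) mp (fun p => sqr_ge0 _) le.
split => //; split => //; apply: (@measurableT_comp _ _ _ _ _ _
  (fun p : OG * X => F (zeta p.1) p.2 - f (zeta p.1)) _ (fun w : Omega => (w : OG, xi w))) => //.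
apply: measurable_fun_pair; last by case: law_xi.
exact: (@measurable_from_sub _ _ G GM _ OG id).
Qed.

Lemma noise_orthogonal (h : Omega -> R) :
  measurable_fun setT (h : OG -> R) -> L2 P h -> E (fun w => N w * h w) = 0.
Proof.
move=> mh l2h.
pose phi (p : OG * X) := (F (zeta p.1) p.2 - f (zeta p.1)) * h p.1.
have mp : measurable_fun setT phi.
  apply: measurable_funM => //.
  by apply: (@measurableT_comp _ _ _ _ _ _ (h : OG -> _)).
have ip : L1 P (fun w => phi (w, xi w)) by apply: L2_L1M => //; case: noise_L2.
have inner w : (\int[comp_kernel Xi mzeta w]_y (phi (w, y))%:E = (0 : R)%:E)%E.
  exact: (szo_centered (zeta w) (h w)).
have [_ ->] := @cond_law_E _ _ _ _ _ P G GM xi (comp_kernel Xi mzeta) law_xi phi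
  (fun=> 0) mp ip inner.
exact: mean_cst.
Qed.

End noise.

(** The two options give estimators of one form: a scalar times the fresh
direction [u], where the scalar is the sum of an oracle noise [A], a function
[q (Y w) (u w)] of the direction bounded on the sphere, and a quantity [W] known
before [u] is drawn. Only the middle term contributes to the mean: [A] is
orthogonal to functions of [u] and of the past, and [u] has mean zero. *)
Section direction.
Context {R : realType} {d : nat} {dO : measure_display}
  {Omega : measurableType dO} (P : probability Omega R)
  (mu : probability 'rV[R]_d R).
Hypothesis muS : uniform_on_sphere mu.
Local Notation E := (Rintegral P setT).
Variables (G : set (set Omega)) (u : Omega -> 'rV[R]_d).
Hypothesis GM : G `<=` measurable.
Local Notation OG := (g_sigma_algebraType G).
Hypothesis law_u : has_cond_law P G u (fun=> mu).

Lemma direction_ae : {ae P, forall w, enorm (u w) = 1}.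
Proof.
apply: (@cond_law_ae _ _ _ _ _ P G u (cst_kernel mu) law_u (@esphere R d)).
  exact: measurable_esphere.
by move=> w; case: muS.
Qed.

Let mu_u : measurable_fun setT u. Proof. by case: law_u. Qed.

Let mO dU (U : measurableType dU) (h : Omega -> U) :
  measurable_fun setT (h : OG -> U) -> measurable_fun setT h.
Proof. exact: measurable_from_sub. Qed.

Variables (Y Z : Omega -> 'rV[R]_d).
Hypothesis mY : measurable_fun setT (Y : OG -> 'rV[R]_d).
Hypothesis mZ : measurable_fun setT (Z : OG -> 'rV[R]_d).
Hypothesis Z2 : L2 P (fun w => enorm (Z w)).

Let mdotuZ : measurable_fun setT (fun w => dot (u w) (Z w)).
Proof. by apply: measurable_dot => //; exact: mO. Qed.

Lemma direction_dot_le : {ae P, forall w, `|dot (u w) (Z w)| <= enorm (Z w)}.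
Proof. by apply: filterS direction_ae => w u1; exact: sphere_dot_le. Qed.

Lemma direction_dot_L2 : L2 P (fun w => dot (u w) (Z w)).
Proof. by apply: (L2_dom mdotuZ) Z2; exact: direction_dot_le. Qed.

Let mfst dU (U : measurableType dU) (h : Omega -> U) :
  measurable_fun setT (h : OG -> U) ->
  measurable_fun setT (fun p : OG * 'rV[R]_d => h p.1).
Proof. by move=> mh; apply: (@measurableT_comp _ _ _ _ _ _ (h : OG -> U)). Qed.

Let mdot2 : measurable_fun setT (fun p : OG * 'rV[R]_d => dot p.2 (Z p.1)).
Proof. by apply: measurable_dot; [exact: measurable_snd|exact: mfst]. Qed.

Lemma direction_centered (W : Omega -> R) : measurable_fun setT (W : OG -> R) ->
  L2 P W -> E (fun w => W w * dot (u w) (Z w)) = 0.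
Proof.
move=> mW lW.
pose phi (p : OG * 'rV[R]_d) := W p.1 * dot p.2 (Z p.1).
have mp : measurable_fun setT phi by apply: measurable_funM => //; exact: mfst.
have ip : L1 P (fun w => phi (w, u w)) by apply: L2_L1M => //; exact: direction_dot_L2.
have inner w : (\int[cst_kernel mu w]_y (phi (w, y))%:E = (0 : R)%:E)%E.
  have l1 : L1 mu (fun u => dot u (Z w)).
    exact: (sphere_L1 muS (measurable_dotl _) (fun u => @sphere_dot_le _ _ u _)).
  transitivity ((Rintegral mu setT (fun u => W w * dot u (Z w)))%:E).
    by rewrite -mean_EFin//; exact: L1Z.
  by rewrite meanZ// sphere_first_moment// mulr0.
have [_ ->] := @cond_law_E _ _ _ _ _ P G GM u (cst_kernel mu) law_u phi
  (fun=> 0) mp ip inner.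
exact: mean_cst.
Qed.

Variables (q : 'rV[R]_d -> 'rV[R]_d -> R) (v : 'rV[R]_d -> 'rV[R]_d) (B b L : R).
Hypothesis mq : measurable_fun setT (fun p : 'rV[R]_d * 'rV[R]_d => q p.1 p.2).
Hypothesis mv : measurable_fun setT v.
Hypothesis B0 : 0 <= B.
Hypothesis qB : forall y x, enorm x = 1 -> `|q y x| <= B.
Hypothesis vL : forall y, enorm (v y) <= L.
Hypothesis q_bias : forall y z,
  Rintegral mu setT (fun x => q y x * dot x z) <= dot (v y) z + b * enorm z.

Let mqYu : measurable_fun setT (fun w => q (Y w) (u w)).
Proof.
apply: (@measurableT_comp _ _ _ _ _ _ (fun p : 'rV[R]_d * 'rV[R]_d => q p.1 p.2)
  _ (fun w => (Y w, u w))) => //.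
by apply: measurable_fun_pair => //; exact: mO.
Qed.

Let qL2 : L2 P (fun w => q (Y w) (u w)).
Proof.
by apply: (L2_bdd (c := B) mqYu); apply: filterS direction_ae => w; exact: qB.
Qed.

Let mvY : measurable_fun setT (fun w => v (Y w)).
Proof. by apply: (measurableT_comp mv); exact: mO. Qed.

Let L0 : 0 <= L. Proof. by rewrite (le_trans (enorm_ge0 (v 0))). Qed.

Let dotvZ : L1 P (fun w => dot (v (Y w)) (Z w)).
Proof.
apply: (@L1_dom _ _ _ _ _ (fun w => L * enorm (Z w))).
- by apply: measurable_dot => //; exact: mO.
- apply: aeW => w; rewrite (le_trans (dot_abs_le _ _))// ler_wpM2r ?enorm_ge0//.
- by apply: L1Z; exact: L2_L1.
Qed.

Lemma smooth_part_bias :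
  E (fun w => q (Y w) (u w) * dot (u w) (Z w)) <=
  E (fun w => dot (v (Y w)) (Z w)) + b * E (fun w => enorm (Z w)).
Proof.
pose phi (p : OG * 'rV[R]_d) := q (Y p.1) p.2 * dot p.2 (Z p.1).
have mp : measurable_fun setT phi.
  apply: measurable_funM => //.
  apply: (@measurableT_comp _ _ _ _ _ _ (fun p : 'rV[R]_d * 'rV[R]_d => q p.1 p.2)
    _ (fun p : OG * 'rV[R]_d => (Y p.1, p.2))) => //.
  by apply: measurable_fun_pair; [exact: mfst|exact: measurable_snd].
have ip : L1 P (fun w => phi (w, u w)) by apply: L2_L1M => //; exact: direction_dot_L2.
pose c w := Rintegral mu setT (fun x => q (Y w) x * dot x (Z w)).
have inner w : (\int[cst_kernel mu w]_y (phi (w, y))%:E = (c w)%:E)%E.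
  rewrite -mean_EFin//; apply: (sphere_L1 muS (c := B * enorm (Z w))) => [|x x1].
    apply: measurable_funM; last exact: measurable_dotl.
    apply: (@measurableT_comp _ _ _ _ _ _ (fun p : 'rV[R]_d * 'rV[R]_d => q p.1 p.2)
      _ (pair (Y w))) => //.
  by rewrite normrM ler_pM//; [exact: qB|exact: sphere_dot_le].
have [lc ->] := @cond_law_E _ _ _ _ _ P G GM u (cst_kernel mu) law_u phi c mp ip inner.
have lZ := L2_L1 Z2.
rewrite -meanZ// -meanD//; last exact: L1Z.
apply: mean_le => //; last by apply: L1D => //; exact: L1Z.
by apply: aeW => w; exact: q_bias.
Qed.

Variables (A W : Omega -> R).
Hypothesis A2 : L2 P A.
Hypothesis AZ : E (fun w => A w * dot (u w) (Z w)) = 0.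
Hypothesis mW : measurable_fun setT (W : OG -> R).
Hypothesis W2 : L2 P W.

Let g w := (A w + q (Y w) (u w) + W w) *: u w.

Let cL2 : L2 P (fun w => A w + q (Y w) (u w) + W w).
Proof. by apply: L2D => //; exact: L2D. Qed.

Let enorm_g : {ae P, forall w, enorm (g w) = `|A w + q (Y w) (u w) + W w|}.
Proof. by apply: filterS direction_ae => w u1; rewrite enormZ u1 mulr1. Qed.

Lemma estimator_bias :
  E (fun w => dot (g w - v (Y w)) (Z w)) <= b * E (fun w => enorm (Z w)).
Proof.
have lu := direction_dot_L2.
have lA := L2_L1M A2 lu; have lq := L2_L1M qL2 lu; have lW := L2_L1M W2 lu.
have -> : (fun w => dot (g w - v (Y w)) (Z w)) = (fun w =>
    A w * dot (u w) (Z w) + q (Y w) (u w) * dot (u w) (Z w)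
    + W w * dot (u w) (Z w) - dot (v (Y w)) (Z w)).
  by apply/funext => w; rewrite dotBl dotZl; ring.
rewrite meanB//; last by apply: L1D => //; exact: L1D.
rewrite meanD//; last exact: L1D.
by rewrite meanD// AZ (direction_centered mW W2) add0r addr0 lerBlDl smooth_part_bias.
Qed.

Lemma estimator_L2 : L2 P (fun w => enorm (g w)) /\
  E (fun w => enorm (g w) ^+ 2) <=
  3 * (E (fun w => A w ^+ 2) + B ^+ 2 + E (fun w => W w ^+ 2)).
Proof.
have mg : measurable_fun setT (fun w => enorm (g w)).
  by apply: measurable_enorm; apply: measurable_rVZ => //; case: cL2.
have lg : L2 P (fun w => enorm (g w)).
  have [mc c2] := cL2; split => //; apply: (L1_dom _ _ c2).
    exact: measurable_funX.
  apply: filterS enorm_g => w ->.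
  by rewrite ger0_norm ?sqr_ge0// real_normK// num_real.
split => //; have [_ lA] := A2; have [_ lW] := W2.
have lB := L1_cst P (B ^+ 2).
rewrite -[B ^+ 2](mean_cst P) -meanD// -meanD//; last exact: L1D.
rewrite -meanZ; last by apply: L1D => //; exact: L1D.
apply: mean_le; [|by case: lg|by apply: L1Z; apply: L1D => //; exact: L1D].
near=> w.
have -> : enorm (g w) = `|A w + q (Y w) (u w) + W w| by near: w.
rewrite real_normK ?num_real//.
have : q (Y w) (u w) ^+ 2 <= B ^+ 2.
  have : `|q (Y w) (u w)| <= B.
    by apply: qB; near: w; exact: direction_ae.
  move=> qle; rewrite -(real_normK (num_real (q _ _))).
  by apply: lerXn2r => //; rewrite nnegrE.
move: (A w) (q _ _) (W w) => a c e.
have := sqr_ge0 (a - c); have := sqr_ge0 (a - e); have := sqr_ge0 (c - e).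
nra.
Unshelve. all: by end_near. Qed.

End direction.

(** * Sums of errors with a small drift, and averages of gradients *)

Section drift_sum.
Context {R : realType} {d : nat} {dO : measure_display}
  {Omega : measurableType dO} (P : probability Omega R).
Local Notation E := (Rintegral P setT).
Variables (e : nat -> Omega -> 'rV[R]_d) (m : nat) (b B : R).
Hypothesis b0 : 0 <= b.
Hypothesis B0 : 0 <= B.
Let S n w := \sum_(i < n) e i w.
Hypothesis me : forall n, (n < m)%N -> measurable_fun setT (e n).
Hypothesis e2 : forall n, (n < m)%N -> L2 P (fun w => enorm (e n w)).
Hypothesis eB : forall n, (n < m)%N -> E (fun w => enorm (e n w) ^+ 2) <= B ^+ 2.
Hypothesis drift : forall n, (n < m)%N -> L2 P (fun w => enorm (S n w)) ->
  E (fun w => dot (e n w) (S n w)) <= b * E (fun w => enorm (S n w)).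

(** With [c n = b * n + B * sqrt n], the induction shows that the second moment of
the norm of the sum of [n] terms is at most [c n ^+ 2]. The cross term adds
[2 * b * c n] and the new square [B ^+ 2], and
[c n ^+ 2 + 2 * b * c n + B ^+ 2 <= c n.+1 ^+ 2]. *)
Lemma drift_sum_enorm :
  E (fun w => enorm (S m w)) <= b * m%:R + B * Num.sqrt m%:R.
Proof.
pose c n := b * n%:R + B * Num.sqrt n%:R : R.
have c0 n : 0 <= c n by rewrite addr_ge0// mulr_ge0// sqrtr_ge0.
have bnd n : L2 P (fun w => enorm (S n w)) ->
    E (fun w => enorm (S n w) ^+ 2) <= c n ^+ 2 -> E (fun w => enorm (S n w)) <= c n.
  move=> l2 le; rewrite -(@ler_pXn2r _ 2%N)// ?nnegrE//.
    exact: le_trans (mean_sqr_le l2) le.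
  by apply: mean_ge0; [apply: aeW => w; exact: enorm_ge0|exact: L2_L1].
suff [_ [l2 le]] : measurable_fun setT (S m) /\ L2 P (fun w => enorm (S m w)) /\
    E (fun w => enorm (S m w) ^+ 2) <= c m ^+ 2 by exact: bnd.
have : (m <= m)%N by [].
elim: {1 3 4 5 6}m => [|n IH] nm.
  have S0 : S 0 = (fun=> 0) by apply/funext => w; rewrite /S big_ord0.
  rewrite S0; split; first exact: measurable_cst.
  split; first by rewrite enorm0; exact: L2_cst.
  rewrite enorm0; under eq_Rintegral do rewrite expr0n.
  by rewrite mean_cst sqr_ge0.
have [mS [S2 Sle]] := IH (ltnW nm).
have SS : S n.+1 = (fun w => S n w + e n w).
  by apply/funext => w; rewrite /S big_ord_recr.
have mS' : measurable_fun setT (S n.+1).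
  by rewrite SS; apply: measurable_rVD => //; exact: me.
split => //; split.
  by rewrite SS; apply: enormD_L2 => //; [exact: me|exact: e2].
have l1 := dot_L1 (me nm) mS (e2 nm) S2.
have [_ ee] := e2 nm; have [_ ss] := S2.
have -> : (fun w => enorm (S n.+1 w) ^+ 2) = (fun w =>
    enorm (S n w) ^+ 2 + 2 * dot (e n w) (S n w) + enorm (e n w) ^+ 2).
  apply/funext => w; rewrite SS !enorm_sqr dotDl !dotDr (dotC (S n w) (e n w)); ring.
rewrite meanD//; last by apply: L1D => //; exact: L1Z.
rewrite meanD//; last exact: L1Z.
rewrite meanZ//.
have d1 := drift nm S2; have d2 := eB nm; have d3 := bnd n S2 Sle.
have d4 : b * E (fun w => enorm (S n w)) <= b * c n by rewrite ler_wpM2l.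
have : c n ^+ 2 + 2 * (b * c n) + B ^+ 2 <= c n.+1 ^+ 2.
  rewrite /c; set r := Num.sqrt n%:R; set r' := Num.sqrt n.+1%:R.
  have r2 : r ^+ 2 = n%:R by rewrite sqr_sqrtr.
  have r'2 : r' ^+ 2 = n%:R + 1 by rewrite sqr_sqrtr// -natr1.
  have rr : r <= r' by rewrite ler_sqrt// ler_nat.
  have r0 : 0 <= r by exact: sqrtr_ge0.
  rewrite -[n.+1%:R]natr1; move: (n%:R : R) (ler0n R n) r2 r'2 => t t0 r2 r'2.
  have h : 0 <= b * (t + 1) * B * (r' - r).
    by rewrite !mulr_ge0// ?subr_ge0// addr_ge0.
  have -> : (b * (t + 1) + B * r') ^+ 2 =
     b ^+ 2 * (t + 1) ^+ 2 + 2 * (b * (t + 1) * B * r') + B ^+ 2 * r' ^+ 2 by ring.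
  have -> : (b * t + B * r) ^+ 2 + 2 * (b * (b * t + B * r)) + B ^+ 2 =
     b ^+ 2 * (t + 1) ^+ 2 - b ^+ 2 + 2 * (b * (t + 1) * B * r) + B ^+ 2 * r ^+ 2 + B ^+ 2.
    by ring.
  rewrite r2 r'2; have := sqr_ge0 b; nra.
by lra.
Qed.

End drift_sum.

Section averaging.
Context {R : realType} {d : nat} (f : 'rV[R]_d -> R) (LH : R).
Hypothesis f2 : twice_differentiable f.
Hypothesis LH0 : 0 <= LH.
Hypothesis fH : forall x y, opnorm (hess f x - hess f y) <= LH * enorm (x - y).

(** The first-order terms at the mean cancel, and the mean minimises the sum of
squared distances, so the squared distances to [c] bound the remainders. *)
Lemma grad_average (M : nat) (y : 'I_M -> 'rV[R]_d) (c : 'rV[R]_d) (r : R) :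
  (0 < M)%N -> (forall i, enorm (y i - c) <= r) ->
  enorm (grad f (M%:R^-1 *: \sum_i y i)) <=
  enorm (M%:R^-1 *: \sum_i grad f (y i)) + LH * r ^+ 2 / 2.
Proof.
move=> M0 yr; set yb := M%:R^-1 *: \sum_i y i.
have Mn0 : M%:R != 0 :> R by rewrite pnatr_eq0 -lt0n.
have MP : 0 < M%:R :> R by rewrite ltr0n.
have Syb : \sum_i y i = M%:R *: yb by rewrite scalerA divff// scale1r.
have S0 : \sum_i (y i - yb) = 0.
  by rewrite sumrB Syb sumr_const card_ord scaler_nat subrr.
have var : \sum_i enorm (y i - yb) ^+ 2 <= M%:R * r ^+ 2.
  have : \sum_i enorm (y i - yb) ^+ 2 <= \sum_i enorm (y i - c) ^+ 2.
    have -> : \sum_i enorm (y i - c) ^+ 2 =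
      \sum_i (enorm (y i - yb) ^+ 2 + 2 * dot (y i - yb) (yb - c) + enorm (yb - c) ^+ 2).
      apply: eq_bigr => i _; have -> : y i - c = (y i - yb) + (yb - c).
        by rewrite addrA subrK.
      move: (y i - yb) (yb - c) => s t.
      by rewrite !enorm_sqr dotDl !dotDr (dotC t); ring.
    rewrite !big_split/= -mulr_sumr -dot_suml S0 dot0l mulr0 addr0 lerDl.
    by apply: sumr_ge0 => i _; exact: sqr_ge0.
  move=> /le_trans; apply; rewrite mulr_natl -[M in X in _ <= X]card_ord -sumr_const.
  apply: ler_sum => i _; rewrite lerXn2r// nnegrE ?enorm_ge0//.
  by rewrite (le_trans (enorm_ge0 _) (yr i)).
pose rem i := grad f (y i) - grad f yb - (y i - yb) *m hess f yb.
have rem_le i : enorm (rem i) <= LH * enorm (y i - yb) ^+ 2 / 2.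
  by have := grad_taylor f2 LH0 fH yb (y i - yb); rewrite addrCA subrr addr0.
have E1 : grad f yb = M%:R^-1 *: \sum_i grad f (y i) - M%:R^-1 *: \sum_i rem i.
  rewrite -scalerBr -sumrB (eq_bigr (fun i => grad f yb + (y i - yb) *m hess f yb)).
    rewrite big_split/= -mulmx_suml S0 mul0mx addr0 sumr_const card_ord.
    by rewrite -[grad f yb *+ M]scaler_nat scalerA mulVf// scale1r.
  by move=> i _; rewrite /rem -[grad f (y i) - _ - _]addrA -opprD subKr.
rewrite {1}E1 (le_trans (enormB _ _))// lerD2l enormZ ger0_norm ?invr_ge0 ?(ltW MP)//.
rewrite ler_pdivrMl// (le_trans (enorm_sum _ _ _))//.
apply: (@le_trans _ _ (\sum_i LH * enorm (y i - yb) ^+ 2 / 2)).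
  by apply: ler_sum => i _; exact: rem_le.
rewrite -mulr_suml -mulr_sumr mulrA ler_wpM2r// mulrCA ler_wpM2l//.
Qed.

End averaging.

(** * Uniform points on segments and uniform block indices *)

Section uniform01.
Context {R : realType}.

Let id01 : measurableTypeR R -> R := id.
Let measurable_id01 : measurable_fun setT id01.
Proof. by move=> _ B mB; rewrite setTI. Qed.

Let mid01 : {mfun measurableTypeR R >-> R} :=
  HB.pack id01 (isMeasurableFun.Build _ _ _ _ _ measurable_id01).

(** [uniform_prob] is a probability on [measurableTypeR R], whose display differs from
that of [R]; this is the same law transported to [R]. *)
Definition uniform01 : probability R R :=
  distribution (uniform_prob (@ltr01 R)) mid01.

Lemma integral_uniform01 (h : R -> R) :
  measurable_fun setT h -> L1 (uniform_prob (@ltr01 R)) h ->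
  (\int[uniform01]_y (h y)%:E = \int[uniform_prob (@ltr01 R)]_y (h y)%:E)%E.
Proof.
by move=> mh ih; rewrite integral_distribution//; exact/measurable_EFinP.
Qed.

End uniform01.

Section random_segment.
Context {R : realType} {d : nat} {dO : measure_display}
  {Omega : measurableType dO} (P : probability Omega R).
Local Notation E := (Rintegral P setT).
Variables (f : 'rV[R]_d -> R) (L : R).
Hypothesis L0 : 0 <= L.
Hypothesis fL : forall x y, `|f x - f y| <= L * enorm (x - y).
Hypothesis f2 : twice_differentiable f.
Variables (G : set (set Omega)) (s : Omega -> R) (x v : Omega -> 'rV[R]_d) (D : R).
Hypothesis GM : G `<=` measurable.
Local Notation OG := (g_sigma_algebraType G).
Hypothesis law_s : has_cond_law P G s (fun=> uniform_prob (@ltr01 R)).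
Hypothesis mx : measurable_fun setT (x : OG -> 'rV[R]_d).
Hypothesis mv : measurable_fun setT (v : OG -> 'rV[R]_d).
Hypothesis vD : forall w, enorm (v w) <= D.

Let U01 : probability R R := uniform01.

Lemma segment_ae : {ae P, forall w, 0 <= s w <= 1}.
Proof.
have mI : measurable (`[0, 1]%classic : set R) by exact: measurable_itv.
have := @cond_law_ae _ _ _ _ _ P G s (cst_kernel U01)
  law_s _ mI.
move=> h; apply: filterS (h _) => [w /=|w]; first by rewrite in_itv.
transitivity (uniform_prob (@ltr01 R) `[0, 1]); first by [].
by rewrite /uniform_prob integral_uniform_pdf1.
Qed.

Lemma measurable_grad : measurable_fun setT (grad f).
Proof. by apply: continuous_measurable_rV; exact: (continuous_grad f2). Qed.

Lemma segment_expectation :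
  E (fun w => dot (grad f (x w + s w *: v w)) (v w)) =
  E (fun w => f (x w + v w) - f (x w)).
Proof.
pose phi (p : OG * R) := dot (grad f (x p.1 + p.2 *: v p.1)) (v p.1).
have mfst (U : OG -> 'rV[R]_d) : measurable_fun setT U ->
    measurable_fun setT (fun p : OG * R => U p.1).
  by move=> mU; apply: (@measurableT_comp _ _ _ _ _ _ U).
have mp : measurable_fun setT phi.
  apply: measurable_dot; last exact: (mfst v).
  apply: (measurableT_comp measurable_grad).
  apply: measurable_rVD; first exact: (mfst x).
  by apply: measurable_rVZ; [exact: measurable_snd|exact: (mfst v)].
have ip : L1 P (fun w => phi (w, s w)).
  apply: (@L1_bdd _ _ _ _ _ (L * D)).
    apply: (@measurableT_comp _ _ _ _ _ _ phi _ (fun w : Omega => (w : OG, s w))) => //.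
    apply: measurable_fun_pair; last by case: law_s.
    exact: (@measurable_from_sub _ _ G GM _ OG id).
  apply: aeW => w; rewrite (le_trans (dot_abs_le _ _))//.
  by rewrite ler_pM ?enorm_ge0//; exact: grad_le.
have inner w : (\int[cst_kernel U01 w]_y (phi (w, y))%:E =
    (f (x w + v w) - f (x w))%:E)%E.
  have [l1 <-] := uniform_line_integral L0 fL f2 (x w) (v w).
  rewrite -mean_EFin// [LHS]integral_uniform01//.
  apply: (@measurableT_comp _ _ _ _ _ _ phi _ (pair w)) => //.
by have [_ ->] := @cond_law_E _ _ _ _ _ P G GM s (cst_kernel U01)
  law_s phi _ mp ip inner.
Qed.

End random_segment.

Section uniform_nat.
Context {R : realType}.
Variable K : nat.
Hypothesis K0 : (0 < K)%N.

Let invK_ge0 : 0 <= (K%:R^-1 : R). Proof. by rewrite invr_ge0. Qed.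

Let counting : {measure set nat -> \bar R} :=
  msum (fun k : nat => (\d_k.+1 : {measure set nat -> \bar R})) K.

Definition uniform_nat (_ : (0 < K)%N) : set nat -> \bar R :=
  mscale (NngNum invK_ge0) counting.

HB.instance Definition _ := Measure.on (uniform_nat K0).

Lemma uniform_natE B : uniform_nat K0 B = uniform_upto R K B.
Proof.
rewrite /uniform_nat /mscale /= /uniform_upto; congr (_ * _)%E.
by rewrite /msum big_add1 big_mkord.
Qed.

Let uniform_natT : uniform_nat K0 setT = 1%E.
Proof.
rewrite uniform_natE /uniform_upto big_add1 big_mkord.
under eq_bigr do rewrite diracT.
rewrite sumEFin sumr_const card_ord -EFinM mulVf//.
by rewrite pnatr_eq0 -lt0n.
Qed.

HB.instance Definition _ := Measure_isProbability.Build _ _ _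
  (uniform_nat K0) uniform_natT.

Lemma integral_uniform_nat (h : nat -> R) : (forall k, 0 <= h k) ->
  (\int[uniform_nat K0]_k (h k)%:E = (K%:R^-1 * \sum_(1 <= k < K.+1) h k)%:E)%E.
Proof.
move=> h0; rewrite ge0_integral_mscale//=; last by move=> k _; rewrite lee_fin.
rewrite ge0_integral_measure_sum//; last by move=> k _; rewrite lee_fin.
rewrite EFinM; congr (_ * _)%E; rewrite big_add1 big_mkord -sumEFin.
by apply: eq_bigr => k _; rewrite integral_dirac//= diracT mul1e.
Qed.

End uniform_nat.

(** The integral of a nonnegative function is a supremum over simple functions
below it, so it is monotone without measurability. It is used for the output of
the run, whose measurability is only known on the event that the block index lies
in its range: draws made beyond the horizon are arbitrary functions. *)
Lemma nonmeasurable_ge0_le_integral {R : realType} {dT : measure_display}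
  {T : measurableType dT} (m : {measure set T -> \bar R}) (g h : T -> \bar R) :
  (forall x, 0 <= g x)%E -> (forall x, g x <= h x)%E ->
  (\int[m]_x g x <= \int[m]_x h x)%E.
Proof.
move=> g0 gh; have h0 x : (0 <= h x)%E by exact: le_trans (gh x).
rewrite !ge0_integralTE//; apply: le_ereal_sup => _ [s sg <-].
by exists s => // x; exact: le_trans (gh x).
Qed.

Section uniform_choice.
Context {R : realType} {dO : measure_display}
  {Omega : measurableType dO} (P : probability Omega R).
Local Notation E := (Rintegral P setT).
Variables (G : set (set Omega)) (k : Omega -> nat) (K : nat) (h : nat -> Omega -> R) (c : R).
Hypothesis GM : G `<=` measurable.
Local Notation OG := (g_sigma_algebraType G).
Hypothesis K0 : (0 < K)%N.
Hypothesis law_k : has_cond_law P G k (fun=> uniform_upto R K).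
Hypothesis h0 : forall j w, 0 <= h j w.
Hypothesis hc : forall j w, h j w <= c.
Hypothesis mh : forall j, (0 < j <= K)%N -> measurable_fun setT (h j : OG -> R).

(** Measurability is assumed only for indices in the range, since the means of
later blocks involve draws about which nothing is known. Outside a null event the
index is in the range; on that event the bound [c] is used. *)
Lemma uniform_choice_expectation :
  (\int[P]_w (h (k w) w)%:E <=
   (K%:R^-1 * \sum_(1 <= j < K.+1) E (h j))%:E)%E.
Proof.
pose hh (j : nat) : Omega -> R := if (0 < j <= K)%N then h j else fun=> 0.
have mhh j : measurable_fun setT (hh j : OG -> R).
  rewrite /hh; case: (boolP (0 < j <= K)%N) => [jK|_]; first exact: mh.
  exact: measurable_cst.
have hh0 j w : 0 <= hh j w by rewrite /hh; case: ifP.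
have c0 : 0 <= c by apply: (@le_trans _ _ (h 0%N point)).
have hhc j w : hh j w <= c by rewrite /hh; case: ifP.
pose phi (p : OG * nat) := hh p.2 p.1.
have mp : measurable_fun setT phi.
  move=> _ B mB; rewrite setTI.
  have -> : phi @^-1` B = \bigcup_j ((hh j : OG -> R) @^-1` B `*` [set j]).
    apply/seteqP; split => [[w j] /= Bj|[w j] [i _ [/= Bi ->]]//].
    by exists j.
  apply: bigcupT_measurable => j; apply: measurableX => //.
  by rewrite -[X in measurable X]setTI; exact: mhh.
have law' : has_cond_law P G k (fun=> uniform_nat K0).
  case: law_k => mk Hk; split => // A B mA mB; rewrite Hk//.
  by apply: eq_integral => w _; rewrite uniform_natE.
have kK : {ae P, forall w, (0 < k w <= K)%N}.
  have mI : measurable [set j | (0 < j <= K)%N] by [].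
  apply: (@cond_law_ae _ _ _ _ _ P G k (cst_kernel (uniform_nat K0)) law' _ mI) => w.
  transitivity (uniform_upto R K [set j | (0 < j <= K)%N]).
    exact: uniform_natE.
  rewrite -[RHS](@probability_setT _ _ _ (uniform_nat K0)) [RHS]uniform_natE.
  congr (_ * _)%E; apply: eq_big_nat => j /andP[j1 jK].
  have jm : [set j | (0 < j <= K)%N] j by rewrite /= j1 -ltnS.
  by rewrite !diracE (mem_set jm) mem_set.
have mphik : measurable_fun setT (fun w => phi (w, k w)).
  apply: (@measurableT_comp _ _ _ _ _ _ phi _ (fun w : Omega => (w : OG, k w))) => //.
  apply: measurable_fun_pair; last by case: law_k.
  exact: (@measurable_from_sub _ _ G GM _ OG id).
have ip : L1 P (fun w => phi (w, k w)).
  by apply: (L1_bdd (c := c) mphik); apply: aeW => w; rewrite ger0_norm// /phi.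
pose cc w := K%:R^-1 * \sum_(1 <= j < K.+1) hh j w.
have inner w : (\int[cst_kernel (uniform_nat K0) w]_j (phi (w, j))%:E = (cc w)%:E)%E.
  by rewrite [LHS](integral_uniform_nat K0 (h := hh ^~ w)).
have [_ EE] := @cond_law_E _ _ _ _ _ P G GM k (cst_kernel (uniform_nat K0)) law'
  phi cc mp ip inner.
have lh j : L1 P (hh j).
  apply: (@L1_bdd _ _ _ _ _ c); first exact: (measurable_from_sub GM (mhh j)).
  by apply: aeW => w; rewrite ger0_norm.
have -> : (K%:R^-1 * \sum_(1 <= j < K.+1) E (h j))%:E = (E cc)%:E.
  rewrite /cc meanZ ?mean_sum//; last exact: L1_sum.
  congr (_ * _)%:E; apply: eq_big_nat => j; rewrite ltnS /hh => ->.
  by [].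
rewrite -EE -mean_EFin//.
pose bad := ~` [set w | (0 < k w <= K)%N].
have mbad : measurable bad.
  apply: measurableC; have : measurable (k @^-1` [set j | (0 < j <= K)%N]).
    by rewrite -[X in measurable X]setTI; case: law_k => mk _; exact: mk.
  by [].
apply: (@le_trans _ _ (\int[P]_w (phi (w, k w) + c * \1_bad w)%:E)%E).
  apply: nonmeasurable_ge0_le_integral => w; rewrite lee_fin//.
  rewrite /phi /hh /=; case: ifPn => kw.
    by rewrite lerDl mulr_ge0//.
  by rewrite add0r indicE mem_set ?mulr1//; exact/negP.
rewrite le_eqVlt; apply/orP; left; apply/eqP.
apply: ae_eq_integral => //.
- apply/measurable_EFinP; apply: measurable_funD => //.
  by apply: measurable_funM => //; exact: measurable_indic.
- exact/measurable_EFinP.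
- by apply: filterS kK => w kw _; rewrite indicE memNset ?mulr0 ?addr0//; exact.
Qed.

End uniform_choice.

(** * The run of the algorithm *)

Section filtration_measurability.
Context {dO : measure_display} {Omega : measurableType dO}.
Implicit Types G : set (set Omega).

Definition measurable_wrt G dU (U : measurableType dU) (h : Omega -> U) :=
  measurable_fun setT (h : g_sigma_algebraType G -> U).

Lemma measurable_wrt_sub G G' dU (U : measurableType dU) (h : Omega -> U) :
  G `<=` G' -> measurable_wrt G h -> measurable_wrt G' h.
Proof.
move=> GG' mh _ A mA; have := mh measurableT A mA.
exact: sub_sigma_algebra2.
Qed.

Lemma measurable_wrt_events G dU (U : measurableType dU) (h : Omega -> U) :
  events_of h `<=` G -> measurable_wrt G h.
Proof.
move=> hG _ A mA; apply: sub_sigma_algebra; apply: hG.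
by exists A.
Qed.

Lemma events_of_measurable dU (U : measurableType dU) (h : Omega -> U) :
  measurable_fun setT h -> events_of h `<=` measurable.
Proof. by move=> mh _ [A mA <-]; exact: mh. Qed.

End filtration_measurability.

Section algorithm.
Context {R : realType} {d : nat} {dX dO : measure_display}
  {X : measurableType dX} {Omega : measurableType dO}
  (P : probability Omega R) (mu : probability 'rV[R]_d R)
  (f : 'rV[R]_d -> R) (F : 'rV[R]_d -> X -> R) (Xi : R.-pker 'rV[R]_d ~> X)
  (sigma L LH : R) (p : zo_input R) (z : zo_draws R d X Omega).
Hypothesis d0 : (0 < d)%N.
Hypothesis muS : uniform_on_sphere mu.
Hypothesis L0 : 0 <= L.
Hypothesis fL : forall x y, `|f x - f y| <= L * enorm (x - y).
Hypothesis f2 : twice_differentiable f.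
Hypothesis LH0 : 0 <= LH.
Hypothesis fH : forall x y, opnorm (hess f x - hess f y) <= LH * enorm (x - y).
Hypothesis szo : is_szo f F Xi sigma.
Hypothesis law : zo_sampling P mu F Xi p z.
Local Notation delta := (Defs.radius p).
Local Notation M := (block_length p).
Local Notation K := (num_blocks p).
Local Notation eta := (stepsize p).
Local Notation T := (horizon p).
Local Notation opt := (zo_opt p).
Hypothesis delta0 : 0 < delta.
Hypothesis M0 : (0 < M)%N.
Hypothesis K0 : (0 < K)%N.
Hypothesis eta0 : 0 < eta.
Local Notation E := (Rintegral P setT).
Local Notation D := (delta / M%:R).

Let D0 : 0 < D. Proof. by rewrite divr_gt0// ltr0n. Qed.

(** State index [i] is the state before iteration [i.+1]: [Delta_ i] is the increment
that this iteration applies, while its random point is [y_ i.+1] and its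
estimator [g_ i]. *)
Let x_ i w := (zo_state p F z w i).1.1.
Let Delta_ i w := (zo_state p F z w i).1.2.
Let y_ i w := zo_y p F z i w.
Let g_ i w := zo_grad p F z w i.+1 (y_ i w) (y_ i.+1 w).

Let stateS i w : [/\ x_ i.+1 w = x_ i w + Delta_ i w,
  y_ i.+1 w = x_ i w + draw_s z i.+1 w *: Delta_ i w &
  Delta_ i.+1 w = if (M %| i.+1)%N then 0 else clip D (Delta_ i w - eta *: g_ i w)].
Proof.
rewrite /g_ /x_ /Delta_ /y_ /zo_y [zo_state p F z w i.+1]/=.
case: (zo_state p F z w i) => -[x Delta_'] y /=; split => //.
by case: ifP => // _; rewrite eproj_ball// ltW.
Qed.

Let x_S i w : x_ i.+1 w = x_ i w + Delta_ i w. Proof. by case: (stateS i w). Qed.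
Let y_S i w : y_ i.+1 w = x_ i w + draw_s z i.+1 w *: Delta_ i w.
Proof. by case: (stateS i w). Qed.
Let Delta_S i w : Delta_ i.+1 w = if (M %| i.+1)%N then 0 else clip D (Delta_ i w - eta *: g_ i w).
Proof. by case: (stateS i w). Qed.

Let Delta_le i w : enorm (Delta_ i w) <= D.
Proof.
case: i => [|i]; first by rewrite /Delta_ /= enorm0 ltW.
by rewrite Delta_S; case: ifP => _; [rewrite enorm0 ltW|rewrite enorm_clip// ltW].
Qed.

(** The sigma-algebras of the draws made before iteration [i.+1], and after its
[s], its [u] and its first oracle draw. *)
Let PA i := zo_past opt z i.
Let HS i := PA i `|` events_of (draw_s z i.+1).
Let HU i := HS i `|` events_of (draw_u z i.+1).
Let HX i := HU i `|` events_of (draw_xi z i.+1).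

Let PAS i : PA i.+1 = HX i `|` match opt with
   OptionI => events_of (draw_xi' z i.+1) | OptionII => set0 end.
Proof. by []. Qed.

Let PA_HS i : PA i `<=` HS i. Proof. by move=> A; left. Qed.
Let HS_HU i : HS i `<=` HU i. Proof. by move=> A; left. Qed.
Let HU_HX i : HU i `<=` HX i. Proof. by move=> A; left. Qed.
Let HX_PA i : HX i `<=` PA i.+1. Proof. by rewrite PAS => A; left. Qed.

Let PA_mono i j : (i <= j)%N -> PA i `<=` PA j.
Proof.
elim: j => [|j IH]; first by rewrite leqn0 => /eqP ->.
rewrite leq_eqVlt => /predU1P[->//|/IH h].
by apply: (subset_trans h) => A /PA_HS /HS_HU /HU_HX /HX_PA.
Qed.

Let ltT i : (i < T)%N -> (1 <= i.+1 <= T)%N. Proof. by []. Qed.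

Let PA_measurable i : (i <= T)%N -> PA i `<=` measurable.
Proof.
elim: i => [_|i IH iT].
  rewrite /PA /=; case E : (zo_opt p); first exact: sub0set.
  have [mu0 _] := zo_law_u0 law E; have [mx0 _] := zo_law_xi0 law E.
  by rewrite subUset; split; exact: events_of_measurable.
have lt := ltT iT.
have [ms _] := zo_law_s law lt; have [mu1 _] := zo_law_u law lt.
have [mx _] := zo_law_xi law lt.
rewrite PAS; case E : (zo_opt p); last first.
  rewrite setU0 /HX /HU /HS !subUset; split; last exact: events_of_measurable.
  split; last exact: events_of_measurable.
  by split; [exact: IH (ltnW iT)|exact: events_of_measurable].
have [mx' _] := zo_law_xi' law E lt.
rewrite /HX /HU /HS !subUset; split; last exact: events_of_measurable.
split; last exact: events_of_measurable.
split; last exact: events_of_measurable.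
by split; [exact: IH (ltnW iT)|exact: events_of_measurable].
Qed.

Let HX_measurable i : (i < T)%N -> HX i `<=` measurable.
Proof. by move=> iT; apply: (subset_trans (@HX_PA i)); exact: PA_measurable. Qed.
Let HU_measurable i : (i < T)%N -> HU i `<=` measurable.
Proof. by move=> iT; apply: (subset_trans (@HU_HX i)); exact: HX_measurable. Qed.
Let HS_measurable i : (i < T)%N -> HS i `<=` measurable.
Proof. by move=> iT; apply: (subset_trans (@HS_HU i)); exact: HU_measurable. Qed.

Let s_HS i : measurable_wrt (HS i) (draw_s z i.+1).
Proof. by apply: measurable_wrt_events => A; right. Qed.
Let u_HU i : measurable_wrt (HU i) (draw_u z i.+1).
Proof. by apply: measurable_wrt_events => A; right. Qed.
Let xi_HX i : measurable_wrt (HX i) (draw_xi z i.+1).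
Proof. by apply: measurable_wrt_events => A; right. Qed.

Let oracle_wrt G (zeta : Omega -> 'rV[R]_d) (xi : Omega -> X) :
  measurable_wrt G zeta -> measurable_wrt G xi ->
  measurable_wrt G (fun w => F (zeta w) (xi w)).
Proof.
move=> mz mx.
apply: (@measurableT_comp _ _ _ _ _ _ (fun q : 'rV[R]_d * X => F q.1 q.2) _
  (fun w : g_sigma_algebraType G => (zeta w, xi w))).
  exact: (szo_measurable szo).
exact: measurable_fun_pair.
Qed.

Let shift_wrt G (Y u : Omega -> 'rV[R]_d) (c : R) :
  measurable_wrt G Y -> measurable_wrt G u ->
  measurable_wrt G (fun w => Y w + c *: u w).
Proof. by move=> mY mu'; apply: measurable_rVD => //; exact: measurable_rVZ. Qed.

(** The oracle value which Option II reuses one iteration later. *)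
Let last i w := F (y_ i w + delta *: draw_u z i w) (draw_xi z i w).

Let adapted i : (i <= T)%N ->
  [/\ measurable_wrt (PA i) (x_ i), measurable_wrt (PA i) (Delta_ i),
    measurable_wrt (PA i) (y_ i),
    opt = OptionII -> measurable_wrt (PA i) (last i) &
    forall j, (j < i)%N -> measurable_wrt (PA j.+1) (g_ j)].
Proof.
elim: i => [_|i IH iT].
  split; [exact: measurable_cst|exact: measurable_cst|exact: measurable_cst| |by []].
  move=> E; apply: oracle_wrt; last first.
    by apply: measurable_wrt_events => A; rewrite /PA /= E; right.
  apply: shift_wrt; first exact: measurable_cst.
  by apply: measurable_wrt_events => A; rewrite /PA /= E; left.
have [mx mD my ml mgg] := IH (ltnW iT).
have PAS' : PA i `<=` PA i.+1 by exact: PA_mono.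
have mx' := measurable_wrt_sub PAS' mx; have mD' := measurable_wrt_sub PAS' mD.
have my' := measurable_wrt_sub PAS' my.
have HSP : HS i `<=` PA i.+1 by move=> A /HS_HU /HU_HX /HX_PA.
have HUP : HU i `<=` PA i.+1 by move=> A /HU_HX /HX_PA.
have ms := measurable_wrt_sub HSP (@s_HS i).
have mu1 := measurable_wrt_sub HUP (@u_HU i).
have mxi := measurable_wrt_sub (@HX_PA i) (@xi_HX i).
have mY : measurable_wrt (PA i.+1) (y_ i.+1).
  rewrite (_ : y_ i.+1 = (fun w => x_ i w + draw_s z i.+1 w *: Delta_ i w)); last first.
    by apply/funext => w; rewrite y_S.
  by apply: measurable_rVD => //; exact: measurable_rVZ.
have mL : measurable_wrt (PA i.+1) (last i.+1).
  by apply: oracle_wrt => //; exact: shift_wrt.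
have mg : measurable_wrt (PA i.+1) (g_ i).
  rewrite /g_ /zo_grad; case E : (zo_opt p).
    apply: measurable_rVZ => //; apply: measurable_funM => //.
    apply: measurable_funB => //.
    have mxi' : measurable_wrt (PA i.+1) (draw_xi' z i.+1).
      by apply: measurable_wrt_events => A; rewrite PAS E; right.
    apply: oracle_wrt => //.
    by apply: measurable_rVB => //; exact: measurable_rVZ.
  apply: measurable_rVZ => //; apply: measurable_funM => //.
  by apply: measurable_funB => //; apply: (measurable_wrt_sub PAS'); exact: ml.
split => //.
- rewrite (_ : x_ i.+1 = (fun w => x_ i w + Delta_ i w)); last first.
    by apply/funext => w; rewrite x_S.
  exact: measurable_rVD.
- rewrite (_ : Delta_ i.+1 = (fun w => if (M %| i.+1)%N then 0 else
      clip D (Delta_ i w - eta *: g_ i w))); last by apply/funext => w; rewrite Delta_S.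
  case: (_ %| _)%N; first exact: measurable_cst.
  by apply: measurable_clip; apply: measurable_rVB => //; exact: measurable_rVZ.
- by move=> j; rewrite ltnS leq_eqVlt => /predU1P[->//|]; exact: mgg.
Qed.

Let x_PA i : (i <= T)%N -> measurable_wrt (PA i) (x_ i).
Proof. by move=> /adapted[]. Qed.
Let Delta_PA i : (i <= T)%N -> measurable_wrt (PA i) (Delta_ i).
Proof. by move=> /adapted[]. Qed.
Let y_PA i : (i <= T)%N -> measurable_wrt (PA i) (y_ i).
Proof. by move=> /adapted[]. Qed.
Let last_PA i : (i <= T)%N -> opt = OptionII -> measurable_wrt (PA i) (last i).
Proof. by move=> /adapted[]. Qed.
Let g_PA i : (i < T)%N -> measurable_wrt (PA i.+1) (g_ i).
Proof. by move=> /adapted[_ _ _ _]; apply. Qed.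

Let Y_HS i : (i < T)%N -> measurable_wrt (HS i) (y_ i.+1).
Proof.
move=> iT; rewrite (_ : y_ i.+1 = (fun w => x_ i w + draw_s z i.+1 w *: Delta_ i w)); last first.
  by apply/funext => w; rewrite y_S.
have mx := measurable_wrt_sub (@PA_HS i) (x_PA (ltnW iT)).
have mD := measurable_wrt_sub (@PA_HS i) (Delta_PA (ltnW iT)).
by apply: measurable_rVD => //; exact: (measurable_rVZ (@s_HS i) mD).
Qed.

Let mf : measurable_fun setT f. Proof. exact: (measurable_f f2). Qed.

Let u_ae i : (i < T)%N -> {ae P, forall w, enorm (draw_u z i.+1 w) = 1}.
Proof. by move=> iT; exact: (direction_ae muS (zo_law_u law (ltT iT))). Qed.

Let s_ae i : (i < T)%N -> {ae P, forall w, 0 <= draw_s z i.+1 w <= 1}.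
Proof. by move=> iT; exact: (segment_ae (zo_law_s law (ltT iT))). Qed.

Let noise i w := last i w - f (y_ i w + delta *: draw_u z i w).

Let zeta_HU i (c : R) : (i < T)%N ->
  measurable_wrt (HU i) (fun w => y_ i.+1 w + c *: draw_u z i.+1 w).
Proof.
by move=> iT; apply: shift_wrt => //; exact: (measurable_wrt_sub (@HS_HU i) (Y_HS iT)).
Qed.

Let noiseS_L2 i : (i < T)%N ->
  L2 P (noise i.+1) /\ E (fun w => noise i.+1 w ^+ 2) <= sigma ^+ 2.
Proof.
move=> iT; apply: (noise_L2 mf szo (HU_measurable iT) (zeta_HU delta iT)).
exact: (zo_law_xi law (ltT iT)).
Qed.

Let noise0_L2 : opt = OptionII ->
  L2 P (noise 0) /\ E (fun w => noise 0 w ^+ 2) <= sigma ^+ 2.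
Proof.
move=> E; have lu := zo_law_u0 law E; have lx := zo_law_xi0 law E.
have [mu0 _] := lu.
apply: (noise_L2 mf szo (events_of_measurable mu0) _ lx).
apply: shift_wrt; first exact: measurable_cst.
exact: measurable_wrt_events.
Qed.

Let noise_orth i h : (i < T)%N -> measurable_wrt (HU i) h -> L2 P h ->
  E (fun w => noise i.+1 w * h w) = 0.
Proof.
move=> iT; apply: (noise_orthogonal mf szo (HU_measurable iT) (zeta_HU delta iT)).
exact: (zo_law_xi law (ltT iT)).
Qed.

Let b := LH * delta ^+ 2 / 2.
Let grad_ i w := grad f (y_ i.+1 w).

(** The second moment bound [3 * (A2 + B2 + W2)] of the estimators, for a noise of
second moment [(d / delta * sigma) ^+ 2], a smooth part at most [d * L], and a
reused value of second moment
[18 * (d * L) ^+ 2 + 2 * (d / delta * sigma) ^+ 2]. *)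
Let Q0 := 57 * (d%:R * L) ^+ 2 + 9 * (d%:R / delta * sigma) ^+ 2.

Let gain : R := d%:R / delta.

Let gain_ge0 : 0 <= gain. Proof. by rewrite divr_ge0// ltW. Qed.

Let half_gain_ge0 : 0 <= gain / 2. Proof. exact: divr_ge0 gain_ge0 (ler0n _ 2). Qed.

Let gainL : gain * (L * delta) = d%:R * L.
Proof. by rewrite /gain; field; rewrite gt_eqF. Qed.

Let mgrad : measurable_fun setT (grad f). Proof. exact: (measurable_grad f2). Qed.

(** What the analysis of a block uses about the estimators. *)
Let good_estimator i :=
  (forall Z, measurable_wrt (HS i) Z -> L2 P (fun w => enorm (Z w)) ->
     E (fun w => dot (g_ i w - grad_ i w) (Z w)) <= b * E (fun w => enorm (Z w))) /\
  L2 P (fun w => enorm (g_ i w)) /\ E (fun w => enorm (g_ i w) ^+ 2) <= Q0.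

Let good_estimator_of_sum i (q : 'rV[R]_d -> 'rV[R]_d -> R) (A W : Omega -> R) :
  (i < T)%N ->
  (forall w, g_ i w = (A w + q (y_ i.+1 w) (draw_u z i.+1 w) + W w) *: draw_u z i.+1 w) ->
  measurable_fun setT (fun p : 'rV[R]_d * 'rV[R]_d => q p.1 p.2) ->
  (forall y x, enorm x = 1 -> `|q y x| <= d%:R * L) ->
  (forall y v, Rintegral mu setT (fun x => q y x * dot x v) <=
     dot (grad f y) v + b * enorm v) ->
  L2 P A ->
  (forall Z, measurable_wrt (HS i) Z -> L2 P (fun w => enorm (Z w)) ->
     E (fun w => A w * dot (draw_u z i.+1 w) (Z w)) = 0) ->
  E (fun w => A w ^+ 2) <= (gain * sigma) ^+ 2 ->
  measurable_wrt (HS i) W -> L2 P W ->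
  E (fun w => W w ^+ 2) <= 18 * (d%:R * L) ^+ 2 + 2 * (gain * sigma) ^+ 2 ->
  good_estimator i.
Proof.
move=> iT g_E mq qB qb A2 AZ Ale mW W2 Wle.
have law_u := zo_law_u law (ltT iT).
have HM := HS_measurable iT; have mY := Y_HS iT.
have {}g_E : g_ i = (fun w => (A w + q (y_ i.+1 w) (draw_u z i.+1 w) + W w) *: draw_u z i.+1 w).
  exact/funext.
split=> [Z mZ Z2|]; rewrite g_E.
  exact: (estimator_bias muS HM law_u mY mZ Z2 mq mgrad qB
    (grad_le L0 fL f2) qb A2 (AZ Z mZ Z2) mW W2).
have dL0 : 0 <= d%:R * L by rewrite mulr_ge0.
have [l2 le] := estimator_L2 muS HM law_u mY mq dL0 qB A2 W2.
split => //; apply: (le_trans le); rewrite /Q0 -/gain; lra.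
Qed.

Let joint_shift (c : R) :
  measurable_fun setT (fun p : 'rV[R]_d * 'rV[R]_d => f (p.1 + c *: p.2)).
Proof.
apply: (measurableT_comp mf); apply: measurable_rVD; first exact: measurable_fst.
by apply: measurable_rVZ => //; exact: measurable_snd.
Qed.

Let dot_HU i Z : (i < T)%N -> measurable_wrt (HS i) Z ->
  measurable_wrt (HU i) (fun w => dot (draw_u z i.+1 w) (Z w)).
Proof.
move=> iT mZ; apply: measurable_dot => //; first exact: u_HU.
exact: (measurable_wrt_sub (@HS_HU i) mZ).
Qed.

(** The two noises of the difference are centered given different pasts, the
second one given also the first draw. *)
Let good_estimatorI i : (i < T)%N -> opt = OptionI -> good_estimator i.
Proof.
move=> iT EI.
pose u := draw_u z i.+1; pose Y := y_ i.+1.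
pose N' w := F (Y w - delta *: u w) (draw_xi' z i.+1 w) - f (Y w - delta *: u w).
have lawx' := zo_law_xi' law EI (ltT iT).
have mz' : measurable_wrt (HX i) (fun w => Y w - delta *: u w).
  under eq_fun do rewrite -scaleNr.
  exact: (measurable_wrt_sub (@HU_HX i) (zeta_HU (- delta) iT)).
have [N'2 N'le] : L2 P N' /\ E (fun w => N' w ^+ 2) <= sigma ^+ 2.
  exact: (noise_L2 mf szo (HX_measurable iT) mz' lawx').
have [N2 Nle] := noiseS_L2 iT.
pose A w := gain / 2 * (noise i.+1 w - N' w).
pose q y x := gain / 2 * (f (y + delta *: x) - f (y - delta *: x)).
apply: (@good_estimator_of_sum i q A (fun=> 0)) => //.
- move=> w; rewrite /g_ /zo_grad EI; congr (_ *: _).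
  rewrite /A /q /noise /N' /last -/u -/Y -/(Y w) -/(u w) addr0 /gain.
  by field; rewrite gt_eqF.
- apply: measurable_funM => //; apply: measurable_funB; first exact: joint_shift.
  by under eq_fun do rewrite -scaleNr; exact: joint_shift.
- move=> y x x1; rewrite /q normrM (ger0_norm half_gain_ge0).
  apply: le_trans (ler_wpM2l half_gain_ge0 (central_le fL delta0 y x1)) _.
  by rewrite -gainL le_eqVlt; apply/orP; left; apply/eqP; field.
- move=> y v; apply: le_trans (sphere_central_bias d0 muS L0 fL f2 LH0 fH delta0 y v).
  have l1 : L1 mu (fun x => (f (y + delta *: x) - f (y - delta *: x)) * dot x v).
    apply: (sphere_L1 muS (c := 2 * L * delta * enorm v)) => [|x x1].
      apply: measurable_funM; last exact: measurable_dotl.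
      apply: measurable_funB; first exact: (measurable_shift f2).
      by under eq_fun do rewrite -scaleNr; exact: (measurable_shift f2).
    by rewrite normrM ler_pM//; [exact: central_le|exact: sphere_dot_le].
  rewrite -meanZ// le_eqVlt; apply/orP; left; apply/eqP; apply: eq_Rintegral => x _.
  by rewrite /q /gain; field; rewrite gt_eqF.
- by apply: L2Z; exact: L2B.
- move=> Z mZ Z2; have lu := direction_dot_L2 muS (HS_measurable iT)
    (zo_law_u law (ltT iT)) mZ Z2.
  have mu1 := dot_HU iT mZ; have mu2 := measurable_wrt_sub (@HU_HX i) mu1.
  rewrite (_ : (fun w => _) = (fun w => gain / 2 * (noise i.+1 w * dot (u w) (Z w)
    - N' w * dot (u w) (Z w)))); last by apply/funext => w; rewrite /A /u; ring.
  have l1 := L2_L1M N2 lu; have l2 := L2_L1M N'2 lu.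
  rewrite meanZ ?meanB//; last exact: L1B.
  rewrite noise_orth// (noise_orthogonal mf szo (HX_measurable iT) mz' lawx')//.
  by rewrite subrr mulr0.
- have [_ n1] := N2; have [_ n2] := N'2.
  apply: (@le_trans _ _ (E (fun w => gain ^+ 2 / 2 * (noise i.+1 w ^+ 2 + N' w ^+ 2)))).
    apply: mean_le; [|by case: (L2Z (gain / 2) (L2B N2 N'2))|by apply: L1Z; exact: L1D].
    apply: aeW => w; rewrite /A; move: (noise _ w) (N' w) => s t.
    have := mulr_ge0 (sqr_ge0 gain) (sqr_ge0 (s + t)); nra.
  rewrite meanZ ?meanD//; last exact: L1D.
  have -> : (gain * sigma) ^+ 2 = gain ^+ 2 / 2 * (sigma ^+ 2 + sigma ^+ 2) by field.
  by apply: ler_wpM2l; [exact: divr_ge0 (sqr_ge0 gain) (ler0n _ 2)|exact: lerD].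
- exact: measurable_cst.
- exact: L2_cst.
- under eq_Rintegral do rewrite expr0n.
  by rewrite mean_cst addr_ge0// mulr_ge0// sqr_ge0.
Qed.

Let D_le_delta : D <= delta.
Proof. by rewrite ler_pdivrMr ?ltr0n// ler_peMr ?ler1n// ltW. Qed.

Let scaled_Delta_le (c : R) i w : 0 <= c <= 1 -> enorm (c *: Delta_ i w) <= D.
Proof.
move=> /andP[c0 c1]; rewrite enormZ ger0_norm// (le_trans _ (Delta_le i w))//.
by rewrite ler_piMl// enorm_ge0.
Qed.

Let x_y_ae i : (i < T)%N -> {ae P, forall w, enorm (x_ i w - y_ i w) <= D}.
Proof.
case: i => [|i] iT.
  by apply: aeW => w; rewrite /x_ /y_ /zo_y /= subrr enorm0 ltW.
apply: filterS (s_ae (ltnW iT)) => w /andP[s0 s1].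
have -> : x_ i.+1 w - y_ i.+1 w = (1 - draw_s z i.+1 w) *: Delta_ i w.
  by rewrite x_S y_S opprD addrACA subrr add0r scalerBl scale1r.
by rewrite scaled_Delta_le// subr_ge0 s1 gerBl.
Qed.

Let y_step_ae i : (i < T)%N ->
  {ae P, forall w, enorm (y_ i.+1 w - y_ i w) <= 2 * delta}.
Proof.
move=> iT; near=> w.
have -> : y_ i.+1 w - y_ i w = draw_s z i.+1 w *: Delta_ i w + (x_ i w - y_ i w).
  by rewrite y_S addrA [in RHS](addrC (_ *: _)).
rewrite (le_trans (enormD _ _))// mulr_natl mulr2n; apply: lerD.
  rewrite (le_trans _ D_le_delta)//; apply: scaled_Delta_le.
  by near: w; exact: s_ae.
rewrite (le_trans _ D_le_delta)//; near: w; exact: x_y_ae.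
Unshelve. all: by end_near. Qed.

(** The reused value was drawn at the point [y_ i + delta *: u_i], at distance at
most [3 * delta] from [y_ i.+1], so [f (y_ i.+1) - last i] is a bounded quantity minus the
previous noise. It is known before [u] is drawn, and thus harmless in mean. *)
Let good_estimatorII i : (i < T)%N -> opt = OptionII -> good_estimator i.
Proof.
move=> iT EII.
pose u := draw_u z i.+1; pose Y := y_ i.+1.
have [N2 Nle] := noiseS_L2 iT.
have [N'2 N'le] : L2 P (noise i) /\ E (fun w => noise i w ^+ 2) <= sigma ^+ 2.
  by case: i iT u Y N2 Nle => [|i] iT u Y N2 Nle; [exact: noise0_L2|exact: noiseS_L2 (ltnW iT)].
have u'1 : {ae P, forall w, enorm (draw_u z i w) = 1}.
  case: i iT u Y N2 Nle N'2 N'le => [|i] iT u Y N2 Nle N'2 N'le.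
    exact: (direction_ae muS (zo_law_u0 law EII)).
  exact: u_ae (ltnW iT).
pose A w := gain * noise i.+1 w.
pose W w := gain * (f (Y w) - last i w).
pose q y x := gain * (f (y + delta *: x) - f y).
have mYO : measurable_fun setT Y := measurable_from_sub (HS_measurable iT) (Y_HS iT).
have mlO : measurable_fun setT (last i).
  exact: (measurable_from_sub (PA_measurable (ltnW iT)) (last_PA (ltnW iT) EII)).
pose J w := f (Y w) - last i w + noise i w.
have JE w : J w = f (Y w) - f (y_ i w + delta *: draw_u z i w).
  by rewrite /J /noise addrA subrK.
have J2 : L2 P J.
  apply: (@L2_bdd _ _ _ _ _ (3 * (L * delta))).
    apply: measurable_funD; last by case: N'2.
    by apply: measurable_funB => //; exact: (measurableT_comp mf).
  near=> w; rewrite JE (le_trans (fL _ _))//.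
  rewrite mulrCA ler_wpM2l// opprD addrA (le_trans (enormB _ _))//.
  rewrite enormZ gtr0_norm// (_ : enorm (draw_u _ _ _) = 1); last by near: w.
  rewrite mulr1 (_ : 3 = 2 + 1 :> R); last by ring.
  by rewrite mulrDl mul1r lerD2r; near: w; exact: y_step_ae.
have Jle : E (fun w => J w ^+ 2) <= 9 * (L * delta) ^+ 2.
  rewrite -(mean_cst P (9 * _)); apply: mean_le; [|by case: J2|exact: L1_cst].
  near=> w; have -> : 9 * (L * delta) ^+ 2 = (3 * (L * delta)) ^+ 2 by ring.
  rewrite -(real_normK (num_real (J w))); apply: lerXn2r; rewrite ?nnegrE//.
    by rewrite !mulr_ge0// ltW.
  rewrite JE (le_trans (fL _ _))//.
  rewrite mulrCA ler_wpM2l// opprD addrA (le_trans (enormB _ _))//.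
  rewrite enormZ gtr0_norm// (_ : enorm (draw_u _ _ _) = 1); last by near: w.
  rewrite mulr1 (_ : 3 = 2 + 1 :> R); last by ring.
  by rewrite mulrDl mul1r lerD2r; near: w; exact: y_step_ae.
have WE : W = (fun w => gain * (J w - noise i w)).
  by apply/funext => w; rewrite /W /J addrK.
have W2 : L2 P W by rewrite WE; apply: L2Z; exact: L2B.
apply: (@good_estimator_of_sum i q A W) => //.
- move=> w; rewrite /g_ /zo_grad EII; congr (_ *: _).
  by rewrite /A /q /W /noise /last -/u -/Y -/(Y w) -/(u w) -/gain [i.+1.-1]/=; ring.
- apply: measurable_funM => //; apply: measurable_funB; first exact: joint_shift.
  exact: (measurableT_comp mf).
- move=> y x x1; rewrite /q normrM (ger0_norm gain_ge0) -gainL.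
  apply: ler_wpM2l => //.
  by rewrite (le_trans (f_shift_le fL _ _ x1))// gtr0_norm.
- by move=> y v; exact: (sphere_onepoint_bias d0 muS L0 fL f2 LH0 fH delta0 y v).
- exact: L2Z.
- move=> Z mZ Z2; have lu := direction_dot_L2 muS (HS_measurable iT)
    (zo_law_u law (ltT iT)) mZ Z2.
  under eq_Rintegral do rewrite /A -mulrA.
  by rewrite meanZ ?noise_orth ?mulr0//; [exact: dot_HU|exact: L2_L1M].
- under eq_Rintegral do rewrite /A exprMn.
  rewrite meanZ; last by case: N2.
  by rewrite (exprMn 2 gain sigma); apply: ler_wpM2l => //; exact: sqr_ge0.
- apply: measurable_funM => //; apply: measurable_funB.
    by apply: (measurableT_comp mf); exact: Y_HS.
  exact: (measurable_wrt_sub (@PA_HS i) (last_PA (ltnW iT) EII)).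
- have [_ n1] := J2; have [_ n2] := N'2.
  rewrite WE; apply: (@le_trans _ _ (E (fun w => gain ^+ 2 * 2 * (J w ^+ 2 + noise i w ^+ 2)))).
    apply: mean_le; [|by case: (L2Z gain (L2B J2 N'2))|by apply: L1Z; exact: L1D].
    apply: aeW => w; move: (noise _ w) (J w) => s t.
    have := mulr_ge0 (sqr_ge0 gain) (sqr_ge0 (s + t)); nra.
  rewrite meanZ ?meanD//; last exact: L1D.
  have -> : 18 * (d%:R * L) ^+ 2 + 2 * (gain * sigma) ^+ 2 =
      gain ^+ 2 * 2 * (9 * (L * delta) ^+ 2 + sigma ^+ 2).
    by rewrite -gainL; ring.
  apply: ler_wpM2l; last exact: lerD.
  by rewrite mulr_ge0// sqr_ge0.
Unshelve. all: by end_near. Qed.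

Let estimator_ok i : (i < T)%N -> good_estimator i.
Proof.
by move=> iT; case E: (zo_opt p); [exact: good_estimatorI|exact: good_estimatorII].
Qed.

Variables (B gamma : R).
Hypothesis B0 : 0 < B.
Hypothesis Q0B : 2 * Q0 + 2 * L ^+ 2 <= B ^+ 2.
Hypothesis fgap : forall x, f 0 - f x <= gamma.

Let err i w := g_ i w - grad_ i w.

Let b0 : 0 <= b. Proof. by rewrite divr_ge0// mulr_ge0// sqr_ge0. Qed.

Let Q0_ge0 : 0 <= Q0.
Proof. by rewrite addr_ge0// mulr_ge0// sqr_ge0. Qed.

Let grad_PA i : (i < T)%N -> measurable_wrt (PA i.+1) (grad_ i).
Proof. by move=> iT; apply: (measurableT_comp mgrad); exact: y_PA. Qed.

Let err_PA i : (i < T)%N -> measurable_wrt (PA i.+1) (err i).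
Proof. by move=> iT; apply: measurable_rVB; [exact: g_PA|exact: grad_PA]. Qed.

Let PA_O i dU (U : measurableType dU) (h : Omega -> U) : (i <= T)%N ->
  measurable_wrt (PA i) h -> measurable_fun setT h.
Proof. by move=> iT; apply: measurable_from_sub; exact: PA_measurable. Qed.

Let mgrad_O i : (i < T)%N -> measurable_fun setT (grad_ i).
Proof. by move=> iT; apply: (@PA_O i.+1) => //; exact: grad_PA. Qed.

Let merr_O i : (i < T)%N -> measurable_fun setT (err i).
Proof. by move=> iT; apply: (@PA_O i.+1) => //; exact: err_PA. Qed.

Let mDelta_O i : (i < T)%N -> measurable_fun setT (Delta_ i).
Proof. by move=> iT; apply: (@PA_O i); [exact: ltnW|exact: (Delta_PA (ltnW iT))]. Qed.

Let grad_L2 i : (i < T)%N -> L2 P (fun w => enorm (grad_ i w)).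
Proof.
move=> iT; apply: (@L2_bdd _ _ _ _ _ L); first by apply: measurable_enorm; exact: mgrad_O.
by apply: aeW => w; rewrite ger0_norm ?enorm_ge0//; exact: grad_le.
Qed.

Let Delta_L2 i : (i < T)%N -> L2 P (fun w => enorm (Delta_ i w)).
Proof.
move=> iT; apply: (@L2_bdd _ _ _ _ _ D); first by apply: measurable_enorm; exact: mDelta_O.
by apply: aeW => w; rewrite ger0_norm ?enorm_ge0.
Qed.

Let err_L2 i : (i < T)%N -> L2 P (fun w => enorm (err i w)).
Proof.
move=> iT; have [_ [g2 _]] := estimator_ok iT.
apply: (L2_dom _ _ (L2D g2 (grad_L2 iT))); first by apply: measurable_enorm; exact: merr_O.
by apply: aeW => w; rewrite ger0_norm ?enorm_ge0// enormB.
Qed.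

Let g_B i : (i < T)%N -> E (fun w => enorm (g_ i w) ^+ 2) <= B ^+ 2.
Proof.
move=> iT; have [_ [_ le]] := estimator_ok iT.
apply: (le_trans le); apply: le_trans Q0B.
rewrite [2 * Q0]mulr_natl mulr2n -addrA lerDl addr_ge0 ?Q0_ge0//.
by rewrite mulr_ge0// sqr_ge0.
Qed.

Let err_B i : (i < T)%N -> E (fun w => enorm (err i w) ^+ 2) <= B ^+ 2.
Proof.
move=> iT; have [_ [[_ g2] le]] := estimator_ok iT.
apply: (@le_trans _ _ (E (fun w => 2 * enorm (g_ i w) ^+ 2 + 2 * L ^+ 2))).
  apply: mean_le; [|by case: (err_L2 iT)|by apply: L1D; [exact: L1Z|exact: L1_cst]].
  apply: aeW => w; rewrite (le_trans (enorm_sqrD_le _ _))// enormN lerD2l.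
  rewrite ler_wpM2l//; apply: lerXn2r; rewrite ?nnegrE ?enorm_ge0//.
  exact: grad_le.
rewrite meanD; [|exact: L1Z|exact: L1_cst].
by rewrite meanZ// mean_cst; apply: le_trans Q0B; rewrite lerD2r ler_wpM2l.
Qed.

Let x_le i w : enorm (x_ i w) <= i%:R * D.
Proof.
elim: i => [|i IH]; first by rewrite /x_ /= enorm0 mul0r.
by rewrite x_S (le_trans (enormD _ _))// -natr1 mulrDl mul1r lerD.
Qed.

Let fx i := E (fun w => f (x_ i w)).

Let fx_L1 i : (i <= T)%N -> L1 P (fun w => f (x_ i w)).
Proof.
move=> iT; apply: (@L1_bdd _ _ _ _ _ (`|f 0| + L * (i%:R * D))).
  apply: (measurableT_comp mf); apply: (@PA_O i) => //; exact: x_PA.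
apply: aeW => w; rewrite -[f (x_ i w)](subrK (f 0)) addrC.
rewrite (le_trans (ler_normD _ _))// lerD2l (le_trans (fL _ _))// subr0.
by rewrite ler_wpM2l.
Qed.

Let grad_Delta i : (i < T)%N ->
  E (fun w => dot (grad_ i w) (Delta_ i w)) = fx i.+1 - fx i.
Proof.
move=> iT; have iT' := ltnW iT.
have := segment_expectation L0 fL f2 (PA_measurable iT') (zo_law_s law (ltT iT))
  (x_PA iT') (Delta_PA iT') (Delta_le i).
rewrite (_ : (fun w => dot (grad f _) _) = (fun w => dot (grad_ i w) (Delta_ i w))); last first.
  by apply/funext => w; rewrite /grad_ y_S.
move=> ->; rewrite meanB; [|by under eq_fun do rewrite -x_S; exact: fx_L1|exact: fx_L1].
by congr (_ - _); rewrite /fx; congr Rintegral; apply/funext => w; rewrite x_S.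
Qed.

Section block.
Variable k : nat.
Hypothesis kK : (k < K)%N.

Let iT n : (n < M)%N -> (n + k * M < T)%N.
Proof.
move=> nM; rewrite /horizon (@leq_trans (k.+1 * M))//.
  by rewrite mulSn ltn_add2r.
by rewrite leq_mul2r kK orbT.
Qed.

Let Delta_start w : Delta_ (0 + k * M)%N w = 0.
Proof.
rewrite add0n; case E : (k * M)%N => [|m]; first by [].
by rewrite Delta_S -E dvdn_mull.
Qed.

Let Delta_next n w : (n.+1 < M)%N ->
  Delta_ (n.+1 + k * M)%N w = clip D (Delta_ (n + k * M)%N w - eta *: g_ (n + k * M) w).
Proof.
move=> nM; rewrite addSn Delta_S -addSn dvdn_addl ?dvdn_mull// gtnNdvd//.
Qed.

Let block_drift : E (fun w => enorm (\sum_(n < M) err (n + k * M) w)) <=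
  b * M%:R + B * Num.sqrt M%:R.
Proof.
apply: (@drift_sum_enorm _ _ _ _ P (fun n => err (n + k * M)) M b B b0 (ltW B0)).
- by move=> n /iT; exact: merr_O.
- by move=> n /iT; exact: err_L2.
- by move=> n /iT; exact: err_B.
move=> n nM S2; have [h _] := estimator_ok (iT nM).
apply: h S2; apply: (measurable_wrt_sub (@PA_HS _)).
suff: forall m, (m <= n)%N ->
    measurable_wrt (PA (n + k * M)) (fun w => \sum_(i < m) err (i + k * M)%N w).
  by apply.
elim=> [_|m IH mn].
  have -> : (fun w => \sum_(i < 0) err (i + k * M)%N w) = (fun=> 0).
    by apply/funext => w; rewrite big_ord0.
  exact: measurable_cst.
have -> : (fun w => \sum_(i < m.+1) err (i + k * M)%N w) =
    (fun w => \sum_(i < m) err (i + k * M)%N w + err (m + k * M) w).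
  by apply/funext => w; rewrite big_ord_recr.
apply: measurable_rVD; first exact: IH (ltnW mn).
have mM : (m < M)%N by exact: ltn_trans mn nM.
apply: (measurable_wrt_sub _ (err_PA (iT mM))).
by apply: PA_mono; rewrite -addSn leq_add2r.
Qed.

Let err_sum_L1 : L1 P (fun w => enorm (\sum_(n < M) err (n + k * M) w)).
Proof.
apply: enorm_sum_L1 => n; first by apply: merr_O; exact: iT.
by apply: L2_L1; apply: err_L2; exact: iT.
Qed.

(** The pathwise inequality [block_regret] in expectation: the first term is the
mean decrease of [f] over the block. *)
Lemma block_bound :
  D * E (fun w => enorm (\sum_(n < M) grad_ (n + k * M) w)) <=
  fx (k * M) - fx (k.+1 * M) + (D ^+ 2 / (2 * eta) + eta / 2 * (M%:R * B ^+ 2))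
  + M%:R * (b * D) + D * (b * M%:R + B * Num.sqrt M%:R).
Proof.
have lgD (n : 'I_M) : L1 P (fun w => dot (grad_ (n + k * M) w) (Delta_ (n + k * M)%N w)).
  by apply: dot_L1; [apply: mgrad_O|apply: mDelta_O|apply: grad_L2|apply: Delta_L2]; exact: iT.
have leD (n : 'I_M) : L1 P (fun w => dot (err (n + k * M) w) (Delta_ (n + k * M)%N w)).
  by apply: dot_L1; [apply: merr_O|apply: mDelta_O|apply: err_L2|apply: Delta_L2]; exact: iT.
have lg (n : 'I_M) : L1 P (fun w => enorm (g_ (n + k * M) w) ^+ 2).
  by have [_ [[_ g2] _]] := estimator_ok (iT (ltn_ord n)).
pose S_gD w := \sum_(n < M) dot (grad_ (n + k * M) w) (Delta_ (n + k * M)%N w).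
pose S_g2 w := \sum_(n < M) enorm (g_ (n + k * M) w) ^+ 2.
pose S_eD w := \sum_(n < M) dot (err (n + k * M) w) (Delta_ (n + k * M)%N w).
pose S_e w := enorm (\sum_(n < M) err (n + k * M) w).
have l1 : L1 P S_gD by exact: L1_sum.
have l2 : L1 P S_g2 by exact: L1_sum.
have l3 : L1 P S_eD by exact: L1_sum.
have path w : D * enorm (\sum_(n < M) grad_ (n + k * M) w) <=
    D ^+ 2 / (2 * eta) + (-1) * S_gD w + eta / 2 * S_g2 w + (-1) * S_eD w + D * S_e w.
  have := @block_regret R d D eta M (fun n => Delta_ (n + k * M)%N w)
    (fun n => g_ (n + k * M) w) (fun n => grad_ (n + k * M) w) (ltW D0) eta0
    (Delta_start w) (fun n nM => Delta_next w nM).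
  rewrite (_ : \sum_(i < M) dot (grad_ (i + k * M) w - g_ (i + k * M) w) _ = - S_eD w).
    rewrite -/(S_gD w) -/(S_g2 w) -/(S_e w) => h; rewrite !mulN1r; apply: (le_trans h).
    by rewrite le_eqVlt; apply/orP; left; apply/eqP; ring.
  by rewrite /S_eD -sumrN; apply: eq_bigr => n _; rewrite -dotNl opprB.
have lV : L1 P (fun w => enorm (\sum_(n < M) grad_ (n + k * M) w)).
  apply: enorm_sum_L1 => n; first by apply: mgrad_O; exact: iT.
  by apply: L2_L1; apply: grad_L2; exact: iT.
have lc := L1_cst P (D ^+ 2 / (2 * eta)).
have lR1 : L1 P (fun w => D ^+ 2 / (2 * eta) + (-1) * S_gD w).
  by apply: L1D => //; exact: L1Z.
have lR2 : L1 P (fun w => D ^+ 2 / (2 * eta) + (-1) * S_gD w + eta / 2 * S_g2 w).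
  by apply: L1D => //; exact: L1Z.
have lR3 : L1 P (fun w => D ^+ 2 / (2 * eta) + (-1) * S_gD w + eta / 2 * S_g2 w + (-1) * S_eD w).
  by apply: L1D => //; exact: L1Z.
rewrite -meanZ//; apply: le_trans (mean_le (aeW _ path) _ _) _.
- exact: L1Z.
- by apply: L1D => //; exact: L1Z.
rewrite meanD//; last exact: L1Z.
rewrite meanD//; last exact: L1Z.
rewrite meanD//; last exact: L1Z.
rewrite meanD//; last exact: L1Z.
rewrite mean_cst !meanZ//.
have E1 : E S_gD = fx (k.+1 * M) - fx (k * M).
  rewrite mean_sum// (eq_bigr (fun n : 'I_M => fx (n.+1 + k * M) - fx (n + k * M))); last first.
    by move=> n _; rewrite grad_Delta ?addSn//; exact: iT.
  rewrite -(big_mkord xpredT (fun n => fx (n.+1 + k * M) - fx (n + k * M))).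
  by rewrite (telescope_sumr (fun n => fx (n + k * M))).
have E2 : E S_g2 <= M%:R * B ^+ 2.
  rewrite mean_sum// mulr_natl -[M in X in _ <= X]card_ord -sumr_const.
  by apply: ler_sum => n _; apply: g_B; exact: iT.
have E3 : - E S_eD <= M%:R * (b * D).
  have <- : \sum_(n < M) b * D = M%:R * (b * D).
    by rewrite sumr_const card_ord mulr_natl.
  rewrite mean_sum// -sumrN; apply: ler_sum => n _.
  have [h _] := estimator_ok (iT (ltn_ord n)).
  have mN : measurable_wrt (HS (n + k * M)) (fun w => -1 *: Delta_ (n + k * M)%N w).
    apply: measurable_rVZ => //; apply: (measurable_wrt_sub (@PA_HS _)).
    by apply: Delta_PA; exact: ltnW (iT _).
  have N2 : L2 P (fun w => enorm (-1 *: Delta_ (n + k * M)%N w)).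
    under eq_fun do rewrite scaleN1r enormN.
    by apply: Delta_L2; exact: iT.
  have := h _ mN N2.
  have -> : E (fun w => dot (g_ (n + k * M) w - grad_ (n + k * M) w)
      (-1 *: Delta_ (n + k * M)%N w)) =
      - E (fun w => dot (err (n + k * M) w) (Delta_ (n + k * M)%N w)).
    rewrite -[RHS]mulN1r -meanZ//; congr Rintegral; apply/funext => w.
    by rewrite dotZr.
  move=> /le_trans; apply; apply: ler_wpM2l => //.
  rewrite -[leRHS](mean_cst P); apply: mean_le; [|exact: L2_L1|exact: L1_cst].
  by apply: aeW => w; rewrite scaleN1r enormN.
have E4 : E S_e <= b * M%:R + B * Num.sqrt M%:R by exact: block_drift.
rewrite E1; have E2' := ler_wpM2l (divr_ge0 (ltW eta0) (ler0n R 2)) E2.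
have E4' := ler_wpM2l (ltW D0) E4.
by move: E2' E3 E4'; rewrite !mulN1r; lra.
Qed.

Lemma block_sum w : \sum_((k * M).+1 <= t < (k.+1 * M).+1) zo_y p F z t w =
  \sum_(n < M) y_ (n + k * M).+1 w.
Proof.
rewrite big_add1 /= -[in X in \sum_(X <= _ < _) _](add0n (k * M)%N).
by rewrite big_addn mulSn addnK big_mkord.
Qed.

Let x_drift n w : enorm (x_ (n + k * M) w - x_ (k * M) w) <= n%:R * D.
Proof.
elim: n => [|n IH]; first by rewrite add0n subrr enorm0 mul0r.
rewrite addSn x_S addrAC (le_trans (enormD _ _))// -natr1 mulrDl mul1r.
exact: lerD.
Qed.

(** Consecutive points of a block differ by at most [D], and [M * D = delta]. *)
Let y_near_start :
  {ae P, forall w, forall n : 'I_M, enorm (y_ (n + k * M).+1 w - x_ (k * M) w) <= delta}.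
Proof.
have : {ae P, forall w, forall n, (n < M)%N -> 0 <= draw_s z (n + k * M).+1 w <= 1}.
  apply: ae_foralln => n; case: (ltnP n M) => nM; last by apply: aeW.
  by apply: filterS (s_ae (iT nM)) => w + _.
apply: filterS => w sw n; rewrite y_S addrAC (le_trans (enormD _ _))//.
rewrite (le_trans (lerD (x_drift n w) (scaled_Delta_le _ _ (sw n (ltn_ord n)))))//.
rewrite -{2}[D]mul1r -mulrDl natr1 mulrCA ler_piMr ?(ltW delta0)//.
by rewrite ler_pdivrMr ?ltr0n// mul1r ler_nat.
Qed.

Let block_out w := enorm (grad f (M%:R^-1 *: \sum_(n < M) y_ (n + k * M).+1 w)).

Lemma block_out_wrt : measurable_wrt (PA T) block_out.
Proof.
apply: measurable_enorm; apply: (measurableT_comp mgrad); apply: measurable_rVZ => //.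
apply: measurable_rV_sum => n.
apply: (measurable_wrt_sub _ (y_PA (iT (ltn_ord n)))).
by apply: PA_mono; exact: iT.
Qed.

Lemma block_out_bound :
  E block_out <= M%:R^-1 * E (fun w => enorm (\sum_(n < M) grad_ (n + k * M) w)) + b.
Proof.
have lV : L1 P (fun w => enorm (\sum_(n < M) grad_ (n + k * M) w)).
  apply: enorm_sum_L1 => n; first by apply: mgrad_O; exact: iT.
  by apply: L2_L1; apply: grad_L2; exact: iT.
rewrite -meanZ// -[X in _ + X](mean_cst P) -meanD//; [|exact: L1Z|exact: L1_cst].
apply: mean_le.
- apply: filterS y_near_start => w near.
  apply: le_trans (grad_average f2 LH0 fH M0 near) _.
  by rewrite enormZ ger0_norm ?invr_ge0.
- apply: (@L1_bdd _ _ _ _ _ L); first exact: (PA_O (leqnn _) block_out_wrt).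
  by apply: aeW => w; rewrite ger0_norm ?enorm_ge0//; exact: grad_le.
- by apply: L1D; [exact: L1Z|exact: L1_cst].
Qed.

End block.

Let h j w := enorm (grad f (M%:R^-1 *:
  \sum_((j.-1 * M).+1 <= t < (j * M).+1) zo_y p F z t w)).

Let hE k w : (k < K)%N -> h k.+1 w =
  enorm (grad f (M%:R^-1 *: \sum_(n < M) y_ (n + k * M).+1 w)).
Proof. by move=> kK; rewrite /h /= block_sum. Qed.

(** The decreases of [f] telescope over the blocks; of the three terms [b], one is
the bias against the increments, one the bias against the comparator, and one
comes from evaluating the gradient at the mean of a block. *)
Lemma expected_gradient_bound :
  ('E_P[fun w => enorm (grad f (zo_output p F z w))] <=
   (gamma / (delta * K%:R) + D / (2 * eta * M%:R) + eta * B ^+ 2 / (2 * D)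
    + B * Num.sqrt M%:R / M%:R + 3 * (LH * delta ^+ 2 / 2))%:E)%E.
Proof.
have MP : 0 < M%:R :> R by rewrite ltr0n.
have KP : 0 < K%:R :> R by rewrite ltr0n.
rewrite unlock.
have -> : (fun w => (enorm (grad f (zo_output p F z w)))%:E) =
  (fun w => (h (draw_k z w) w)%:E) by [].
have hm j : (0 < j <= K)%N -> measurable_wrt (PA T) (h j).
  case: j => // j jK; rewrite (_ : h j.+1 = (fun w =>
    enorm (grad f (M%:R^-1 *: \sum_(n < M) y_ (n + j * M).+1 w)))).
    exact: block_out_wrt.
  by apply/funext => w; rewrite hE.
apply: le_trans (uniform_choice_expectation (PA_measurable (leqnn T)) K0
  (zo_law_k law) (fun j w => enorm_ge0 _) (fun j w => grad_le L0 fL f2 _) hm) _.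
rewrite lee_fin big_add1 big_mkord.
pose C0 := (D ^+ 2 / (2 * eta) + eta / 2 * (M%:R * B ^+ 2))
  + M%:R * (b * D) + D * (b * M%:R + B * Num.sqrt M%:R).
have step (k : 'I_K) : E (h k.+1) <=
    (D * M%:R)^-1 * (fx (k * M) - fx (k.+1 * M) + C0) + b.
  have -> : E (h k.+1) = E (fun w =>
      enorm (grad f (M%:R^-1 *: \sum_(n < M) y_ (n + k * M).+1 w))).
    by congr Rintegral; apply/funext => w; rewrite hE.
  apply: le_trans (block_out_bound (ltn_ord k)) _; rewrite lerD2r.
  have DM0 : 0 < D * M%:R by exact: mulr_gt0.
  rewrite -(ler_pM2l DM0) [leRHS]mulrA divff ?gt_eqF// mul1r.
  rewrite -[D * _ * _]mulrA [M%:R * _]mulrA divff ?gt_eqF// mul1r.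
  by apply: le_trans (block_bound (ltn_ord k)) _; rewrite /C0 !addrA.
have tele : \sum_(k < K) (fx (k * M) - fx (k.+1 * M)) <= gamma.
  have -> : \sum_(k < K) (fx (k * M) - fx (k.+1 * M)) =
      - \sum_(0 <= k < K) (fx (k.+1 * M) - fx (k * M)).
    by rewrite big_mkord -sumrN; apply: eq_bigr => k _; rewrite opprB.
  rewrite (telescope_sumr (fun k => fx (k * M)))// opprB mul0n.
  have -> : fx 0 = f 0 by rewrite /fx /x_ /= mean_cst.
  rewrite -[X in X - _](mean_cst P) -meanB ?fx_L1//; last exact: L1_cst.
  rewrite -[leRHS](mean_cst P); apply: mean_le; [exact: aeW| |exact: L1_cst].
  by apply: L1B; [exact: L1_cst|exact: fx_L1].
have DM0 : 0 <= (D * M%:R)^-1 by rewrite invr_ge0 ltW// mulr_gt0.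
apply: (@le_trans _ _ (K%:R^-1 * ((D * M%:R)^-1 * (gamma + K%:R * C0) + K%:R * b))).
  rewrite ler_pM2l ?invr_gt0//.
  apply: le_trans (ler_sum _ (fun k _ => step k)) _.
  rewrite big_split/= sumr_const card_ord [K%:R * b]mulr_natl lerD2r.
  rewrite -mulr_sumr; apply: ler_wpM2l => //.
  by rewrite big_split/= sumr_const card_ord [K%:R * C0]mulr_natl lerD2r.
rewrite le_eqVlt; apply/orP; left; apply/eqP; rewrite /C0 /b; field.
by rewrite !gt_eqF.
Qed.

End algorithm.

(** * Choice of the parameters *)

Lemma powRN92 (R : realType) (x : R) : 0 <= x ->
  x `^ (- (9 / 2)) = (Num.sqrt x ^+ 9)^-1.
Proof.
move=> x0; rewrite powRN (_ : 9 / 2 = 2^-1 * 9%:R); last by field.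
by rewrite powRrM powR12_sqrt// powR_mulrn ?sqrtr_ge0.
Qed.

Lemma stepsize_balance (R : realType) (D B m e : R) :
  0 < D -> 0 < B -> 0 < m -> e = D / (B * Num.sqrt m) ->
  D / (2 * e * m) + e * B ^+ 2 / (2 * D) + B * Num.sqrt m / m = 2 * B / Num.sqrt m.
Proof.
move=> D0 B0 m0 ->; set r := Num.sqrt m.
have r0 : 0 < r by rewrite sqrtr_gt0.
have -> : m = r ^+ 2 by rewrite sqr_sqrtr// ltW.
by field; rewrite !gt_eqF.
Qed.

Theorem theorem4p2 (R : realType) (gamma sigma L LH : R) :
  0 <= sigma -> 0 < L -> 0 < LH ->
  exists C eps0 : R, [/\ 0 < C, 0 < eps0 &
  forall (opt : zo_option) (d : nat) (eps : R),
    (0 < d)%N -> 0 < eps -> eps <= eps0 ->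
  exists (M K : nat) (eta : R),
    let p := ZOInput opt (Num.sqrt (eps / (2 * LH))) M K eta in
    [/\ (0 < M)%N, (0 < K)%N, 0 < eta,
        (szo_calls p)%:R <= C * d%:R ^+ 2 * eps `^ (- (9 / 2)) &
        forall (dX : measure_display) (X : measurableType dX)
          (f : 'rV[R]_d -> R) (F : 'rV[R]_d -> X -> R)
          (Xi : R.-pker 'rV[R]_d ~> X),
          has_lbound (range f) ->
          f 0 - inf (range f) = gamma ->
          (forall x y, `|f x - f y| <= L * enorm (x - y)) ->
          twice_differentiable f ->
          (forall x y, opnorm (hess f x - hess f y) <= LH * enorm (x - y)) ->
          is_szo f F Xi sigma ->
        forall (dO : measure_display) (Omega : measurableType dO)
          (P : probability Omega R) (mu : probability 'rV[R]_d R)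
          (z : zo_draws R d X Omega),
          uniform_on_sphere mu ->
          zo_sampling P mu F Xi p z ->
          ('E_P[fun w => enorm (grad f (zo_output p F z w))] <= eps%:E)%E]].
Proof.
move=> sigma0 L0 LH0.
pose kappa := Num.sqrt (2 * LH).
have kappa0 : 0 < kappa by rewrite sqrtr_gt0 mulr_gt0.
have kappa2 : kappa ^+ 2 = 2 * LH by rewrite sqr_sqrtr// mulr_ge0// ltW.
(* [c * d ^+ 2 / eps] dominates the second moment of the estimators once the
   radius is inserted, for [1 <= d] and [eps <= 1]. *)
pose c := 116 * L ^+ 2 + 36 * sigma ^+ 2 * LH.
have c0 : 0 < c.
  by rewrite ltr_pwDl ?mulr_gt0 ?exprn_gt0// mulr_ge0 ?(ltW LH0)// mulr_ge0// sqr_ge0.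
pose CK := 8 * `|gamma| * kappa + 1; pose CM := 256 * c + 1.
have CK0 : 0 < CK by rewrite ltr_wpDl// !mulr_ge0// ltW.
have CM0 : 0 < CM by rewrite ltr_wpDl// mulr_ge0// ltW.
exists (2 * (CM * CK)), 1; split => //; first by rewrite !mulr_gt0.
move=> opt d eps d0 eps0 eps1.
pose s := Num.sqrt eps.
have s0 : 0 < s by rewrite sqrtr_gt0.
have s2 : s ^+ 2 = eps by rewrite sqr_sqrtr// ltW.
have s1 : s <= 1 by rewrite -sqrtr1 ler_sqrt.
pose delta := Num.sqrt (eps / (2 * LH)).
have deltaE : delta = s / kappa.
  by rewrite /delta sqrtrM ?(ltW eps0)// sqrtrV// mulr_ge0// ltW.
have delta0 : 0 < delta by rewrite deltaE divr_gt0.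
have dd1 : 1 <= d%:R :> R by rewrite ler1n.
have ddp : 0 < d%:R :> R by rewrite ltr0n.
pose B := Num.sqrt (c * d%:R ^+ 2 / eps).
have B2 : B ^+ 2 = c * d%:R ^+ 2 / eps.
  by rewrite sqr_sqrtr// divr_ge0 ?(ltW eps0)// mulr_ge0 ?sqr_ge0// ltW.
have B0 : 0 < B by rewrite sqrtr_gt0 divr_gt0// mulr_gt0// exprn_gt0.
(* The budget is [eps / 8] for [2 * B / sqrt M], [eps / 8] for [gamma / (delta * K)],
   and [3 * eps / 4] for the three terms [LH * delta ^+ 2 / 2 = eps / 4]. *)
pose M := (Num.truncn (256 * B ^+ 2 / eps ^+ 2)).+1.
pose K := (Num.truncn (8 * `|gamma| / (delta * eps))).+1.
have M_ge : 256 * B ^+ 2 / eps ^+ 2 <= M%:R by rewrite ltW// truncnS_gt.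
have K_ge : 8 * `|gamma| / (delta * eps) <= K%:R by rewrite ltW// truncnS_gt.
have trunc_le (x : R) : 0 <= x -> (Num.truncn x).+1%:R <= x + 1.
  by move=> x0; rewrite -natr1 lerD2r truncn_le.
have sn (n : nat) : s ^+ n <= 1 by rewrite exprn_ile1// ltW.
have M_le : M%:R <= CM * d%:R ^+ 2 / s ^+ 6.
  apply: le_trans (trunc_le _ _) _.
    by rewrite divr_ge0 ?sqr_ge0// mulr_ge0// sqr_ge0.
  rewrite B2 -s2 (_ : 256 * _ / _ = 256 * c * d%:R ^+ 2 / s ^+ 6); last first.
    by field; rewrite gt_eqF.
  have -> : CM * d%:R ^+ 2 / s ^+ 6 = 256 * c * d%:R ^+ 2 / s ^+ 6 + d%:R ^+ 2 / s ^+ 6.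
    by rewrite /CM; field; rewrite gt_eqF.
  rewrite lerD2l ler_pdivlMr ?exprn_gt0// mul1r.
  by rewrite (le_trans (sn _))// exprn_ege1.
have K_le : K%:R <= CK / s ^+ 3.
  apply: le_trans (trunc_le _ _) _.
    by rewrite divr_ge0 ?mulr_ge0// ltW.
  rewrite deltaE -s2 (_ : 8 * _ / _ = 8 * `|gamma| * kappa / s ^+ 3); last first.
    by field; rewrite !gt_eqF.
  have -> : CK / s ^+ 3 = 8 * `|gamma| * kappa / s ^+ 3 + 1 / s ^+ 3.
    by rewrite /CK; field; rewrite gt_eqF.
  by rewrite lerD2l ler_pdivlMr ?exprn_gt0// mul1r.
have MP : 0 < M%:R :> R by rewrite ltr0n.
have KP : 0 < K%:R :> R by rewrite ltr0n.
pose D := delta / M%:R; pose eta := D / (B * Num.sqrt M%:R).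
have D0 : 0 < D by rewrite divr_gt0.
have eta0 : 0 < eta by rewrite divr_gt0// mulr_gt0// sqrtr_gt0.
exists M, K, eta => p; split => //.
  rewrite powRN92 ?(ltW eps0)// -/s.
  (* Option II makes [1 + K * M <= 2 * (K * M)] calls. *)
  have calls : (szo_calls p <= 2 * (M * K))%N.
    rewrite /szo_calls /p /horizon /=; case: (opt); first by rewrite [(K * _)%N]mulnC.
    by rewrite mul2n -addnn [(K * _)%N]mulnC leq_add2r muln_gt0.
  rewrite (@le_trans _ _ (2 * (M%:R * K%:R)))//.
    by rewrite -!natrM ler_nat.
  have -> : 2 * (CM * CK) * d%:R ^+ 2 / s ^+ 9 =
      2 * ((CM * d%:R ^+ 2 / s ^+ 6) * (CK / s ^+ 3)).
    by field; rewrite gt_eqF.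
  by rewrite ler_pM2l// ler_pM// ltW.
move=> dX X f F Xi lb gap fL f2 fH szo dO Omega P mu z muS law.
have fgap x : f 0 - f x <= gamma.
  by rewrite -gap lerD2l lerN2; apply: ge_inf => //; exists x.
have Q0B : 2 * (57 * (d%:R * L) ^+ 2 + 9 * (d%:R / Defs.radius p * sigma) ^+ 2)
    + 2 * L ^+ 2 <= B ^+ 2.
  rewrite B2 [Defs.radius p]/= -/delta deltaE -s2.
  have -> : 2 * (57 * (d%:R * L) ^+ 2 + 9 * (d%:R / (s / kappa) * sigma) ^+ 2)
      + 2 * L ^+ 2 = 114 * d%:R ^+ 2 * L ^+ 2 + 2 * L ^+ 2
      + 18 * d%:R ^+ 2 * sigma ^+ 2 * kappa ^+ 2 / s ^+ 2.
    by field; rewrite !gt_eqF.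
  rewrite kappa2.
  have -> : c * d%:R ^+ 2 / s ^+ 2 = 116 * (d%:R ^+ 2 * L ^+ 2 / s ^+ 2)
      + 18 * d%:R ^+ 2 * sigma ^+ 2 * (2 * LH) / s ^+ 2.
    by rewrite /c; field; rewrite gt_eqF.
  rewrite lerD2r.
  have h1 : L ^+ 2 <= d%:R ^+ 2 * L ^+ 2.
    by rewrite ler_peMl ?sqr_ge0// exprn_ege1.
  have h2 : d%:R ^+ 2 * L ^+ 2 <= d%:R ^+ 2 * L ^+ 2 / s ^+ 2.
    by rewrite ler_pdivlMr ?exprn_gt0// ler_piMr// mulr_ge0// sqr_ge0.
  by lra.
have := expected_gradient_bound d0 muS (ltW L0) fL f2 (ltW LH0) fH szo law
  delta0 isT isT eta0 B0 Q0B fgap.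
move=> /le_trans; apply; rewrite lee_fin [Defs.radius p]/= -/delta
  [block_length p]/= [num_blocks p]/= [stepsize p]/= -/D.
have bE : LH * delta ^+ 2 / 2 = eps / 4.
  by rewrite deltaE expr_div_n kappa2 s2; field; rewrite gt_eqF.
have bal : D / (2 * eta * M%:R) + eta * B ^+ 2 / (2 * D) + B * Num.sqrt M%:R / M%:R
    <= eps / 8.
  rewrite (stepsize_balance D0 B0 MP (erefl eta)).
  rewrite ler_pdivrMr ?sqrtr_gt0//.
  have : 16 * B / eps <= Num.sqrt M%:R.
    rewrite -[leLHS]ger0_norm; last by rewrite divr_ge0 ?(ltW eps0)// mulr_ge0// ltW.
    rewrite -sqrtr_sqr ler_sqrt//; apply: le_trans M_ge.
    by rewrite le_eqVlt; apply/orP; left; apply/eqP; field; rewrite gt_eqF.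
  rewrite ler_pdivrMr// mulrC; lra.
have blocks : gamma / (delta * K%:R) <= eps / 8.
  rewrite ler_pdivrMr ?mulr_gt0//; apply: le_trans (ler_norm _) _.
  move: K_ge; rewrite ler_pdivrMr ?mulr_gt0//.
  set a := `|gamma|; set k := K%:R => h.
  have -> : eps / 8 * (delta * k) = k * (delta * eps) / 8 by ring.
  by lra.
rewrite bE; move: bal blocks.
set a := gamma / _; set t1 := D / _; set t2 := _ / (2 * D); set t3 := _ / M%:R.
lra.
Qed.
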